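(* Let $\Theta\in(0,\infty)^N$. A field $X=\{X(t)\}_{t\in\mathbb{R}^N}$ is stationary if and only if there is $G\in\mathcal G_{\Theta,0}$ such that $X$ is the (unique up to equivalence with respect to $\Theta$) solution of the Langevin equation $$\sum_{u\subseteq\{1,\dots,N\}}\prod_{i\in u}\theta_i\,d_{-u}X(t)\,dt_u=dG(t)$$ with initial condition $X(0)=\int_{-\infty}^0e^{\Theta\cdot u}dG(u)$, namely $$X(t)=\big((\mathcal L_\Theta^{-1}\circ\mathcal M_\Theta^{-1})(G)\big)(t)=e^{-\Theta\cdot t}\int_{-\infty}^te^{\Theta\cdot u}\,dG(u).$$ Moreover, the field $G$ in this representation is unique (modulo the equivalence $\sim$ on $\mathcal G_{\Theta,0}$) and given by $G=(\mathcal M_\Theta\circ\mathcal L_\Theta)(X)$.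
   Context: All random fields are assumed to have almost surely continuous sample functions. Notation: for $u\subseteq\{1,\dots,N\}$ (listed increasingly), $t_u=(t_i)_{i\in u}$, $-u$ the complement, $(s_u:t_{-u})$ the vector with entries $s_i$ for $i\in u$ and $t_i$ otherwise; $e^t=(e^{t_1},\dots,e^{t_N})$, $\Theta\cdot t=\sum\theta_it_i$, $\tilde t_l=-\sum_{k\ne l}t_k$. Rectangular increments: $[X]_s^t=\sum_v(-1)^{|v|}X(s_v:t_{-v})$, $[X(r)]_{s_u}^{t_u}=\sum_{w\subseteq u}(-1)^{|w|}X(r_{-u}:s_w:t_{u-w})$. Multiple Riemann–Stieltjes integrals are limits of $\sum_Ig(\xi_I)[G]_{\underline I}^{\overline I}$ over grid partitions with mesh $\to0$ and arbitrary tags. The Langevin equation is understood in the integrated multiple Riemann–Stieltjes sense: $\sum_u\prod_{i\in u}\theta_i\int_{0_u}^{t_u}[X(r)]_{0_{-u}}^{t_{-u}}dr_u=[G]_0^t$ for all $t$, with $d_\emptyset X=X$. Two fields $X,Y$ are equivalent with respect to $\Theta$ if $Z(t)=e^{\Theta\cdot t}[X(t)-Y(t)]$ satisfies $[Z]_s^t=0$ for all $s,t$. Stationarity: $\{X(t+s)\}_t\overset{\text{law}}{=}\{X(t)\}_t$ for all $s$. $\Theta$-self-similar: $\{Y(e^{t+s})\}_t\overset{\text{law}}{=}\{e^{\Theta\cdot s}Y(e^t)\}_t$ for all $s$. Lamperti: $(\mathcal L_\Theta X)(e^t)=e^{\Theta\cdot t}X(t)$, $(\mathcal L_\Theta^{-1}Y)(t)=e^{-\Theta\cdot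 t}Y(e^t)$. If $\sum_lt_l\ge0$: $T_v(t)=\{x\in\mathbb{R}^{|v|}:x_l\le t_{v_l}\ \forall l,\ \sum_lx_l+\sum_{i\notin v}t_i\ge0\}$; if $\sum_lt_l<0$: $T_v(t)=\{x:x_l\ge t_{v_l}\ \forall l,\ \sum_lx_l+\sum_{i\notin v}t_i\le0\}$. $(\mathcal M_\Theta Y)(t)=e^{-\Theta\cdot t}Y(e^t)-\frac1N\sum_{l=1}^Ne^{-\Theta\cdot(t_{-l}:\tilde t_l)}Y(e^{t_{-l}:\tilde t_l})+\sum_{\emptyset\ne v}\epsilon_v(t)\prod_{j\in v}\theta_j\int_{T_v(t)}e^{-\Theta\cdot(t_{-v}:u_v)}Y(e^{t_{-v}:u_v})du_v$ with $\epsilon_v(t)=1$ if $\sum_lt_l\ge0$ and $(-1)^{|v|}$ otherwise; $(\mathcal M_\Theta^{-1}G)(e^t)=\int_{-\infty}^te^{\Theta\cdot u}dG(u)$. Stationary increments: for all $n,h,s^{(k)},t^{(k)}$ the laws of $([G]_{s^{(k)}+h}^{t^{(k)}+h})_k$ and $([G]_{s^{(k)}}^{t^{(k)}})_k$ coincide. $\mathcal G_\Theta$: stationary increment fields $G$ with $\lim_{s\to\infty}\int_{(-s,\dots,-s)}^te^{\Theta\cdot u}dG(u)$ converging in probability to an a.s. finite limit (denoted $\int_{-\infty}^t$) for all $t$. $\mathcal G_{\Theta,0}$: those with $G(t)=0$ whenever $\sum_lt_l=0$; $\tilde G\sim G$ if $\tilde G-G=\sum_{v\ne\emptyset,|v|\ne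 N}f^{(v)}(t_v)$ with $f^{(v)}$ depending only on $t_v$ and this difference vanishing on $\{\sum_lt_l=0\}$.
   Formalization: The tags in the multiple Riemann–Stieltjes sums are taken as products of one-dimensional tags, not chosen independently in each cell; with independent tags the integral of e^{Θ·u} fails to exist for rough G (N=2, Ornstein–Uhlenbeck sheet), so the ''only if'' part would be false. *)

(* Defs.v *)
From HB Require Import structures.
From mathcomp Require Import all_boot all_order all_algebra.
From mathcomp Require Import all_classical all_reals all_analysis.
Set Implicit Arguments. Unset Strict Implicit. Unset Printing Implicit Defensive.
Import Order.TTheory GRing.Theory Num.Theory.
Local Open Scope classical_set_scope.
Local Open Scope ring_scope.

Definition merge (R : realType) (N : nat) (v : {set 'I_N}) (s t : 'I_N -> R)
  : 'I_N -> R := fun i => if i \in v then s i else t i.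

Definition dotv (R : realType) (N : nat) (th t : 'I_N -> R) : R :=
  \sum_(i < N) th i * t i.

Definition expv (R : realType) (N : nat) (t : 'I_N -> R) : 'I_N -> R :=
  fun i => expR (t i).

Definition shiftv (R : realType) (N : nat) (t h : 'I_N -> R) : 'I_N -> R :=
  fun i => t i + h i.

Definition zerov (R : realType) (N : nat) : 'I_N -> R := fun _ => 0.

Definition incr_part (R : realType) (N : nat) (F : ('I_N -> R) -> R)
  (v : {set 'I_N}) (r s t : 'I_N -> R) : R :=
  \sum_(w : {set 'I_N} | w \subset v)
     (-1) ^+ #|w| * F (merge v (merge w s t) r).

Definition rect_incr (R : realType) (N : nat) (F : ('I_N -> R) -> R)
  (s t : 'I_N -> R) : R := incr_part F [set: 'I_N]%SET s s t.

Definition is_grid (R : realType) (N : nat) (u : {set 'I_N}) (s t : 'I_N -> R)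
  (m : 'I_N -> nat) (p xi : 'I_N -> nat -> R) : Prop :=
  forall i, i \in u ->
    [/\ (0 < m i)%N, p i 0%N = s i, p i (m i) = t i &
     forall j, (j < m i)%N ->
       [/\ (s i <= t i -> p i j <= p i j.+1),
           (t i <= s i -> p i j.+1 <= p i j) &
           Num.min (p i j) (p i j.+1) <= xi i j <= Num.max (p i j) (p i j.+1)]].

Definition mesh_lt (R : realType) (N : nat) (u : {set 'I_N}) (delta : R)
  (m : 'I_N -> nat) (p : 'I_N -> nat -> R) : Prop :=
  forall i, i \in u -> forall j, (j < m i)%N -> `|p i j.+1 - p i j| < delta.

(* Riemann--Stieltjes sum: sum over cells of g(tag) * incr(lower, upper).
   Coordinates outside u are not partitioned (only cell index 0). *)
Definition RSsum (R : realType) (N : nat) (u : {set 'I_N})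
  (g : ('I_N -> R) -> R) (incr : ('I_N -> R) -> ('I_N -> R) -> R)
  (m : 'I_N -> nat) (p xi : 'I_N -> nat -> R) : R :=
  \sum_(k : {ffun 'I_N -> 'I_(\max_(i < N) m i).+1} |
          [forall i, if i \in u then (k i < m i)%N else k i == ord0])
     g (fun i => xi i (k i)) *
     incr (fun i => p i (k i)) (fun i => p i (k i).+1).

Definition RSint (R : realType) (N : nat) (u : {set 'I_N}) (s t : 'I_N -> R)
  (g : ('I_N -> R) -> R) (incr : ('I_N -> R) -> ('I_N -> R) -> R) (I : R)
  : Prop :=
  forall eps : R, 0 < eps -> exists2 delta : R, 0 < delta &
    forall m p xi, is_grid u s t m p xi -> mesh_lt u delta m p ->
      `|RSsum u g incr m p xi - I| < eps.

Definition leb_incr (R : realType) (N : nat) (u : {set 'I_N})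
  (a b : 'I_N -> R) : R := \prod_(i in u) (b i - a i).

Definition cont_path (R : realType) (N : nat) (f : ('I_N -> R) -> R) : Prop :=
  forall (t : 'I_N -> R) (eps : R), 0 < eps -> exists2 delta : R, 0 < delta &
    forall s : 'I_N -> R, (forall i, `|s i - t i| < delta) -> `|f s - f t| < eps.

Definition is_field (R : realType) (N : nat) (d : measure_display)
  (Omega : measurableType d) (P : probability Omega R)
  (X : ('I_N -> R) -> Omega -> R) : Prop :=
  (forall t, measurable_fun setT (X t)) /\
  {ae P, forall w, cont_path (fun t => X t w)}.

Definition same_law (R : realType) (d : measure_display)
  (Omega : measurableType d) (P : probability Omega R) (n : nat)
  (A B : 'I_n -> Omega -> R) : Prop :=
  forall x : 'I_n -> R,
    P [set w | forall k, A k w <= x k] = P [set w | forall k, B k w <= x k].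

Definition stationary (R : realType) (N : nat) (d : measure_display)
  (Omega : measurableType d) (P : probability Omega R)
  (X : ('I_N -> R) -> Omega -> R) : Prop :=
  forall (s : 'I_N -> R) (n : nat) (ts : 'I_n -> 'I_N -> R),
    same_law P (fun k => X (shiftv (ts k) s)) (fun k => X (ts k)).

Definition stat_incr (R : realType) (N : nat) (d : measure_display)
  (Omega : measurableType d) (P : probability Omega R)
  (G : ('I_N -> R) -> Omega -> R) : Prop :=
  forall (n : nat) (h : 'I_N -> R) (s t : 'I_n -> 'I_N -> R),
    same_law P
      (fun k w => rect_incr (fun x => G x w) (shiftv (s k) h) (shiftv (t k) h))
      (fun k w => rect_incr (fun x => G x w) (s k) (t k)).

Definition expint_lim (R : realType) (N : nat) (d : measure_display)
  (Omega : measurableType d) (P : probability Omega R) (Theta : 'I_N -> R)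
  (G : ('I_N -> R) -> Omega -> R) (t : 'I_N -> R) (L : Omega -> R) : Prop :=
  measurable_fun setT L /\
  exists J : R -> Omega -> R,
    (forall s, measurable_fun setT (J s)) /\
    (forall s, {ae P, forall w,
        RSint [set: 'I_N]%SET (fun _ => - s) t (fun u => expR (dotv Theta u))
          (fun a b => rect_incr (fun x => G x w) a b) (J s w)}) /\
    (forall eps : R, 0 < eps ->
        (fun s => P [set w | eps <= `|J s w - L w|]) @ +oo --> 0%E).

Definition GTheta (R : realType) (N : nat) (d : measure_display)
  (Omega : measurableType d) (P : probability Omega R) (Theta : 'I_N -> R)
  (G : ('I_N -> R) -> Omega -> R) : Prop :=
  [/\ is_field P G, stat_incr P G &
      forall t, exists L, expint_lim P Theta G t L].

Definition GTheta0 (R : realType) (N : nat) (d : measure_display)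
  (Omega : measurableType d) (P : probability Omega R) (Theta : 'I_N -> R)
  (G : ('I_N -> R) -> Omega -> R) : Prop :=
  GTheta P Theta G /\
  {ae P, forall w, forall t : 'I_N -> R, \sum_(i < N) t i = 0 -> G t w = 0}.

Definition equivG (R : realType) (N : nat) (d : measure_display)
  (Omega : measurableType d) (P : probability Omega R)
  (G G' : ('I_N -> R) -> Omega -> R) : Prop :=
  exists f : {set 'I_N} -> ('I_N -> R) -> Omega -> R,
    (forall (v : {set 'I_N}) (t t' : 'I_N -> R) (w : Omega),
       (forall i, i \in v -> t i = t' i) -> f v t w = f v t' w) /\
    {ae P, forall w, forall t,
        G' t w - G t w = \sum_(v : {set 'I_N} | (v != finset.set0) && (#|v| != N)) f v t w} /\
    {ae P, forall w, forall t : 'I_N -> R, \sum_(i < N) t i = 0 ->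
        \sum_(v : {set 'I_N} | (v != finset.set0) && (#|v| != N)) f v t w = 0}.

(* the Langevin equation, integrated multiple RS sense, on a sample path:
   sum_u prod_{i in u} theta_i int_{0_u}^{t_u} [X(r)]_{0_{-u}}^{t_{-u}} dr_u
     = [G]_0^t  for all t *)
Definition langevin_path (R : realType) (N : nat) (Theta : 'I_N -> R)
  (x g : ('I_N -> R) -> R) : Prop :=
  forall t : 'I_N -> R, exists I : {set 'I_N} -> R,
    (forall u : {set 'I_N},
       RSint u (@zerov R N) t (fun r => incr_part x (~: u) r (@zerov R N) t)
             (leb_incr u) (I u)) /\
    \sum_(u : {set 'I_N}) (\prod_(i in u) Theta i) * I u
      = rect_incr g (@zerov R N) t.

Definition solves (R : realType) (N : nat) (d : measure_display)
  (Omega : measurableType d) (P : probability Omega R) (Theta : 'I_N -> R)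
  (X G : ('I_N -> R) -> Omega -> R) : Prop :=
  {ae P, forall w, langevin_path Theta (fun x => X x w) (fun x => G x w)}.

Definition init_cond (R : realType) (N : nat) (d : measure_display)
  (Omega : measurableType d) (P : probability Omega R) (Theta : 'I_N -> R)
  (X G : ('I_N -> R) -> Omega -> R) : Prop :=
  exists L, expint_lim P Theta G (@zerov R N) L /\
            {ae P, forall w, X (@zerov R N) w = L w}.

Definition represents (R : realType) (N : nat) (d : measure_display)
  (Omega : measurableType d) (P : probability Omega R) (Theta : 'I_N -> R)
  (X G : ('I_N -> R) -> Omega -> R) : Prop :=
  forall t : 'I_N -> R, exists L, expint_lim P Theta G t L /\
    {ae P, forall w, X t w = expR (- dotv Theta t) * L w}.

Definition equivTheta (R : realType) (N : nat) (d : measure_display)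
  (Omega : measurableType d) (P : probability Omega R) (Theta : 'I_N -> R)
  (X Y : ('I_N -> R) -> Omega -> R) : Prop :=
  {ae P, forall w, forall s t : 'I_N -> R,
     rect_incr (fun x => expR (dotv Theta x) * (X x w - Y x w)) s t = 0}.

(* (L_Theta X)(e^t) = e^{Theta.t} X(t), i.e. (L_Theta X)(x) = x^Theta X(ln x)
   for x in (0,oo)^N (values at other points are irrelevant). *)
Definition lamperti (R : realType) (N : nat) (Omega : Type) (Theta : 'I_N -> R)
  (X : ('I_N -> R) -> Omega -> R) : ('I_N -> R) -> Omega -> R :=
  fun x w => expR (dotv Theta (fun i => ln (x i))) * X (fun i => ln (x i)) w.

Definition tildev (R : realType) (N : nat) (t : 'I_N -> R) (l : 'I_N)
  : 'I_N -> R :=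
  fun i => if i == l then - \sum_(k < N | k != l) t k else t i.

Definition inT (R : realType) (N : nat) (v : {set 'I_N}) (t x : 'I_N -> R)
  : bool :=
  if 0 <= \sum_(i < N) t i then
    [forall i in v, x i <= t i] &&
    (0 <= \sum_(i in v) x i + \sum_(i in ~: v) t i)
  else
    [forall i in v, t i <= x i] &&
    (\sum_(i in v) x i + \sum_(i in ~: v) t i <= 0).

Definition epsv (R : realType) (N : nat) (v : {set 'I_N}) (t : 'I_N -> R) : R :=
  if 0 <= \sum_(i < N) t i then 1 else (-1) ^+ #|v|.

(* int_{T_v(t)} f(t_{-v} : u_v) du_v, as the Riemann integral of
   f * 1_{T_v(t)} over the box (in the coordinates v) between t_v and
   t_v - (sum t), which contains T_v(t). *)
Definition regint (R : realType) (N : nat) (v : {set 'I_N}) (t : 'I_N -> R)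
  (f : ('I_N -> R) -> R) : R :=
  let S := \sum_(i < N) t i in
  xget 0 [set I | RSint v (fun i => Num.min (t i) (t i - S))
                          (fun i => Num.max (t i) (t i - S))
                    (fun r => if inT v t r then f (merge v r t) else 0)
                    (leb_incr v) I].

Definition Mop (R : realType) (N : nat) (Omega : Type) (Theta : 'I_N -> R)
  (Y : ('I_N -> R) -> Omega -> R) : ('I_N -> R) -> Omega -> R :=
  fun t w =>
    expR (- dotv Theta t) * Y (expv t) w
    - N%:R^-1 * \sum_(l < N) expR (- dotv Theta (tildev t l)) * Y (expv (tildev t l)) w
    + \sum_(v : {set 'I_N} | v != finset.set0)
        epsv v t * (\prod_(j in v) Theta j) *
        regint v t (fun x => expR (- dotv Theta x) * Y (expv x) w).

(* Main.v *)
(** Let [prim phi] be the antiderivative of phi vanishing at 0, and P_i this operation in the i-th coordinate.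
    Integration by parts in each coordinate shows that, for G merely continuous, the Riemann-Stieltjes integral
    of e^(Theta . u) dG(u) over [s, t] exists and is the increment over [s, t] of E_1 ... E_N G, where
    E_i G = e^(theta_i t_i) G - theta_i P_i(e^(theta_i t_i) G). Changing the sign of theta_i inverts E_i, and
    applying the inverse to e^(theta_i t_i) X gives X + theta_i P_i X. Hence the Langevin equation says that G and
    the product of the operators 1 + theta_i P_i at X have the same increments, equivalently that
    E_1 ... E_N G and e^(Theta . t) X do.

    The integral over T_v(t) is, up to the sign epsilon_v(t), the composition over i in v of the integrals from the
    hyperplane {sum t = 0} to t_i; each differs from P_i by a function not depending on t_i. So the
    field G = M(L(X)) solves the Langevin equation, and it vanishes on the hyperplane.

    All these operators are limits of finite linear combinations of values of the field and commute with
    translations modulo functions without increments. Therefore stationarity of X gives stationary increments of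
    G, and stationary increments of G give, for the increments J over [-r, t] of E_1 ... E_N G, equality in law of
    e^(- Theta . h) J(-r + h, t + h) and J(-r, t). In the limit r -> oo a change of the corner by h is
    negligible, because it only adds boxes with at least one side of fixed length near -r, whose J is in law
    of order e^(- c r); this yields stationarity of X. The limits also determine the increments of G, so two
    noises representing X differ by a function without increments, which is a sum of functions of fewer
    coordinates. *)
Require Import Defs.
From HB Require Import structures.
From mathcomp Require Import all_boot all_order all_algebra.
From mathcomp Require Import all_classical all_reals all_analysis.
From mathcomp Require Import measurable_realfun.
From mathcomp Require Import ring lra.
Set Implicit Arguments. Unset Strict Implicit. Unset Printing Implicit Defensive.
Import Order.TTheory GRing.Theory Num.Theory.
Import numFieldNormedType.Exports.
Local Open Scope classical_set_scope.
Local Open Scope ring_scope.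

(** * Antiderivatives *)

Section primitive.
Context {R : realType}.
Implicit Types (phi psi Phi : R -> R).

(** The integrator G need not have bounded variation, and a Riemann-Stieltjes sum in N coordinates
    iterates N one-dimensional sums. The error made in one coordinate has to survive the sums in the
    others, so each one-dimensional sum needs a Lipschitz constant in the sup norm that does not
    depend on the grid. For [exp_sum] summation by parts gives it, by moving the differences from G
    to the exponential. Identities hold modulo functions with zero increments ([null]). The
    Stieltjes operators fix constants and hence preserve [null]; this makes the base point 0 of
    [prim] harmless and absorbs the errors caused by translations and by projections to the
    hyperplane. Almost sure statements about uncountably many t are controlled by passing to
    versions all of whose paths are continuous. There the operators are limits of finite linear
    combinations with path-independent coefficients and nodes, which yields measurability and
    transfers equality of finite-dimensional laws. *)

Lemma derive_itv0_cst (f : R -> R) (a b : R) :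
  (forall x, a < x < b -> is_derive x (1 : R) f 0) ->
  forall x y, a < x < b -> a < y < b -> f x = f y.
Proof.
move=> df x y; wlog xy : x y / x <= y.
  by move=> H; case: (leP x y) => [/H // |/ltW yx hx hy]; rewrite (H y x).
move=> /andP[ax xb] /andP[ay yb].
have inab z : x <= z <= y -> a < z < b.
  by move=> /andP[xz zy]; rewrite (lt_le_trans ax xz) (le_lt_trans zy yb).
have [||c _] := @MVT_segment R f (fun=> 0) x y xy.
- by move=> z; rewrite in_itv/= => /andP[xz zy]; apply: df; apply: inab; rewrite !ltW.
- apply: derivable_within_continuous => z; rewrite in_itv/= => xzy.
  by have [] := df z (inab z xzy).
by rewrite mul0r => /eqP; rewrite subr_eq0 => /eqP.
Qed.

Definition antiderivative phi Phi :=
  (forall x, is_derive x (1 : R) Phi (phi x)) /\ Phi 0 = 0.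

Lemma antiderivative_unique phi Phi Psi :
  antiderivative phi Phi -> antiderivative phi Psi -> Phi = Psi.
Proof.
move=> [dP P0] [dQ Q0]; apply/funext => x.
apply/eqP; rewrite -subr_eq0; apply/eqP.
have E0 : (Phi - Psi) 0 = 0 by change (Phi 0 - Psi 0 = 0); rewrite P0 Q0 subr0.
transitivity ((Phi - Psi) 0) => //.
apply: (@is_derive_0_is_cst R (Phi - Psi) x 0) => y.
by rewrite -(subrr (phi y)); exact: is_deriveB.
Qed.

Lemma antiderivative_itv phi (n : R) : continuous phi -> 0 < n ->
  exists2 B : R -> R, B 0 = 0 &
    forall x, - n < x < n -> is_derive x (1 : R) B (phi x).
Proof.
move=> cphi n0.
pose A (x : R) := (\int[@lebesgue_measure R]_(t in [set` `[- n, x]]) (phi t))%R.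
have iphi : (@lebesgue_measure R).-integrable `[- n, n] (EFin \o phi).
  apply: continuous_compact_integrable; first exact: segment_compact.
  exact: continuous_subspaceT.
exists (fun x => A x - A 0); first by rewrite subrr.
move=> x /andP[nx xn].
have [dA Ax] := continuous_FTC1_closed xn iphi nx (cphi x).
rewrite -[phi x]subr0; apply: is_deriveB.
apply: DeriveDef; first exact: dA.
by rewrite -derive1E.
Qed.

(** Antiderivatives on the intervals from [- k.+1] to [k.+1] are glued. Two of them vanish at 0 and
    have equal derivatives, so they agree on the smaller interval; at [x] the piece of index
    [truncn |x|] is used. *)
Lemma antiderivative_exists phi : continuous phi -> exists Phi, antiderivative phi Phi.
Proof.
move=> cphi.
have npos (k : nat) : 0 < k.+1%:R :> R by rewrite ltr0Sn.
have Bex (k : nat) : exists B : R -> R, B 0 = 0 /\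
    forall x : R, - k.+1%:R < x < k.+1%:R -> is_derive x (1 : R) B (phi x).
  by have [B B0 HB] := antiderivative_itv cphi (npos k); exists B.
have [B HB] := choice Bex.
have BB k m (x : R) : (k <= m)%N -> - k.+1%:R < x < k.+1%:R -> B k x = B m x.
  move=> km xk; have [B0 dB] := HB k; have [C0 dC] := HB m.
  have sub (z : R) : - k.+1%:R < z < k.+1%:R -> - m.+1%:R < z < m.+1%:R.
    have : k.+1%:R <= m.+1%:R :> R by rewrite ler_nat ltnS.
    lra.
  apply/eqP; rewrite -subr_eq0; apply/eqP.
  have E0 : (B k - B m) 0 = 0 by change (B k 0 - B m 0 = 0); rewrite B0 C0 subr0.
  transitivity ((B k - B m) 0) => //.
  have d0 (y : R) : - k.+1%:R < y < k.+1%:R -> is_derive y (1 : R) (B k - B m) 0.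
    move=> yk; rewrite -(subrr (phi y)); apply: is_deriveB.
      exact: dB.
    by apply: dC; exact: sub.
  apply: (derive_itv0_cst d0) => //.
  by have := npos k; lra.
pose kk (x : R) := Num.truncn `|x|.
have kkP (x : R) k : (kk x <= k)%N -> - k.+1%:R < x < k.+1%:R.
  rewrite -ltr_norml => xk; apply: (lt_le_trans (truncnS_gt _)).
  by rewrite ler_nat ltnS.
exists (fun x => B (kk x) x); split; last by have [] := HB (kk 0).
move=> x.
have xk : - (kk x).+1%:R < x < (kk x).+1%:R by exact: kkP.
have [_ dB] := HB (kk x).
have dx := dB x xk.
apply: near_eq_is_derive dx.
have : `|x| < (kk x).+1%:R by rewrite ltr_norml.
rewrite -subr_gt0 => e0.
(* Near [x] the index [kk y] may differ from [kk x], but [y] lies in the intervals of both pieces,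
   where they agree. *)
near=> y.
have yk : - (kk x).+1%:R < y < (kk x).+1%:R.
  rewrite -ltr_norml -(subrK x y); apply: (le_lt_trans (ler_normD _ _)).
  rewrite -ltrBrDr distrC; near: y.
  exact: (@cvgr_dist_lt _ _ _ _ _ id x).
by case: (leqP (kk y) (kk x)) => [le|/ltnW le]; [symmetry|]; apply: BB => //; exact: kkP.
Unshelve. all: by end_near. Qed.

(** Made total by choice, so that it can act as an operator on all functions; the default is the
    zero function. *)
Definition prim phi : R -> R := xget (fun=> 0) [set Phi | antiderivative phi Phi].

Lemma primP phi : continuous phi -> antiderivative phi (prim phi).
Proof.
move=> cphi; have [Phi HPhi] := antiderivative_exists cphi.
exact: (@xgetPex _ (fun=> 0) [set Phi | antiderivative phi Phi] (ex_intro _ Phi HPhi)).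
Qed.

(** The working tool for primitives: a candidate is differentiated and its value at 0 is checked. *)
Lemma prim_unique phi Phi : antiderivative phi Phi -> prim phi = Phi.
Proof.
move=> HPhi; apply: (antiderivative_unique _ HPhi).
exact: (@xgetPex _ (fun=> 0) [set Phi | antiderivative phi Phi] (ex_intro _ Phi HPhi)).
Qed.

Lemma prim0 phi : continuous phi -> prim phi 0 = 0.
Proof. by move=> /primP[]. Qed.

Lemma prim_continuous phi : continuous phi -> continuous (prim phi).
Proof.
move=> cphi x; have [d _] := primP cphi.
by apply/differentiable_continuous/derivable1_diffP; case: (d x).
Qed.

(** The endpoints may come in either order, because a grid runs downwards when its final point is
    the smaller one. *)
Lemma mean_value (f df : R -> R) (a b : R) :
  (forall x, is_derive x (1 : R) f (df x)) ->
  exists2 c, Num.min a b <= c <= Num.max a b & f b - f a = df c * (b - a).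
Proof.
move=> df_f.
have cont x y : {within `[x, y], continuous f}.
  by apply: derivable_within_continuous => z _; case: (df_f z).
case: (leP a b) => ab.
  have [c cab E] := MVT_segment ab (fun x _ => df_f x) (cont _ _).
  by exists c.
have [c cab E] := MVT_segment (ltW ab) (fun x _ => df_f x) (cont _ _).
by exists c => //; rewrite -opprB E -mulrN opprB.
Qed.

End primitive.

(** * Continuous functions of several variables *)

Section continuous_paths.
Context {R : realType} {N : nat}.
Notation vec := ('I_N -> R).
Implicit Types (F G : vec -> R) (t s : vec) (i j : 'I_N).

Definition upd i (x : R) t : vec := fun j => if j == i then x else t j.

Lemma upd_same i x t : upd i x t i = x.
Proof. by rewrite /upd eqxx. Qed.

Lemma upd_other i j x t : j != i -> upd i x t j = t j.
Proof. by rewrite /upd => /negbTE ->. Qed.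

Lemma upd_id i t : upd i (t i) t = t.
Proof. by apply/funext => j; rewrite /upd; case: eqP => [->|]. Qed.

Lemma updK i x y t : upd i x (upd i y t) = upd i x t.
Proof. by apply/funext => j; rewrite /upd; case: eqP. Qed.

Lemma updC i j x y t : i != j -> upd i x (upd j y t) = upd j y (upd i x t).
Proof.
by move=> ij; apply/funext => k; rewrite /upd; case: (eqVneq k i) => // ->; rewrite (negbTE ij).
Qed.

(** Row vectors carry the sup-norm topology of the library, whose balls are the coordinatewise
    conditions of [cont_path]; continuity and compactness results are imported through this
    encoding. *)
Definition row_path F : 'rV[R]_N -> R := fun v => F (fun i => v ord0 i).

Lemma cont_pathP F : cont_path F <-> continuous (row_path F).
Proof.
split=> [cF v|cF t e e0].
  apply: (proj2 (@cvgrPdist_lt _ _ _ (nbhs v) _ (row_path F) (row_path F v))) => e e0.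
  have [d d0 H] := cF (fun i => v ord0 i) e e0.
  apply/nbhs_ballP; exists d => // w vw; rewrite distrC.
  by apply: H => i; rewrite distrC; exact: vw.2.
pose v : 'rV[R]_N := \row_i t i.
have tv : t = (fun i => v ord0 i) by apply/funext => i; rewrite mxE.
have near_v := proj1 (@cvgrPdist_lt _ _ _ (nbhs v) _ (row_path F) (row_path F v)) (cF v) e e0.
have [d d0 H] := proj1 (@nbhs_ballP _ _ v _) (near_v _).
exists d => // s st; pose w : 'rV[R]_N := \row_i s i.
have sw : s = (fun i => w ord0 i) by apply/funext => i; rewrite mxE.
rewrite distrC tv sw; apply: (H w); split=> // i j.
by rewrite ord1 !mxE /ball/= distrC; exact: st.
Qed.

Lemma cont_pathD F G : cont_path F -> cont_path G -> cont_path (fun t => F t + G t).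
Proof.
move=> /cont_pathP cF /cont_pathP cG; apply/cont_pathP => v.
exact: cvgD (cF v) (cG v).
Qed.

Lemma cont_pathM F G : cont_path F -> cont_path G -> cont_path (fun t => F t * G t).
Proof.
move=> /cont_pathP cF /cont_pathP cG; apply/cont_pathP => v.
exact: cvgM (cF v) (cG v).
Qed.

Lemma cont_path_cst (c : R) : cont_path (fun _ : vec => c).
Proof. by move=> t e e0; exists 1 => // s _; rewrite subrr normr0. Qed.

Lemma cont_pathN F : cont_path F -> cont_path (fun t => - F t).
Proof. by move=> /cont_pathP cF; apply/cont_pathP => v; exact: cvgN (cF v). Qed.

Lemma cont_pathB F G : cont_path F -> cont_path G -> cont_path (fun t => F t - G t).
Proof. by move=> cF cG; apply: cont_pathD => //; exact: cont_pathN. Qed.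

Lemma cont_path_comp (f : R -> R) F : continuous f -> cont_path F ->
  cont_path (fun t => f (F t)).
Proof.
move=> cf /cont_pathP cF; apply/cont_pathP => v.
exact: (continuous_comp (cF v) (cf _)).
Qed.

Lemma cont_path_sum (I : Type) (r : seq I) (p : pred I) (H : I -> vec -> R) :
  (forall k, p k -> cont_path (H k)) -> cont_path (fun t => \sum_(k <- r | p k) H k t).
Proof.
move=> cH; elim: r => [|k r IH].
  by under eq_fun do rewrite big_nil; exact: cont_path_cst.
under eq_fun do rewrite big_cons.
by case: (boolP (p k)) => [pk|//]; apply: cont_pathD => //; exact: cH.
Qed.

Lemma cont_path_coord i : cont_path (fun t => t i).
Proof. by move=> t e e0; exists e => // s; apply. Qed.

Definition cont_map (g : vec -> vec) := forall i, cont_path (fun t => g t i).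

Lemma cont_path_map F (g : vec -> vec) : cont_path F -> cont_map g ->
  cont_path (fun t => F (g t)).
Proof.
move=> cF cg t e e0; have [d d0 H] := cF (g t) e e0.
have ex i : exists x : R, 0 < x /\ forall s,
    (forall j, `|s j - t j| < x) -> `|g s i - g t i| < d.
  by have [x x0 Hx] := cg i t d d0; exists x.
have [dd Hdd] := choice ex.
(* Starting the minimum at 1 keeps it positive even when there are no coordinates. *)
exists (\big[Num.min/1]_i dd i).
  by elim/big_ind: _ => // [x y x0 y0|i _]; rewrite ?lt_min ?x0// (Hdd i).1.
move=> s st; apply: H => i; have [_] := Hdd i; apply => j.
by apply: (lt_le_trans (st j)); exact: bigmin_le.
Qed.

Lemma cont_map_upd i (h : vec -> R) (g : vec -> vec) : cont_path h -> cont_map g ->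
  cont_map (fun t => upd i (h t) (g t)).
Proof. by move=> ch cg j; rewrite /upd; case: eqP. Qed.

Lemma cont_map_id : cont_map id.
Proof. exact: cont_path_coord. Qed.

Lemma cont_path_line F i t : cont_path F -> continuous (fun x => F (upd i x t)).
Proof.
move=> cF x; apply/cvgrPdist_lt => e e0.
have [d d0 H] := cF (upd i x t) e e0.
apply/nbhs_ballP; exists d => // y xy; rewrite distrC; apply: H => j.
rewrite /upd; case: eqP => _; last by rewrite subrr normr0.
by rewrite distrC.
Qed.

Definition inbox (K : R) t := forall i, `|t i| <= K.

Let box_compact (K : R) :
  compact [set v : 'rV[R]_N | forall i, `[- K, K]%classic (v ord0 i)].
Proof. exact: (@rV_compact R N (fun=> `[- K, K]%classic) (fun=> @segment_compact R _ _)). Qed.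

Lemma cont_path_bounded F (K : R) : cont_path F ->
  exists2 M : R, 0 <= M & forall t, inbox K t -> `|F t| <= M.
Proof.
move=> /cont_pathP cF.
have /compact_bounded := continuous_compact (continuous_subspaceT cF) (@box_compact K).
move=> [M [Mr HM]]; exists (Num.max 0 (M + 1)); first by rewrite le_max lexx.
move=> t tK; rewrite le_max; apply/orP; right; apply: (HM (M + 1)); first by rewrite ltrDl.
exists (\row_i t i) => /=.
  by move=> i; rewrite mxE /= in_itv/= -ler_norml; exact: tK.
by rewrite /row_path; congr F; apply/funext => i; rewrite mxE.
Qed.

(** Heine-Cantor on a cube, by the near-covering form of compactness: [Q d v] says that the distance
    [d] suffices at [v], and near each point it holds for all small [d]. *)
Lemma cont_path_unif F (K e : R) : cont_path F -> 0 < e ->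
  exists2 d : R, 0 < d & forall s t, inbox K s -> inbox K t ->
    (forall i, `|s i - t i| < d) -> `|F s - F t| < e.
Proof.
move=> cF e0.
pose Q (d : R) (v : 'rV[R]_N) := forall s : vec,
  (forall i, `|s i - v ord0 i| < d) -> `|F s - F (fun i => v ord0 i)| < e.
have H x : [set v : 'rV[R]_N | forall i, `[- K, K]%classic (v ord0 i)] x ->
    \forall x' \near x & i \near 0^'+, Q i x'.
  move=> _; have [d d0 Hd] := cF (fun i => x ord0 i) (e / 2) (divr_gt0 e0 (ltr0Sn R 1)).
  exists ((ball x (d / 2) : set 'rV[R]_N), [set i | i < d / 2]) => /=.
    split; first by apply: nbhsx_ballx; rewrite divr_gt0.
    by apply: nbhs_right_lt; rewrite divr_gt0.
  move=> [y i]/= [[_ xy] id] s sy.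
  have Hy : `|F (fun i => y ord0 i) - F (fun i => x ord0 i)| < e / 2.
    apply: Hd => k; rewrite distrC; have := xy ord0 k; rewrite /ball/= => /lt_trans; apply.
    by rewrite ltr_pdivrMr// ltr_pMr// ltr1n.
  have Hs : `|F s - F (fun i => x ord0 i)| < e / 2.
    apply: Hd => k; rewrite -(subrK (y ord0 k) (s k)) -addrA.
    apply: (le_lt_trans (ler_normD _ _)); rewrite (splitr d); apply: ltrD.
      exact: (lt_trans (sy k)).
    by rewrite distrC; exact: xy ord0 k.
  rewrite -(subrK (F (fun i => x ord0 i)) (F s)) -addrA.
  by apply: (le_lt_trans (ler_normD _ _)); rewrite (splitr e); apply: ltrD => //; rewrite distrC.
have cov := proj1 (compact_near_coveringP _) (@box_compact K).
have := cov R (0^'+) Q _ H; rewrite near_withinE => /(_ _)/nbhs_ballP[d d0 Hd].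
have d20 : 0 < d / 2 by rewrite divr_gt0.
exists (d / 2) => // s t sK tK st.
have tE : t = (fun i => (\row_i t i : 'rV[R]_N) ord0 i) by apply/funext => i; rewrite mxE.
rewrite tE; apply: (Hd (d / 2)) => //=.
- rewrite /ball/= sub0r normrN gtr0_norm//.
  by rewrite ltr_pdivrMr// ltr_pMr// ltr1n.
- by move=> i; rewrite mxE/= in_itv/= -ler_norml; exact: tK.
- by move=> i; rewrite mxE; exact: st.
Qed.

End continuous_paths.

(** * Operators in one coordinate *)

Section line_operators.
Context {R : realType}.
Implicit Types (phi psi : R -> R) (alpha : (R -> R) -> R -> R).

(** The conditions under which an operator can act in one coordinate of a function of several
    variables. The bound on each interval from [- K] to [K] is what makes the result jointly
    continuous. *)
Definition line_op alpha :=
  [/\ forall phi, continuous phi -> continuous (alpha phi),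
      forall phi psi a b, continuous phi -> continuous psi ->
        alpha (fun x => a * phi x + b * psi x) = (fun x => a * alpha phi x + b * alpha psi x) &
      forall K : R, exists2 C : R, 0 <= C & forall phi psi M,
        continuous phi -> continuous psi ->
        (forall x, `|x| <= K -> `|phi x - psi x| <= M) ->
        forall x, `|x| <= K -> `|alpha phi x - alpha psi x| <= C * M].

Lemma continuous_lin phi psi a b : continuous phi -> continuous psi ->
  continuous (fun x => a * phi x + b * psi x).
Proof.
move=> cphi cpsi x.
exact: (cvgD (cvgM (cvg_cst a) (cphi x)) (cvgM (cvg_cst b) (cpsi x))).
Qed.

Lemma continuous_mul phi psi : continuous phi -> continuous psi ->
  continuous (fun x => phi x * psi x).
Proof. by move=> cphi cpsi x; exact: (cvgM (cphi x) (cpsi x)). Qed.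

Lemma continuous_expM (th : R) : continuous (fun x : R => expR (th * x)).
Proof.
move=> x; apply: (@continuous_comp _ _ _ (fun x => th * x) expR).
  exact: mulrl_continuous.
exact: continuous_expR.
Qed.

Lemma prim_lin phi psi a b : continuous phi -> continuous psi ->
  prim (fun x => a * phi x + b * psi x) = (fun x => a * prim phi x + b * prim psi x).
Proof.
move=> cphi cpsi; apply: prim_unique.
have [dphi phi0] := primP cphi; have [dpsi psi0] := primP cpsi.
split; last by rewrite phi0 psi0 !mulr0 addr0.
move=> x; have dx := dphi x; have dy := dpsi x.
by apply: is_deriveD.
Qed.

Lemma prim_mean phi (a b : R) : continuous phi ->
  exists2 c, Num.min a b <= c <= Num.max a b & prim phi b - prim phi a = phi c * (b - a).
Proof. by move=> /primP[d _]; exact: mean_value. Qed.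

Lemma ler_prim phi M x : continuous phi ->
  (forall y, `|y| <= `|x| -> `|phi y| <= M) -> `|prim phi x| <= M * `|x|.
Proof.
move=> cphi bphi; have [c cb] := prim_mean 0 x cphi.
rewrite prim0// !subr0 => ->; rewrite normrM; apply: ler_wpM2r => //.
apply: bphi; move: cb; case: (leP 0 x) => x0 /andP[c1 c2].
  by rewrite !ger0_norm// (le_trans _ c1).
by rewrite !ler0_norm// ?lerN2 ?(ltW x0).
Qed.

Lemma line_op_prim : line_op (@prim R).
Proof.
split=> [phi|phi psi a b|K]; [exact: prim_continuous|exact: prim_lin|].
exists `|K| => // phi psi M cphi cpsi H x xK.
have -> : prim phi x - prim psi x = prim (fun x => 1 * phi x + (-1) * psi x) x.
  by rewrite prim_lin// mul1r mulN1r.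
have M0 : 0 <= M by exact: (le_trans (normr_ge0 _) (H _ xK)).
apply: (@le_trans _ _ (M * `|x|)).
  apply: ler_prim; first exact: continuous_lin.
  by move=> y yx; rewrite mul1r mulN1r; apply: H; exact: (le_trans yx).
by rewrite mulrC ler_wpM2r// (le_trans xK)// ler_norm.
Qed.

(* Integration by parts turns the Stieltjes integral of e^(th x) against phi into the increment of [eop th phi]. *)
Definition eop (th : R) phi : R -> R :=
  fun x => expR (th * x) * phi x - th * prim (fun y => expR (th * y) * phi y) x.

Lemma line_op_eop (th : R) : line_op (eop th).
Proof.
have [primc priml primb] := line_op_prim.
have ec phi : continuous phi -> continuous (fun y => expR (th * y) * phi y).
  by move=> cphi; apply: continuous_mul => //; exact: continuous_expM.
split=> [phi cphi|phi psi a b cphi cpsi|K].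
- move=> x.
  exact: (cvgB (ec _ cphi x) (cvgM (cvg_cst th) (primc _ (ec _ cphi) x))).
- apply/funext => x; rewrite /eop.
  rewrite (_ : (fun y => _) = (fun y => a * (expR (th * y) * phi y) + b * (expR (th * y) * psi y))).
    by rewrite priml; [ring|exact: ec|exact: ec].
  by apply/funext => y; ring.
have [C C0 HC] := primb K.
exists (expR (`|th| * K) * (1 + `|th| * C)).
  by rewrite mulr_ge0 ?expR_ge0// addr_ge0// mulr_ge0.
move=> phi psi M cphi cpsi H x xK.
have M0 : 0 <= M by exact: (le_trans (normr_ge0 _) (H _ xK)).
have eK y : `|y| <= K -> expR (th * y) <= expR (`|th| * K).
  move=> yK; rewrite ler_expR; apply: (le_trans (ler_norm _)).
  by rewrite normrM; exact: ler_wpM2l.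
have eM y : `|y| <= K -> `|expR (th * y) * phi y - expR (th * y) * psi y| <= expR (`|th| * K) * M.
  move=> yK; rewrite -mulrBr normrM ger0_norm ?expR_ge0//.
  by apply: ler_pM; rewrite ?expR_ge0 ?normr_ge0//; [exact: eK|exact: H].
have := HC _ _ _ (ec _ cphi) (ec _ cpsi) eM x xK.
have := eM x xK.
rewrite /eop; set p := prim _ x; set q := prim _ x => A B.
have -> : expR (th * x) * phi x - th * p - (expR (th * x) * psi x - th * q) =
  (expR (th * x) * phi x - expR (th * x) * psi x) - th * (p - q) by ring.
apply: (le_trans (ler_normB _ _)); rewrite normrM.
have : `|th| * `|p - q| <= `|th| * (C * (expR (`|th| * K) * M)) by exact: ler_wpM2l.
nra.
Qed.

Lemma is_derive_expM (th x : R) :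
  is_derive x (1 : R) (fun y => expR (th * y)) (th * expR (th * x)).
Proof.
have h : is_derive x (1 : R) (fun y : R => th * y) th.
  by apply: is_derive_eq; rewrite /GRing.scale/= mulr1.
have := is_derive1_comp (is_derive_expR (th * x)) h.
by rewrite mulrC.
Qed.

(** With Phi the primitive of [expR (th * y) * phi y], the derivative of [expR (- th * x) * Phi x]
    is [expR (- th * x) * eop th phi x]. This identifies the primitive inside the outer operator. *)
Lemma eopK (th : R) phi : continuous phi -> eop (- th) (eop th phi) = phi.
Proof.
move=> cphi.
have ec : continuous (fun y => expR (th * y) * phi y).
  by apply: continuous_mul => //; exact: continuous_expM.
have [dP P0] := primP ec.
have E : prim (fun y => expR (- th * y) * eop th phi y) =
    (fun x => expR (- th * x) * prim (fun y => expR (th * y) * phi y) x).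
  apply: prim_unique; split; last by rewrite P0 mulr0.
  move=> x; have d1 := is_derive_expM (- th) x; have d2 := dP x.
  apply: (is_derive_eq (is_deriveM d1 d2)).
  by rewrite /eop /GRing.scale/=; ring.
apply/funext => x; rewrite {1}/eop E /eop.
have e1 : expR (- th * x) * expR (th * x) = 1.
  by rewrite mulNr expRN mulVf// gt_eqF// expR_gt0.
rewrite [LHS](_ : _ = expR (- th * x) * expR (th * x) * phi x); first by rewrite e1 mul1r.
ring.
Qed.

(** The derivative vanishes, and at 0 the primitive term drops out. Through this, [eop] respects
    functions modulo [null]. *)
Lemma eop_cst (th c : R) : eop th (fun=> c) = fun=> c.
Proof.
apply/funext => x.
have ec : continuous (fun y => expR (th * y) * c).
  by apply: continuous_mul => [|y]; [exact: continuous_expM|exact: cvg_cst].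
have [dP P0] := primP ec.
have d0 y : is_derive y (1 : R) (eop th (fun=> c)) 0.
  have d1 := is_derive_expM th y; have d2 := dP y.
  have d3 : is_derive y (1 : R) (fun z => expR (th * z) * c) (th * expR (th * y) * c).
    apply: (is_derive_eq (is_deriveM d1 (is_derive_cst c y 1))).
    by rewrite /GRing.scale/=; ring.
  have d4 : is_derive y (1 : R) (fun z => th * prim (fun y => expR (th * y) * c) z)
      (th * (expR (th * y) * c)).
    exact: (is_derive_eq (is_deriveZ th d2)).
  apply: (is_derive_eq (is_deriveB d3 d4)); ring.
rewrite (is_derive_0_is_cst x 0 d0) /eop P0 mulr0 expR0; ring.
Qed.

(** Substitution [y + h] in the primitive leaves only a constant, caused by the displaced base point
    0. The constant is harmless because it has no increments. *)
Lemma eop_shift (th h : R) phi x : continuous phi ->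
  eop th (fun y => phi (y + h)) x - expR (- th * h) * eop th phi (x + h) =
  eop th (fun y => phi (y + h)) 0 - expR (- th * h) * eop th phi h.
Proof.
move=> cphi.
have csh : continuous (fun y => phi (y + h)).
  move=> y; apply: (@continuous_comp _ _ _ (fun y => y + h) phi); last exact: cphi.
  by apply: (@continuousD _ _ _ (fun y : R => y) (fun=> h)) => //; exact: cvg_cst.
have c1 : continuous (fun y => expR (th * y) * phi y).
  by apply: continuous_mul => //; exact: continuous_expM.
have c2 : continuous (fun y => expR (th * y) * phi (y + h)).
  by apply: continuous_mul => //; exact: continuous_expM.
have [d1 _] := primP c1; have [d2 _] := primP c2.
pose D x := prim (fun y => expR (th * y) * phi (y + h)) x -
  expR (- th * h) * prim (fun y => expR (th * y) * phi y) (x + h).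
have ee y : expR (- th * h) * expR (th * (y + h)) = expR (th * y).
  by rewrite -expRD; congr expR; ring.
have d0 y : is_derive y (1 : R) D 0.
  have dh : is_derive y (1 : R) (fun z : R => z + h) 1.
    by apply: is_derive_eq; rewrite addr0.
  have d3 := @is_derive1_comp R _ (fun z => z + h) y _ _ (d1 (y + h)) dh.
  apply: (is_derive_eq (is_deriveB (d2 y) (is_deriveZ (expR (- th * h)) d3))).
  by rewrite /GRing.scale/= mulr1 mulrA ee subrr.
have E z : eop th (fun y => phi (y + h)) z - expR (- th * h) * eop th phi (z + h) = - th * D z.
  by rewrite /eop /D -(ee z); ring.
by have := E 0; rewrite add0r E => ->; rewrite (is_derive_0_is_cst x 0 d0).
Qed.

End line_operators.

(** * Operators and differences in single coordinates *)

Section coordinate_operators.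
Context {R : realType} {N : nat}.
Notation vec := ('I_N -> R).
Implicit Types (F G : vec -> R) (t s r : vec) (i j : 'I_N) (l : seq 'I_N).
Implicit Types alpha : (R -> R) -> R -> R.

Definition lop i alpha F : vec -> R := fun t => alpha (fun x => F (upd i x t)) (t i).

Lemma lop_upd i alpha F x t : lop i alpha F (upd i x t) = alpha (fun y => F (upd i y t)) x.
Proof.
rewrite /lop upd_same; congr (alpha _ x).
by apply/funext => y; rewrite updK.
Qed.

Lemma lop_upd_other i j alpha F c t : i != j ->
  lop i alpha F (upd j c t) = lop i alpha (fun s => F (upd j c s)) t.
Proof.
move=> ij; rewrite /lop upd_other//; congr (alpha _ (t i)).
by apply/funext => y; rewrite updC.
Qed.

Lemma cont_path_upd i c F : cont_path F -> cont_path (fun t => F (upd i c t)).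
Proof.
move=> cF; apply: cont_path_map => //.
by apply: cont_map_upd; [exact: cont_path_cst|exact: cont_map_id].
Qed.

Lemma lop_lin i alpha F G a b : line_op alpha -> cont_path F -> cont_path G ->
  lop i alpha (fun t => a * F t + b * G t) = (fun t => a * lop i alpha F t + b * lop i alpha G t).
Proof.
move=> [_ lin _] cF cG; apply/funext => t; rewrite /lop.
by rewrite lin//; exact: cont_path_line.
Qed.

Lemma lopB i alpha F G : line_op alpha -> cont_path F -> cont_path G ->
  lop i alpha (fun t => F t - G t) = (fun t => lop i alpha F t - lop i alpha G t).
Proof.
move=> la cF cG; have := lop_lin i 1 (-1) la cF cG.
rewrite (_ : (fun t => 1 * F t + -1 * G t) = (fun t => F t - G t)).
  by move=> ->; apply/funext => t; rewrite mul1r mulN1r.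
by apply/funext => t; rewrite mul1r mulN1r.
Qed.

Lemma vec_inbox t : inbox (\sum_i `|t i|) t.
Proof. by move=> i; rewrite (bigD1 i)//= lerDl sumr_ge0. Qed.

(** The passage from [t] to [s] is split in two. Changing the other coordinates alters the line
    function uniformly little, which the Lipschitz bound of [alpha] transmits; then the i-th
    coordinate moves along the continuous function [alpha phi]. *)
Lemma lop_cont i alpha F : line_op alpha -> cont_path F -> cont_path (lop i alpha F).
Proof.
move=> [acont alin abd] cF t e e0.
(* The summand 1 leaves room for every [s] within distance 1 of [t]. *)
set K : R := \sum_i `|t i| + 1.
have [C C0 HC] := abd K.
have C10 : 0 < C + 1 by rewrite ltr_wpDl.
have e4 : 0 < e / 2 / (C + 1) by rewrite divr_gt0// divr_gt0.
have [d d0 Hd] := cont_path_unif K cF e4.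
pose phi x := F (upd i x t).
have cphi : continuous phi by exact: cont_path_line.
have /cvgrPdist_lt/(_ (e / 2) (divr_gt0 e0 (ltr0Sn R 1)))/nbhs_ballP[d' d'0 Hd'] := acont _ cphi (t i).
exists (Num.min 1 (Num.min d d')); first by rewrite !lt_min ltr01 d0.
move=> s st.
have st1 k : `|s k - t k| < 1 by have := st k; rewrite lt_min => /andP[].
have std k : `|s k - t k| < d by have := st k; rewrite !lt_min => /andP[_ /andP[]].
have std' k : `|s k - t k| < d' by have := st k; rewrite !lt_min => /andP[_ /andP[]].
have tK : inbox K t by move=> k; rewrite (le_trans (vec_inbox t k))// lerDl.
have sK : inbox K s.
  move=> k; rewrite -(subrK (t k) (s k)) (le_trans (ler_normD _ _))// addrC.
  by apply: lerD; [exact: vec_inbox|exact: ltW].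
have updK' (x : R) (r : vec) : `|x| <= K -> inbox K r -> inbox K (upd i x r).
  by move=> xK rK k; rewrite /upd; case: eqP.
have h1 : `|alpha (fun x => F (upd i x s)) (s i) - alpha phi (s i)| <= C * (e / 2 / (C + 1)).
  have cs : continuous (fun x => F (upd i x s)) by exact: cont_path_line.
  apply: (HC (fun x => F (upd i x s)) phi _ cs cphi _ (s i) (sK i)) => x xK.
  apply/ltW/Hd; [exact: updK'|exact: updK'|move=> k].
  by rewrite /upd; case: eqP => // _; rewrite subrr normr0.
have h2 : `|alpha phi (s i) - alpha phi (t i)| < e / 2.
  by rewrite distrC; apply: Hd'; rewrite /ball/= distrC.
have h3 : C * (e / 2 / (C + 1)) <= e / 2.
  by rewrite mulrCA ler_piMr// ?divr_ge0 ?(ltW e0)// ler_pdivrMr// mul1r lerDl.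
rewrite /lop -(subrK (alpha phi (s i)) (alpha _ (s i))) -addrA.
apply: (le_lt_trans (ler_normD _ _)); rewrite (splitr e).
by apply: ler_ltD => //; exact: (le_trans h1).
Qed.

Definition dif i s t F : vec -> R := fun r => F (upd i (t i) r) - F (upd i (s i) r).

(** Iterated differences, unlike the alternating sum [incr_part], commute with operators in the
    remaining coordinates by a plain induction; [r] supplies those coordinates. *)
Definition incr l s t F : vec -> R := foldr (fun i H => dif i s t H) F l.

Lemma incr_cons i l s t F : incr (i :: l) s t F = dif i s t (incr l s t F).
Proof. by []. Qed.

Lemma incr_cat l l' s t F : incr (l ++ l') s t F = incr l s t (incr l' s t F).
Proof. by rewrite /incr foldr_cat. Qed.

Lemma dif_cont i s t F : cont_path F -> cont_path (dif i s t F).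
Proof. by move=> cF; apply: cont_pathB; exact: cont_path_upd. Qed.

Lemma incr_cont l s t F : cont_path F -> cont_path (incr l s t F).
Proof. by move=> cF; elim: l => //= i l IH; exact: dif_cont. Qed.

Lemma incr_lin l s t F G a b :
  incr l s t (fun r => a * F r + b * G r) =
  (fun r => a * incr l s t F r + b * incr l s t G r).
Proof.
elim: l => //= i l; rewrite /incr/= => ->.
by apply/funext => r; rewrite /dif; ring.
Qed.

Lemma incrB l s t F G :
  incr l s t (fun r => F r - G r) = (fun r => incr l s t F r - incr l s t G r).
Proof.
elim: l => //= i l; rewrite /incr/= => ->.
by apply/funext => r; rewrite /dif; ring.
Qed.

Lemma incrZ l s t F a : incr l s t (fun r => a * F r) = (fun r => a * incr l s t F r).
Proof.
elim: l => //= i l; rewrite /incr/= => ->.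
by apply/funext => r; rewrite /dif; ring.
Qed.

Lemma incr0 l s t : incr l s t (fun=> 0) = fun=> 0.
Proof.
elim: l => //= i l; rewrite /incr/= => ->.
by apply/funext => r; rewrite /dif subrr.
Qed.

Lemma incr_sum l s t (I : Type) (q : seq I) (p : pred I) (H : I -> vec -> R) :
  incr l s t (fun r => \sum_(k <- q | p k) H k r) =
  (fun r => \sum_(k <- q | p k) incr l s t (H k) r).
Proof.
elim: l => //= i l; rewrite /incr/= => ->.
by apply/funext => r; rewrite /dif sumrB.
Qed.

Lemma difC i j s t F : dif i s t (dif j s t F) = dif j s t (dif i s t F).
Proof.
have [->//|ij] := eqVneq i j.
apply/funext => r; rewrite /dif !(updC _ _ _ ij); ring.
Qed.

Lemma incr_dif i l s t F : incr l s t (dif i s t F) = dif i s t (incr l s t F).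
Proof. by elim: l => //= j l; rewrite /incr/= => ->; rewrite difC. Qed.

Lemma incr_rem i l s t F : i \in l -> incr l s t F = incr (i :: rem i l) s t F.
Proof.
elim: l => //= j l IH; rewrite inE; case: (eqVneq j i) => [-> //|ji].
move=> /= /IH; rewrite /incr/= => ->.
by rewrite difC.
Qed.

End coordinate_operators.
Arguments incr {R N} l s t F r : simpl never.

Lemma sum_subsets_setU1 (R : zmodType) (T : finType) (V : {set T}) (i : T) (f : {set T} -> R) :
  i \notin V ->
  \sum_(w : {set T} | w \subset (i |: V)%SET) f w =
  \sum_(w : {set T} | w \subset V) f w + \sum_(w : {set T} | w \subset V) f (i |: w)%SET.
Proof.
move=> iV; rewrite (bigID (fun w : {set T} => i \in w))/= addrC; congr (_ + _).
  by apply: eq_bigl => w; rewrite -subsetD1 finset.setU1K.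
rewrite (reindex_onto (fun w => i |: w)%SET (fun w => w :\ i)%SET)/=; last first.
  by move=> w /andP[_ iw]; rewrite finset.setD1K.
apply: eq_bigl => w; rewrite finset.setU11 andbT; apply/andP/idP.
  move=> [wV /eqP wi]; rewrite -wi; apply/fintype.subsetP => x; rewrite !inE => /andP[xi].
  rewrite (negbTE xi)/= => xw; have := fintype.subsetP wV x.
  by rewrite !inE xw orbT (negbTE xi)/=; apply.
move=> wV; rewrite finset.setUS//; split=> //.
by rewrite finset.setU1K//; apply: contraNN iV => /(fintype.subsetP wV).
Qed.

(** * Rectangular increments and functions without increments *)

Section increments.
Context {R : realType} {N : nat}.
Notation vec := ('I_N -> R).
Implicit Types (F G : vec -> R) (t s r h : vec) (i j : 'I_N) (l : seq 'I_N).
Implicit Types alpha : (R -> R) -> R -> R.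

Lemma incr_lop i l s t alpha F : line_op alpha -> cont_path F -> i \notin l ->
  incr l s t (lop i alpha F) = lop i alpha (incr l s t F).
Proof.
move=> la cF; elim: l => //= j l IH; rewrite inE negb_or => /andP[ij /IH].
rewrite /incr/= => ->; set H := foldr _ _ _.
have cH : cont_path H by exact: incr_cont.
rewrite /dif (@lopB R N i alpha (fun r => H (upd j (t j) r)))//; try exact: cont_path_upd.
by apply/funext => r; rewrite !lop_upd_other.
Qed.

Lemma incr_ext_base l s t F r r' : (forall i, i \notin l -> r i = r' i) ->
  incr l s t F r = incr l s t F r'.
Proof.
elim: l r r' => [|i l IH] r r' rr'.
  by congr F; apply/funext => i; exact: rr'.
have H c : incr l s t F (upd i c r) = incr l s t F (upd i c r').
  apply: IH => j jl; rewrite /upd; case: eqP => // /eqP ji; apply: rr'.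
  by rewrite inE negb_or ji.
by rewrite incr_cons /dif !H.
Qed.

Lemma incr_ext l s t s' t' F : (forall i, i \in l -> s i = s' i) ->
  (forall i, i \in l -> t i = t' i) -> incr l s t F = incr l s' t' F.
Proof.
elim: l => [//|i l IH] ss tt.
rewrite !incr_cons IH; first by rewrite /dif ss ?tt ?mem_head.
  by move=> j jl; apply: ss; rewrite inE jl orbT.
by move=> j jl; apply: tt; rewrite inE jl orbT.
Qed.

Lemma incr_partE l F r s t : uniq l ->
  incr_part F [set x in l]%SET r s t = incr l s t F r.
Proof.
elim: l r => [|i l IH] r /=.
  move=> _; rewrite /incr_part (big_pred1 finset.set0).
    rewrite cards0 expr0 mul1r; congr F; apply/funext => j.
    by rewrite /Defs.merge inE in_nil.
  by move=> w; rewrite /= (_ : [set x in [::]]%SET = finset.set0) ?finset.subset0//; apply/finset.setP => x; rewrite !inE.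
move=> /andP[il ul]; rewrite incr_cons /dif -!IH// set_cons /incr_part.
have iw (w : {set 'I_N}) : w \subset [set x in l]%SET -> i \notin w.
  by move=> wV; apply: contra il => /(fintype.subsetP wV); rewrite inE.
rewrite sum_subsets_setU1 ?inE// -sumrN; congr (_ + _); apply: eq_bigr => w /iw {}iw.
  congr (_ * F _); apply/funext => j; rewrite /Defs.merge /upd !inE.
  by case: (eqVneq j i) => [->|]//=; rewrite (negbTE il) (negbTE iw).
rewrite cardsU1 iw exprD expr1 mulN1r mulNr; congr (- (_ * F _)).
apply/funext => j; rewrite /Defs.merge /upd !inE.
by case: (eqVneq j i) => [->|]//=; rewrite (negbTE il).
Qed.

Lemma set_enum_ord : [set x in enum 'I_N]%SET = [set: 'I_N]%SET.
Proof. by apply/finset.setP => i; rewrite !inE mem_enum. Qed.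

Lemma rect_incrE F s t r : rect_incr F s t = incr (enum 'I_N) s t F r.
Proof.
rewrite /rect_incr -set_enum_ord incr_partE ?enum_uniq//.
by apply: incr_ext_base => i; rewrite mem_enum.
Qed.

Lemma rect_incrB F G s t :
  rect_incr (fun x => F x - G x) s t = rect_incr F s t - rect_incr G s t.
Proof. by rewrite !(rect_incrE _ _ _ s) incrB. Qed.

Lemma rect_incrD F G s t :
  rect_incr (fun x => F x + G x) s t = rect_incr F s t + rect_incr G s t.
Proof.
rewrite !(rect_incrE _ _ _ s); have := incr_lin (enum 'I_N) s t F G 1 1.
rewrite (_ : (fun r => _) = (fun r => F r + G r)); last by apply/funext => x; rewrite !mul1r.
by move=> ->; rewrite !mul1r.
Qed.

Lemma rect_incrZ F s t a : rect_incr (fun x => a * F x) s t = a * rect_incr F s t.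
Proof. by rewrite !(rect_incrE _ _ _ s) incrZ. Qed.

Lemma rect_incr_shift F s t h :
  rect_incr (fun x => F (shiftv x h)) s t = rect_incr F (shiftv s h) (shiftv t h).
Proof.
rewrite /rect_incr /incr_part; apply: eq_bigr => w _; congr (_ * F _).
by apply/funext => i; rewrite /shiftv /Defs.merge inE; case: ifP.
Qed.

(** These are the sums of functions each of which ignores some coordinate; identities between noises
    and their integrals are proved modulo them. *)
Definition null F := forall s t, rect_incr F s t = 0.

Lemma null_cst i F : (forall x t, F (upd i x t) = F t) -> null F.
Proof.
move=> cF s t; rewrite (rect_incrE _ _ _ s) (@incr_rem R N i) ?mem_enum//.
rewrite incr_cons -incr_dif (_ : dif i s t F = fun=> 0) ?incr0//.
by apply/funext => r; rewrite /dif !cF subrr.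
Qed.

Lemma nullB F G : null F -> null G -> null (fun t => F t - G t).
Proof. by move=> nF nG s t; rewrite rect_incrB nF nG subrr. Qed.

Lemma nullD F G : null F -> null G -> null (fun t => F t + G t).
Proof. by move=> nF nG s t; rewrite rect_incrD nF nG addr0. Qed.

Lemma nullZ a F : null F -> null (fun t => a * F t).
Proof. by move=> nF s t; rewrite rect_incrZ nF mulr0. Qed.

(** Increments in the other coordinates are taken first. Nullity then says that the resulting [H] is
    constant in coordinate [i], so [eop] fixes it and its i-th difference is still zero. *)
Lemma null_lop_eop i th F : null F -> cont_path F -> null (lop i (eop th) F).
Proof.
move=> nF cF s t; rewrite (rect_incrE _ _ _ s) (@incr_rem R N i) ?mem_enum//.
rewrite incr_cons incr_lop//; last 2 first.
- exact: line_op_eop.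
- by rewrite mem_rem_uniqF ?enum_uniq.
set H := incr _ s t F.
have HE x y r : H (upd i x r) = H (upd i y r).
  have := nF (upd i y s) (upd i x t).
  rewrite (rect_incrE _ _ _ r) (@incr_rem R N i) ?mem_enum// incr_cons.
  rewrite /dif !upd_same (@incr_ext (rem i _) _ _ s t) => [/eqP|j|j].
  - by rewrite subr_eq0 => /eqP.
  - by rewrite mem_rem_uniq ?enum_uniq// inE => /andP[ji _]; rewrite upd_other.
  - by rewrite mem_rem_uniq ?enum_uniq// inE => /andP[ji _]; rewrite upd_other.
have E r : lop i (eop th) H r = H r.
  rewrite /lop (_ : (fun x => H (upd i x r)) = fun=> H r) ?eop_cst//.
  by apply/funext => x; rewrite (HE x (r i)) upd_id.
by rewrite /dif !E (HE _ (s i)) subrr.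
Qed.

Definition Eall (th : 'I_N -> R) l F : vec -> R :=
  foldr (fun i H => lop i (eop (th i)) H) F l.

Lemma Eall_cont th l F : cont_path F -> cont_path (Eall th l F).
Proof. by move=> cF; elim: l => //= i l IH; apply: lop_cont => //; exact: line_op_eop. Qed.

Lemma EallB th l F G : cont_path F -> cont_path G ->
  Eall th l (fun t => F t - G t) = (fun t => Eall th l F t - Eall th l G t).
Proof.
move=> cF cG; elim: l => //= i l ->.
by rewrite lopB//; [exact: line_op_eop|exact: Eall_cont|exact: Eall_cont].
Qed.

Lemma null_Eall th l F : null F -> cont_path F -> null (Eall th l F).
Proof.
by move=> nF cF; elim: l => //= i l IH; apply: null_lop_eop => //; exact: Eall_cont.
Qed.

Lemma lop_eopK i th F : cont_path F -> lop i (eop (- th)) (lop i (eop th) F) = F.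
Proof.
move=> cF; apply/funext => t; rewrite {1}/lop.
rewrite (_ : (fun x => _) = eop th (fun y => F (upd i y t))).
  by rewrite eopK ?upd_id//; exact: cont_path_line.
by apply/funext => x; rewrite lop_upd.
Qed.

(** Reversing the list lets each inverse meet its own operator directly, so operators in different
    coordinates need not be commuted. *)
Lemma EallK th l F : cont_path F ->
  Eall (fun i => - th i) (rev l) (Eall th l F) = F.
Proof.
move=> cF; elim: l => //= i l IH.
by rewrite rev_cons -cats1 /Eall foldr_cat/= lop_eopK//; exact: Eall_cont.
Qed.

Lemma EallVK th l F : cont_path F ->
  Eall th l (Eall (fun i => - th i) (rev l) F) = F.
Proof.
move=> cF; rewrite -{1}(revK l) -{1}(_ : (fun i => - - th i) = th) ?EallK//.
by apply/funext => i; rewrite opprK.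
Qed.

Lemma Eall_congr th l F G : cont_path F -> cont_path G ->
  null (fun t => F t - G t) -> null (fun t => Eall th l F t - Eall th l G t).
Proof.
by move=> cF cG nFG; rewrite -EallB//; apply: null_Eall => //; exact: cont_pathB.
Qed.

Lemma cont_path_shift h F : cont_path F -> cont_path (fun t => F (shiftv t h)).
Proof.
move=> cF; apply: cont_path_map => // i.
by apply: cont_pathD; [exact: cont_path_coord|exact: cont_path_cst].
Qed.

Lemma shiftv_upd i x t h : shiftv (upd i x t) h = upd i (x + h i) (shiftv t h).
Proof. by apply/funext => j; rewrite /shiftv /upd; case: eqP => [->|]. Qed.

Lemma lop_eop_shift i th h F : cont_path F ->
  null (fun t => lop i (eop th) (fun t => F (shiftv t h)) t -
                 expR (- th * h i) * lop i (eop th) F (shiftv t h)).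
Proof.
move=> cF; apply: (@null_cst i) => x t.
have E y : lop i (eop th) (fun t => F (shiftv t h)) (upd i y t) -
    expR (- th * h i) * lop i (eop th) F (shiftv (upd i y t) h) =
    eop th (fun z => F (upd i (z + h i) (shiftv t h))) 0 -
    expR (- th * h i) * eop th (fun z => F (upd i z (shiftv t h))) (h i).
  rewrite shiftv_upd !lop_upd.
  rewrite (_ : (fun y0 => _) = (fun z => F (upd i (z + h i) (shiftv t h)))).
    by rewrite (eop_shift th (h i) y (@cont_path_line _ _ F i (shiftv t h) cF)).
  by apply/funext => z; rewrite shiftv_upd.
by have := E (t i); rewrite upd_id E => ->.
Qed.

(** Each coordinate contributes its factor [expR (- th i * h i)] and a null error from
    [lop_eop_shift]; errors made earlier remain null under the later operators. *)
Lemma Eall_shift th l h F : cont_path F ->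
  null (fun t => Eall th l (fun t => F (shiftv t h)) t -
    expR (- \sum_(i <- l) th i * h i) * Eall th l F (shiftv t h)).
Proof.
move=> cF; elim: l => [|i l IH] /=.
  by move=> s t; rewrite big_nil oppr0 expR0 rect_incrB rect_incrZ mul1r subrr.
set A := Eall th l _; set W := Eall th l F; set c := expR _ in IH.
have cA : cont_path A by apply: Eall_cont; exact: cont_path_shift.
have cW : cont_path W by exact: Eall_cont.
have cWs := cont_path_shift h cW.
have n1 := null_lop_eop i (th i) IH (cont_pathB cA (cont_pathM (@cont_path_cst _ _ c) cWs)).
have n2 := nullZ c (lop_eop_shift i (th i) h cW).
have := nullD n1 n2.
have E := lop_lin i 1 (- c) (line_op_eop (th i)) cA cWs.
rewrite (_ : (fun t => A t - c * W (shiftv t h)) = (fun t => 1 * A t + - c * W (shiftv t h))); last first.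
  by apply/funext => t; ring.
rewrite E big_cons opprD expRD -/c => H; congr null: H.
by apply/funext => t; rewrite (mulNr (th i)); ring.
Qed.

Lemma rect_incr_Eall_shift th l h s t F : cont_path F -> perm_eq l (enum 'I_N) ->
  rect_incr (Eall th l (fun t => F (shiftv t h))) s t =
  expR (- dotv th h) * rect_incr (Eall th l F) (shiftv s h) (shiftv t h).
Proof.
move=> cF pl; have := Eall_shift th l h cF s t.
rewrite rect_incrB rect_incrZ rect_incr_shift => /eqP; rewrite subr_eq0 => /eqP ->.
by rewrite (perm_big _ pl)/= big_enum.
Qed.

End increments.

(** * Multiple Riemann-Stieltjes integrals *)

Section monotone_partitions.
Context {R : realType}.
Implicit Types (y tag : nat -> R) (phi g dg : R -> R).

Definition monoseq n y := (forall j, (j < n)%N -> y j <= y j.+1) \/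
                          (forall j, (j < n)%N -> y j.+1 <= y j).

Lemma monoseq_sum n y : monoseq n y -> \sum_(j < n) `|y j.+1 - y j| = `|y n - y 0%N|.
Proof.
have tel : y n - y 0%N = \sum_(j < n) (y j.+1 - y j).
  by rewrite -telescope_sumr// big_mkord.
move=> [H|H]; rewrite tel.
  rewrite [RHS]ger0_norm; last by apply: sumr_ge0 => j _; rewrite subr_ge0 H.
  by apply: eq_bigr => j _; rewrite ger0_norm// subr_ge0 H.
rewrite [RHS]ler0_norm; last by apply: sumr_le0 => j _; rewrite subr_le0 H.
by rewrite -sumrN; apply: eq_bigr => j _; rewrite ler0_norm// subr_le0 H.
Qed.

Lemma monoseq_between n y j : monoseq n y -> (j <= n)%N ->
  Num.min (y 0%N) (y n) <= y j <= Num.max (y 0%N) (y n).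
Proof.
have up (z : nat -> R) a b : (forall j, (a <= j < b)%N -> z j <= z j.+1) -> (a <= b)%N -> z a <= z b.
  move=> H ab; rewrite -subr_ge0 -telescope_sumr// big_nat_cond.
  by apply: sumr_ge0 => k /andP[/H]; rewrite subr_ge0.
move=> [H|H] jn.
  have h1 : y 0%N <= y j by apply: up => // k /andP[_ kj]; apply: H; exact: leq_trans jn.
  have h2 : y j <= y n by apply: up => // k /andP[_ kj]; exact: H.
  by rewrite ge_min h1 le_max h2 orbT.
have h1 : - y 0%N <= - y j.
  by apply: (up (fun k => - y k)) => // k /andP[_ kj]; rewrite lerN2; apply: H; exact: leq_trans jn.
have h2 : - y j <= - y n.
  by apply: (up (fun k => - y k)) => // k /andP[_ kj]; rewrite lerN2; exact: H.
by rewrite ge_min le_max; rewrite !lerN2 in h1 h2; rewrite h1 h2 orbT.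
Qed.

(** On each cell the mean value theorem is applied to [P - phi (tag j) * g], whose derivative is
    [(phi - phi (tag j)) * dg]. Monotonicity of the partition makes the cell lengths add up to the
    distance of the endpoints. *)
Lemma stieltjes_sum_approx n y tag phi g dg (om D : R) :
  continuous phi -> continuous dg -> (forall x, is_derive x (1 : R) g (dg x)) ->
  monoseq n y -> 0 <= om ->
  (forall x, Num.min (y 0%N) (y n) <= x <= Num.max (y 0%N) (y n) -> `|dg x| <= D) ->
  (forall j c, (j < n)%N -> Num.min (y j) (y j.+1) <= c <= Num.max (y j) (y j.+1) ->
     `|phi c - phi (tag j)| <= om) ->
  `|\sum_(j < n) phi (tag j) * (g (y j.+1) - g (y j)) -
    (prim (fun x => phi x * dg x) (y n) - prim (fun x => phi x * dg x) (y 0%N))|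
   <= om * D * `|y n - y 0%N|.
Proof.
move=> cphi cdg dg_g my om0 bD bom.
set P := prim _.
have [dP _] := primP (continuous_mul cphi cdg).
have -> : P (y n) - P (y 0%N) = \sum_(j < n) (P (y j.+1) - P (y j)).
  by rewrite -(telescope_sumr (fun j => P (y j)))// big_mkord.
rewrite -sumrB -(monoseq_sum my) mulr_sumr.
apply: (le_trans (ler_norm_sum _ _ _)); apply: ler_sum => j _.
have d1 x : is_derive x (1 : R) (fun x => P x - phi (tag j) * g x)
    (phi x * dg x - phi (tag j) * dg x).
  exact: (is_derive_eq (is_deriveB (dP x) (is_deriveZ (phi (tag j)) (dg_g x)))).
have [c cj E] := mean_value (y j) (y j.+1) d1.
have -> : phi (tag j) * (g (y j.+1) - g (y j)) - (P (y j.+1) - P (y j)) =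
   - (P (y j.+1) - phi (tag j) * g (y j.+1) - (P (y j) - phi (tag j) * g (y j))) by ring.
rewrite E -mulrBl normrN !normrM.
apply: ler_wpM2r => //; apply: ler_pM => //; first exact: bom.
apply: bD; have /andP[c1 c2] := cj.
have /andP[a1 a2] := monoseq_between my (ltnW (ltn_ord j)).
have /andP[b1 b2] := monoseq_between my (ltn_ord j).
apply/andP; split.
  by apply: (le_trans _ c1); rewrite le_min a1.
by apply: (le_trans c2); rewrite ge_max a2.
Qed.

Lemma between_inbox (K a b c : R) : `|a| <= K -> `|b| <= K ->
  Num.min a b <= c <= Num.max a b -> `|c| <= K.
Proof.
rewrite !ler_norml => /andP[a1 a2] /andP[b1 b2] /andP[c1 c2].
by rewrite (le_trans _ c1) ?le_min ?a1// (le_trans c2)// ge_max a2.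
Qed.

Lemma monoseq_inbox (K : R) n y j : monoseq n y -> `|y 0%N| <= K -> `|y n| <= K ->
  (j <= n)%N -> `|y j| <= K.
Proof. by move=> my y0 yn jn; exact: between_inbox y0 yn (monoseq_between my jn). Qed.

Lemma between_dist (a b c : R) : Num.min a b <= c <= Num.max a b ->
  `|c - a| <= `|b - a| /\ `|c - b| <= `|b - a|.
Proof.
by case: (leP a b) => ab /andP[c1 c2]; split; rewrite ?[`|b - a|]distrC;
  rewrite ler_norml; case: (ger0P (b - a)); case: (ger0P (a - b)); lra.
Qed.

End monotone_partitions.

(** * Iterated one-dimensional functionals *)

Section tensor.
Context {R : realType} {N : nat}.
Notation vec := ('I_N -> R).
Notation functional := ((R -> R) -> R).
Implicit Types (F G : vec -> R) (t s r h : vec) (i j : 'I_N) (l : seq 'I_N).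
Implicit Types (a b : 'I_N -> functional).

Definition cofun i (f : functional) F : vec -> R := fun t => f (fun x => F (upd i x t)).

(* The head of the list acts first, i.e. innermost: the opposite of [incr] and [Eall]. *)
Definition cofunl l a F : vec -> R := foldl (fun H i => cofun i (a i) H) F l.

Definition lipschitz_fun (K C : R) (f : functional) := forall phi psi M,
  (forall x, `|x| <= K -> `|phi x - psi x| <= M) -> `|f phi - f psi| <= C * M.

Lemma inbox_upd K i x r : `|x| <= K -> inbox K r -> inbox K (upd i x r).
Proof. by move=> xK rK k; rewrite /upd; case: eqP. Qed.

Lemma cofunl_lip K C l a F G M : (forall i, i \in l -> lipschitz_fun K C (a i)) ->
  (forall r, inbox K r -> `|F r - G r| <= M) ->
  forall r, inbox K r -> `|cofunl l a F r - cofunl l a G r| <= C ^+ size l * M.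
Proof.
elim: l F G M => [|i l IH] F G M la FG r rK /=; first by rewrite expr0 mul1r; exact: FG.
rewrite exprSr -mulrA; apply: IH => // [j jl|r' r'K]; first by apply: la; rewrite inE jl orbT.
apply: la; first exact: mem_head.
by move=> x xK; apply: FG; exact: inbox_upd.
Qed.

(** The innermost sum is replaced by its limit first: that error is uniformly small and grows at
    most by [C ^+ size l] under the remaining sums. What remains is the induction hypothesis for the
    continuous function [cofun i (b i) F]. Here [good d g] stands for a grid [g] of mesh below
    [d]. *)
Lemma cofunl_approx (T : Type) (good : R -> T -> Prop) (A : T -> 'I_N -> functional)
    b (K C : R) l :
  0 <= C ->
  (forall d d' g, d <= d' -> good d g -> good d' g) ->
  (forall i d g, i \in l -> good d g -> lipschitz_fun K C (A g i)) ->
  (forall i F, i \in l -> cont_path F -> cont_path (cofun i (b i) F)) ->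
  (forall i F e, i \in l -> cont_path F -> 0 < e -> exists2 d, 0 < d &
     forall g, good d g -> forall r, inbox K r ->
       `|cofun i (A g i) F r - cofun i (b i) F r| <= e) ->
  forall F e, cont_path F -> 0 < e -> exists2 d, 0 < d &
    forall g, good d g -> forall r, inbox K r ->
      `|cofunl l (A g) F r - cofunl l b F r| <= e.
Proof.
move=> C0 gmono; elim: l => [|i l IH] lipA cb app F e cF e0.
  by exists 1 => // g _ r _; rewrite subrr normr0 ltW.
have e2 : 0 < e / 2 by rewrite divr_gt0.
have Cl : 0 < C ^+ size l + 1 by rewrite ltr_wpDl// exprn_ge0.
have il : i \in i :: l by exact: mem_head.
have sub j : j \in l -> j \in i :: l by rewrite inE orbC => ->.
have [d1 d10 H1] := app i F _ il cF (divr_gt0 e2 Cl).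
have [d2 d20 H2] := IH (fun j d g jl => lipA j d g (sub j jl)) (fun j G jl => cb j G (sub j jl))
  (fun j G e' jl => app j G e' (sub j jl)) _ (e / 2) (cb i F il cF) e2.
exists (Num.min d1 d2); first by rewrite lt_min d10.
move=> g gg r rK.
have g1 : good d1 g by apply: gmono gg; rewrite ge_min lexx.
have g2 : good d2 g by apply: gmono gg; rewrite ge_min lexx orbT.
rewrite -(subrK (cofunl l (A g) (cofun i (b i) F) r) (cofunl _ (A g) F r)) -addrA.
apply: (le_trans (ler_normD _ _)); rewrite (splitr e); apply: lerD; last exact: H2.
have := @cofunl_lip K C l (A g) (cofun i (A g i) F) (cofun i (b i) F) (e / 2 / (C ^+ size l + 1)).
move=> /(_ _ _ r rK) => H; apply: (le_trans (H _ _)) => //.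
- by move=> j /sub jl; exact: lipA gg.
- exact: H1.
by rewrite mulrCA ler_piMr ?(ltW e2)// ler_pdivrMr// mul1r lerDl.
Qed.

Definition depends_on (Q : pred 'I_N) F :=
  forall r r', (forall i, Q i -> r i = r' i) -> F r = F r'.

(** Once the coordinates of [l] are summed out, only the others of the base point matter. So the
    arbitrary tags at which an actual Riemann sum is based may be exchanged for a fixed point. *)
Lemma depends_cofunl (Q : pred 'I_N) l a F : depends_on Q F ->
  depends_on (fun i => Q i && (i \notin l)) (cofunl l a F).
Proof.
elim: l Q F => [|i l IH] Q F dF /=.
  by move=> r r' H; apply: dF => i Qi; apply: H; rewrite Qi.
have d1 : depends_on (fun j => Q j && (j != i)) (cofun i (a i) F).
  move=> r r' H; rewrite /cofun; congr (a i _); apply/funext => x; apply: dF => j Qj.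
  by rewrite /upd; case: (eqVneq j i) => // ji; apply: H; rewrite Qj.
move=> r r' H; apply: (IH _ _ d1) => j /andP[/andP[Qj ji] jl].
by apply: H; rewrite Qj inE negb_or ji.
Qed.

Definition updn i (x : nat) (k : 'I_N -> nat) : 'I_N -> nat := fun j => if j == i then x else k j.

Definition isum (m : 'I_N -> nat) l (H : ('I_N -> nat) -> R) : ('I_N -> nat) -> R :=
  foldl (fun H i => fun k => \sum_(j < m i) H (updn i j k)) H l.

Lemma grid_sumE (m : 'I_N -> nat) (M : nat) l (H : ('I_N -> nat) -> R) :
  uniq l -> (forall i, (m i <= M)%N) ->
  \sum_(k : {ffun 'I_N -> 'I_M.+1} |
          [forall i, if i \in l then (k i < m i)%N else k i == ord0])
     H (fun i => k i) = isum m l H (fun=> 0%N).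
Proof.
move=> + mM; elim: l H => [|i l IH] H.
  move=> _; rewrite (big_pred1 [ffun=> ord0])/=.
    by congr H; apply/funext => i; rewrite ffunE.
  move=> k; apply/forallP/eqP => [k0|-> i]; last by rewrite /= ffunE.
  by apply/ffunP => i; have := k0 i; rewrite /= ffunE => /eqP.
move=> /= /andP[il ul]; rewrite -IH//.
(* Erasing coordinate [i] splits the multi-indices over [i :: l] into fibres indexed by those over
   [l]; each fibre is a copy of the range of the i-th index. *)
pose er (k : {ffun 'I_N -> 'I_M.+1}) : {ffun 'I_N -> 'I_M.+1} :=
  [ffun x => if x == i then ord0 else k x].
pose fam (q : seq 'I_N) (k : {ffun 'I_N -> 'I_M.+1}) :=
  [forall i, if i \in q then (k i < m i)%N else k i == ord0].
rewrite (partition_big er (fam l)) /=; last first.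
  move=> k /forallP fk; apply/forallP => x; rewrite ffunE.
  have := fk x; rewrite inE; case: (eqVneq x i) => [->|]//=.
  by rewrite (negbTE il).
apply: eq_bigr => k0 fk0.
rewrite (reindex_onto (fun j : 'I_M.+1 => [ffun x => if x == i then j else k0 x] : {ffun 'I_N -> 'I_M.+1})
   (fun k => k i))/=; last first.
  move=> k /andP[_ /eqP <-]; apply/ffunP => x; rewrite !ffunE.
  by case: eqP => // ->.
rewrite (@big_ord_widen_cond _ _ _ (m i) M.+1 predT (fun j : nat => H (updn i j (fun x => k0 x))))/=; last first.
  exact: leqW.
apply: eq_big => [j|j _].
  apply/andP/idP => [[/andP[/forallP/(_ i)]]|ji].
    by rewrite mem_head ffunE eqxx.
  split; last by rewrite ffunE eqxx.
  apply/andP; split; last first.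
    apply/eqP/ffunP => x; rewrite !ffunE; case: eqP => // ->.
    by have /forallP/(_ i) := fk0; rewrite (negbTE il) => /eqP.
  apply/forallP => x; rewrite ffunE inE; case: (eqVneq x i) => [->//|xi]/=.
  by have /forallP/(_ x) := fk0.
by congr H; apply/funext => x; rewrite /updn ffunE; case: eqP.
Qed.

End tensor.

(** * One-dimensional Riemann and Stieltjes sums *)

Section one_dimensional_grids.
Context {R : realType}.
Implicit Types (phi psi : R -> R).

Definition grid1 (K d s t : R) (m : nat) (p xi : nat -> R) : Prop :=
  [/\ monoseq m p, p 0%N = s /\ p m = t,
      forall j, (j < m)%N -> Num.min (p j) (p j.+1) <= xi j <= Num.max (p j) (p j.+1),
      forall j, (j < m)%N -> `|p j.+1 - p j| < d & `|s| <= K /\ `|t| <= K].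

Lemma grid1_length (K d s t : R) m p xi : grid1 K d s t m p xi -> `|t - s| <= 2 * K.
Proof.
move=> [_ _ _ _ [sK tK]]; rewrite (le_trans (ler_normB _ _))// mulr_natl mulr2n addrC.
exact: lerD.
Qed.

Lemma grid1_tag (K d s t : R) m p xi j : grid1 K d s t m p xi -> (j < m)%N -> `|xi j| <= K.
Proof.
move=> [mp [p0 pm] tg _ [sK tK]] jm.
have pK k : (k <= m)%N -> `|p k| <= K.
  by move=> km; apply: (monoseq_inbox mp) => //; rewrite ?p0 ?pm.
by apply: (between_inbox _ _ (tg j jm)); apply: pK; rewrite // ltnW.
Qed.

Definition leb_sum m (p xi : nat -> R) phi := \sum_(j < m) phi (xi j) * (p j.+1 - p j).

Lemma leb_sum_lip (K d s t : R) m p xi : grid1 K d s t m p xi ->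
  lipschitz_fun K (2 * K) (leb_sum m p xi).
Proof.
move=> gr phi psi M H; have [mp [p0 pm] tg _ [sK tK]] := gr.
have M0 : 0 <= M by exact: (le_trans (normr_ge0 _) (H _ sK)).
rewrite /leb_sum -sumrB; apply: (le_trans (ler_norm_sum _ _ _)).
apply: (@le_trans _ _ (M * \sum_(j < m) `|p j.+1 - p j|)).
  rewrite mulr_sumr; apply: ler_sum => j _; rewrite -mulrBl normrM.
  by apply: ler_wpM2r => //; apply: H; exact: grid1_tag gr _.
rewrite (monoseq_sum mp) p0 pm mulrC; apply: ler_wpM2r => //; exact: grid1_length gr.
Qed.

Lemma leb_sum_approx (K d s t om : R) m p xi phi : grid1 K d s t m p xi ->
  continuous phi -> 0 <= om ->
  (forall x y, `|x| <= K -> `|y| <= K -> `|x - y| < d -> `|phi x - phi y| <= om) ->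
  `|leb_sum m p xi phi - (prim phi t - prim phi s)| <= om * (2 * K).
Proof.
move=> gr cphi om0 H; have [mp [p0 pm] tg ms [sK tK]] := gr.
have pK k : (k <= m)%N -> `|p k| <= K.
  by move=> km; apply: (monoseq_inbox mp) => //; rewrite ?p0 ?pm.
have := @stieltjes_sum_approx R m p xi phi id (fun=> 1) om 1 cphi
  (@cst_continuous _ _ (1 : R)) (fun x => is_derive_id x 1).
have -> : (fun x => phi x * 1) = phi by apply/funext => x; rewrite mulr1.
rewrite p0 pm mulr1 => /(_ mp om0) HH.
apply: (le_trans (HH _ _)).
- by move=> x _; rewrite normr1.
- move=> j c jm cj; apply: H.
  + by apply: (between_inbox _ _ cj); apply: pK => //; exact: ltnW.
  + exact: grid1_tag gr jm.
  apply: (le_lt_trans _ (ms j jm)).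
  have /andP[c1 c2] := cj; have /andP[x1 x2] := tg j jm.
  rewrite ler_norml; move: c1 c2 x1 x2.
  by case: (leP (p j) (p j.+1)) => pp; case: (ger0P (p j.+1 - p j)); lra.
- by apply: ler_wpM2l => //; exact: grid1_length gr.
Qed.

Lemma summation_by_parts (a f : nat -> R) m :
  \sum_(j < m) a j.+1 * (f j.+1 - f j) =
  a m.+1 * f m - a 0%N * f 0%N - \sum_(j < m.+1) f j * (a j.+1 - a j).
Proof.
elim: m => [|m IH]; first by rewrite big_ord0 big_ord_recr big_ord0/=; ring.
by rewrite big_ord_recr/= IH [in RHS]big_ord_recr/=; ring.
Qed.

Definition exp_sum (th : R) m (p xi : nat -> R) phi :=
  \sum_(j < m) expR (th * xi j) * (phi (p j.+1) - phi (p j)).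

(* Summation by parts exchanges the roles of the partition and of the tags: the tags, completed by the
   endpoints, become the partition. *)
Definition interlace (s t : R) m (xi : nat -> R) j :=
  if j is j'.+1 then (if (j' < m)%N then xi j' else t) else s.

Lemma exp_sum_parts (th K d s t : R) m p xi phi : grid1 K d s t m p xi ->
  exp_sum th m p xi phi = expR (th * t) * phi t - expR (th * s) * phi s -
   \sum_(j < m.+1) phi (p j) *
     (expR (th * interlace s t m xi j.+1) - expR (th * interlace s t m xi j)).
Proof.
move=> [_ [p0 pm] _ _ _].
have := summation_by_parts (fun j => expR (th * interlace s t m xi j)) (fun j => phi (p j)) m.
rewrite /= ltnn p0 pm => <-; apply: eq_bigr => j _.
by rewrite /= ltn_ord.
Qed.

Lemma interlace_monoseq (K d s t : R) m p xi : grid1 K d s t m p xi ->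
  monoseq m.+1 (interlace s t m xi).
Proof.
move=> [[H|H] [p0 pm] tg _ _]; [left|right] => j jm.
  have h1 : interlace s t m xi j <= p j.
    case: j jm => [|j] /=; first by rewrite p0.
    rewrite ltnS => jm; rewrite jm.
    by have /andP[_] := tg j jm; rewrite max_r ?H.
  have h2 : p j <= interlace s t m xi j.+1.
    move: jm; rewrite ltnS leq_eqVlt => /orP[/eqP ->|jm /=]; first by rewrite /= ltnn pm.
    by rewrite jm; have /andP[+ _] := tg j jm; rewrite min_l ?H.
  exact: le_trans h1 h2.
have h1 : p j <= interlace s t m xi j.
  case: j jm => [|j] /=; first by rewrite p0.
  rewrite ltnS => jm; rewrite jm.
  by have /andP[+ _] := tg j jm; rewrite min_r ?H.
have h2 : interlace s t m xi j.+1 <= p j.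
  move: jm; rewrite ltnS leq_eqVlt => /orP[/eqP ->|jm /=]; first by rewrite /= ltnn pm.
  by rewrite jm; have /andP[_] := tg j jm; rewrite max_l ?H.
exact: le_trans h2 h1.
Qed.

Lemma interlace_dist (K d s t : R) m p xi j : 0 < d -> grid1 K d s t m p xi -> (j <= m)%N ->
  `|interlace s t m xi j - p j| < d /\ `|interlace s t m xi j.+1 - p j| < d.
Proof.
move=> d0 [_ [p0 pm] tg ms _] jm; split.
  case: j jm => [|j] jm /=; first by rewrite p0 subrr normr0.
  rewrite jm; have [_ h] := between_dist (tg j jm).
  by apply: (le_lt_trans h); exact: ms.
move: jm; rewrite leq_eqVlt => /orP[/eqP ->|jm /=]; first by rewrite /= ltnn pm subrr normr0.
by rewrite jm; have [h _] := between_dist (tg j jm); apply: (le_lt_trans h); exact: ms.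
Qed.

Lemma interlace_inbox (K d s t : R) m p xi j : grid1 K d s t m p xi ->
  `|interlace s t m xi j| <= K.
Proof.
move=> gr; have [_ _ _ _ [sK tK]] := gr.
by case: j => [|j]//=; case: ifP => // jm; exact: grid1_tag gr jm.
Qed.

Definition exp_slope (th K : R) := `|th| * expR (`|th| * K).

Let expR_bound (th K x : R) : `|x| <= K -> expR (th * x) <= expR (`|th| * K).
Proof.
move=> xK; rewrite ler_expR; apply: (le_trans (ler_norm _)).
by rewrite normrM; exact: ler_wpM2l.
Qed.

Let dexp_bound (th K x : R) : `|x| <= K -> `|th * expR (th * x)| <= exp_slope th K.
Proof.
move=> xK; rewrite normrM (ger0_norm (expR_ge0 _)).
by apply: ler_wpM2l => //; exact: expR_bound.
Qed.

(** Two boundary terms of the summation by parts, plus the slope of the exponential times the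
    greatest length of the interlaced partition. *)
Definition exp_lip (th K : R) := 2 * expR (`|th| * K) + exp_slope th K * (2 * K).

(** A direct estimate of the differences of [phi] would grow with the number of cells. After
    summation by parts [phi] enters by its values only, weighted with increments of the exponential,
    and the bound depends on [K] alone. *)
Lemma exp_sum_lip (th K d s t : R) m p xi : grid1 K d s t m p xi ->
  lipschitz_fun K (exp_lip th K) (exp_sum th m p xi).
Proof.
move=> gr phi psi M H; have [mp [p0 pm] tg _ [sK tK]] := gr.
have M0 : 0 <= M by exact: (le_trans (normr_ge0 _) (H _ sK)).
have D0 : 0 <= exp_slope th K by rewrite mulr_ge0 ?expR_ge0.
rewrite !(exp_sum_parts th _ gr).
set y := interlace s t m xi.
set S1 := \sum_(j < _) _; set S2 := \sum_(j < _) _.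
have hS : `|S1 - S2| <= exp_slope th K * (2 * K) * M.
  rewrite /S1 /S2 -sumrB; apply: (le_trans (ler_norm_sum _ _ _)).
  apply: (@le_trans _ _ (M * exp_slope th K * \sum_(j < m.+1) `|y j.+1 - y j|)).
    rewrite mulr_sumr; apply: ler_sum => j _; rewrite -mulrBl normrM -mulrA.
    apply: ler_pM => //.
      apply: H; apply: (monoseq_inbox mp); rewrite ?p0 ?pm//.
      by rewrite -ltnS.
    have [c cy ->] := mean_value (y j) (y j.+1) (is_derive_expM th).
    rewrite normrM; apply: ler_wpM2r => //; apply: dexp_bound.
    by apply: (between_inbox _ _ cy); exact: interlace_inbox gr.
  rewrite (monoseq_sum (interlace_monoseq gr)) /y /= ltnn.
  rewrite [leRHS]mulrC [leRHS]mulrA; apply: ler_wpM2l; first exact: mulr_ge0.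
  exact: grid1_length gr.
have e1 x : `|x| <= K -> `|expR (th * x) * phi x - expR (th * x) * psi x| <= expR (`|th| * K) * M.
  move=> xK; rewrite -mulrBr normrM (ger0_norm (expR_ge0 _)).
  by apply: ler_pM; rewrite ?expR_ge0//; [exact: expR_bound|exact: H].
have := e1 _ sK; have := e1 _ tK; move: hS.
have -> : expR (th * t) * phi t - expR (th * s) * phi s - S1 -
   (expR (th * t) * psi t - expR (th * s) * psi s - S2) =
   (expR (th * t) * phi t - expR (th * t) * psi t) -
   (expR (th * s) * phi s - expR (th * s) * psi s) - (S1 - S2) by ring.
move=> h1 h2 h3; apply: (le_trans (ler_normB _ _)).
have := ler_normB (expR (th * t) * phi t - expR (th * t) * psi t)
  (expR (th * s) * phi s - expR (th * s) * psi s).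
rewrite /exp_lip; lra.
Qed.

(** After summation by parts the sum is a Stieltjes sum of [phi] against the smooth exponential, to
    which [stieltjes_sum_approx] applies with the old partition points as tags. *)
Lemma exp_sum_approx (th K d s t om : R) m p xi phi : 0 < d -> grid1 K d s t m p xi ->
  continuous phi -> 0 <= om ->
  (forall x y, `|x| <= K -> `|y| <= K -> `|x - y| < d -> `|phi x - phi y| <= om) ->
  `|exp_sum th m p xi phi - (eop th phi t - eop th phi s)| <= om * (exp_slope th K * (2 * K)).
Proof.
move=> d0 gr cphi om0 H; have [mp [p0 pm] tg ms [sK tK]] := gr.
have D0 : 0 <= exp_slope th K by rewrite mulr_ge0 ?expR_ge0.
have cdg : continuous (fun x => th * expR (th * x)).
  by apply: continuous_mul; [move=> x; exact: cvg_cst|exact: continuous_expM].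
have cexp : continuous (fun x => expR (th * x) * phi x).
  by apply: continuous_mul => //; exact: continuous_expM.
(* The constant [th] is moved out of the primitive by linearity, with second coefficient 0. *)
have primE : prim (fun x => phi x * (th * expR (th * x))) =
    (fun x => th * prim (fun y => expR (th * y) * phi y) x).
  have := prim_lin th 0 cexp cexp.
  rewrite (_ : (fun x => _) = (fun x => phi x * (th * expR (th * x)))); last first.
    by apply/funext => x; ring.
  by move=> ->; apply/funext => x; ring.
rewrite (exp_sum_parts th _ gr).
set y := interlace s t m xi; set S := \sum_(j < _) _.
have my := interlace_monoseq gr.
have yK j : `|y j| <= K by exact: interlace_inbox gr.
have HS := @stieltjes_sum_approx R m.+1 y p phi (fun x => expR (th * x)) _ om (exp_slope th K) cphi cdg
  (is_derive_expM th) my om0.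
have {}HS : `|S - (th * prim (fun y => expR (th * y) * phi y) t -
     th * prim (fun y => expR (th * y) * phi y) s)| <= om * exp_slope th K * `|t - s|.
  have -> : t = y m.+1 by rewrite /y /= ltnn.
  rewrite -[s]/(y 0%N); move: HS; rewrite primE; apply.
    by move=> x xy; apply: dexp_bound; exact: (between_inbox _ _ xy).
  move=> j c; rewrite ltnS => jm cy; apply: H.
  - exact: (between_inbox _ _ cy).
  - by apply: (monoseq_inbox mp); rewrite ?p0 ?pm.
  have [] := interlace_dist d0 gr jm; rewrite -/y !ltr_norml.
  move=> /andP[a1 a2] /andP[b1 b2]; have /andP[c1 c2] := cy.
  move: c1 c2; case: (leP (y j) (y j.+1)) => _ *; apply/andP; split; lra.
rewrite /eop -normrN.
have -> : - (expR (th * t) * phi t - expR (th * s) * phi s - S -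
    (expR (th * t) * phi t - th * prim (fun y => expR (th * y) * phi y) t -
     (expR (th * s) * phi s - th * prim (fun y => expR (th * y) * phi y) s))) =
  S - (th * prim (fun y => expR (th * y) * phi y) t -
     th * prim (fun y => expR (th * y) * phi y) s) by ring.
apply: (le_trans HS); rewrite [leRHS]mulrA; apply: ler_wpM2l; first exact: mulr_ge0.
exact: grid1_length gr.
Qed.

Lemma exp_lip_ge0 (th K : R) : 0 <= K -> 0 <= exp_lip th K.
Proof. by move=> K0; rewrite /exp_lip /exp_slope addr_ge0// ?mulr_ge0 ?expR_ge0. Qed.

Lemma exp_lip_ge (th K : R) : exp_slope th K * (2 * K) <= exp_lip th K.
Proof. by rewrite /exp_lip lerDr mulr_ge0// expR_ge0. Qed.

End one_dimensional_grids.

(** * Existence and uniqueness of multiple integrals *)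

Section multiple_integrals.
Context {R : realType} {N : nat}.
Notation vec := ('I_N -> R).
Notation grid := (('I_N -> nat) * ('I_N -> nat -> R) * ('I_N -> nat -> R))%type.
Implicit Types (F G : vec -> R) (t s r : vec) (i j : 'I_N) (l : seq 'I_N) (u : {set 'I_N}).

Definition good_grid u s t (d : R) (g : grid) :=
  is_grid u s t g.1.1 g.1.2 g.2 /\ mesh_lt u d g.1.1 g.1.2.

Lemma is_grid_grid1 (K d : R) u s t m p xi i : inbox K s -> inbox K t ->
  is_grid u s t m p xi -> mesh_lt u d m p -> i \in u ->
  grid1 K d (s i) (t i) (m i) (p i) (xi i).
Proof.
move=> sK tK gr ms iu; have [m0 p0 pm H] := gr i iu.
split; [|by []| |exact: ms|by split; [exact: sK|exact: tK]].
  case: (leP (s i) (t i)) => [st|/ltW ts]; [left|right] => j jm.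
    by have [h _ _] := H j jm; exact: h.
  by have [_ h _] := H j jm; exact: h.
by move=> j jm; have [] := H j jm.
Qed.

Definition hull s t : R := \sum_i `|s i| + \sum_i `|t i|.

Lemma hull_ge0 s t : 0 <= hull s t.
Proof. by rewrite addr_ge0// sumr_ge0. Qed.

Lemma hull_inboxl s t : inbox (hull s t) s.
Proof. by move=> i; rewrite (le_trans (vec_inbox s i))// lerDl sumr_ge0. Qed.

Lemma hull_inboxr s t : inbox (hull s t) t.
Proof. by move=> i; rewrite (le_trans (vec_inbox t i))// lerDr sumr_ge0. Qed.

Definition leb_part m (p xi : 'I_N -> nat -> R) i := leb_sum (m i) (p i) (xi i).

Definition leb_int s t i (phi : R -> R) := prim phi (t i) - prim phi (s i).

Definition exp_part th m (p xi : 'I_N -> nat -> R) i := exp_sum (th i) (m i) (p i) (xi i).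

Definition exp_int th s t i (phi : R -> R) : R := eop (th i) phi (t i) - eop (th i) phi (s i).

Lemma isum_leb m p xi l H F k : uniq l ->
  (forall k, H k = F (fun i => xi i (k i)) * \prod_(i <- l) (p i (k i).+1 - p i (k i))) ->
  isum m l H k = cofunl l (leb_part m p xi) F (fun i => xi i (k i)).
Proof.
elim: l H F => [|i l IH] H F /=.
  by move=> _ ->; rewrite big_nil mulr1.
move=> /andP[il ul] HE.
rewrite -(IH (fun k => \sum_(j < m i) H (updn i j k)))// => k'.
rewrite /cofun /leb_part /leb_sum mulr_suml; apply: eq_bigr => j _.
rewrite HE big_cons /updn eqxx mulrA; congr (F _ * _ * _).
  by apply/funext => x; rewrite /upd; case: eqP => // ->.
rewrite big_seq [RHS]big_seq; apply: eq_bigr => x xl.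
by case: eqP => // xi'; rewrite xi' (negbTE il) in xl.
Qed.

(** The base point [fun i => xi i 0%N] is forced by [RSsum], which uses cell index 0 in every
    coordinate outside [u]. *)
Lemma RSsum_leb u l F m p xi : uniq l -> u = [set x in l]%SET ->
  RSsum u F (leb_incr u) m p xi = cofunl l (leb_part m p xi) F (fun i => xi i 0%N).
Proof.
move=> ul uE.
pose H (k : 'I_N -> nat) :=
  F (fun i => xi i (k i)) * \prod_(i <- l) (p i (k i).+1 - p i (k i)).
rewrite -(@isum_leb m p xi l H F)// -(@grid_sumE R N m (\max_(i < N) m i))//; last first.
  by move=> i; exact: leq_bigmax.
apply: eq_big => [k|k _].
  by apply: eq_forallb => i; rewrite uE inE.
rewrite /H /leb_incr; congr (_ * _).
by rewrite (big_uniq _ ul)/=; apply: eq_bigl => i; rewrite uE inE.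
Qed.

Lemma incr_lincomb l s t n (c : 'I_n -> R) (H : 'I_n -> vec -> R) r :
  incr l s t (fun r => \sum_(j < n) c j * H j r) r = \sum_(j < n) c j * incr l s t (H j) r.
Proof. by rewrite incr_sum; apply: eq_bigr => j _; rewrite incrZ. Qed.

Lemma isum_exp th m p xi l H G k r : uniq l ->
  (forall k, H k = \prod_(i <- l) expR (th i * xi i (k i)) *
     incr l (fun i => p i (k i)) (fun i => p i (k i).+1) G r) ->
  isum m l H k = cofunl l (exp_part th m p xi) G r.
Proof.
elim: l H G => [|i l IH] H G /=.
  by move=> _ ->; rewrite big_nil mul1r.
move=> /andP[il ul] HE.
rewrite -(IH (fun k => \sum_(j < m i) H (updn i j k)))// => k'.
rewrite /cofun /exp_part /exp_sum incr_lincomb mulr_sumr; apply: eq_bigr => j _.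
rewrite HE big_cons incr_cons -incr_dif.
have updE x : x \in l -> updn i j k' x = k' x.
  by move=> xl; rewrite /updn; case: eqP => // xi'; rewrite xi' (negbTE il) in xl.
have -> : \prod_(x <- l) expR (th x * xi x (updn i j k' x)) =
    \prod_(x <- l) expR (th x * xi x (k' x)).
  by rewrite big_seq [RHS]big_seq; apply: eq_bigr => x xl; rewrite updE.
rewrite (_ : dif i _ _ G = (fun r => G (upd i (p i j.+1) r) - G (upd i (p i j) r))); last first.
  by apply/funext => r'; rewrite /dif /updn eqxx.
rewrite (@incr_ext R N l _ _ (fun x => p x (k' x)) (fun x => p x (k' x).+1)); last 2 first.
- by move=> x xl; rewrite updE.
- by move=> x xl; rewrite updE.
rewrite /updn eqxx; ring.
Qed.

(** The exponential is a product over the coordinates and the rectangular increment is an iterated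
    difference, so the sum is a composition of the functionals [exp_part], in any order. *)
Lemma RSsum_exp th l G m p xi r : perm_eq l (enum 'I_N) ->
  RSsum [set: 'I_N]%SET (fun x => expR (dotv th x)) (fun a b => rect_incr G a b) m p xi =
  cofunl l (exp_part th m p xi) G r.
Proof.
move=> pl; have ul : uniq l by rewrite (perm_uniq pl) enum_uniq.
have inl i : i \in l by rewrite (perm_mem pl) mem_enum.
pose H (k : 'I_N -> nat) := \prod_(i <- l) expR (th i * xi i (k i)) *
     incr l (fun i => p i (k i)) (fun i => p i (k i).+1) G r.
rewrite -(@isum_exp th m p xi l H G (fun=> 0%N))//.
rewrite -(@grid_sumE R N m (\max_(i < N) m i))//; last first.
  by move=> i; exact: leq_bigmax.
apply: eq_big => [k|k _].
  by apply: eq_forallb => i; rewrite inl inE.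
rewrite /H (rect_incrE _ _ _ r); congr (_ * _).
  by rewrite /dotv expR_sum (perm_big _ pl)/= big_enum.
rewrite -!incr_partE ?enum_uniq//; congr (incr_part _ _ _ _ _).
by apply/finset.setP => i; rewrite !inE inl mem_enum.
Qed.

Lemma line_modulus (K e d : R) F i : (forall s t, inbox K s -> inbox K t ->
    (forall i, `|s i - t i| < d) -> `|F s - F t| < e) -> 0 < d ->
  forall r, inbox K r -> forall x y, `|x| <= K -> `|y| <= K -> `|x - y| < d ->
    `|F (upd i x r) - F (upd i y r)| <= e.
Proof.
move=> H d0 r rK x y xK yK xy; apply/ltW/H; [exact: inbox_upd|exact: inbox_upd|].
by move=> j; rewrite /upd; case: eqP => // _; rewrite subrr normr0.
Qed.

Lemma cofun_leb_int s t i F :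
  cofun i (leb_int s t i) F = dif i s t (lop i (@prim R) F).
Proof. by apply/funext => r; rewrite /cofun /leb_int /dif !lop_upd. Qed.

Lemma cofun_exp_int th s t i F :
  cofun i (exp_int th s t i) F = dif i s t (lop i (eop (th i)) F).
Proof. by apply/funext => r; rewrite /cofun /exp_int /dif !lop_upd. Qed.

(** Since [is_grid] leaves the tags outside [u] arbitrary, a limit is available because [F] sees
    only the coordinates in [u]. *)
Lemma RSint_leb u l s t F : uniq l -> u = [set x in l]%SET -> cont_path F ->
  depends_on (fun i => i \in u) F ->
  RSint u s t F (leb_incr u) (cofunl l (leb_int s t) F s).
Proof.
move=> ul uE cF dF eps eps0.
have inu i : (i \in u) = (i \in l) by rewrite uE inE.
set K := hull s t; have K0 : 0 <= K := hull_ge0 s t.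
have sK := @hull_inboxl s t; have tK := @hull_inboxr s t.
have hyp1 : forall d d' (g : grid), d <= d' -> good_grid u s t d g -> good_grid u s t d' g.
  move=> d1 d2 g d12 [gr ms]; split=> // i iu j jm.
  by apply: (lt_le_trans (ms i iu j jm)).
have hyp2 : forall i d (g : grid), i \in l -> good_grid u s t d g -> lipschitz_fun K (2 * K) (leb_part g.1.1 g.1.2 g.2 i).
  move=> i d g il [gr ms].
  by apply: leb_sum_lip; apply: (is_grid_grid1 sK tK gr ms); rewrite inu.
have hyp3 : forall i G, i \in l -> cont_path G -> cont_path (cofun i (leb_int s t i) G).
  move=> i G il cG; rewrite cofun_leb_int; apply: dif_cont; apply: lop_cont => //.
  exact: line_op_prim.
have hyp4 : forall i G e, i \in l -> cont_path G -> 0 < e -> exists2 d, 0 < d &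
    forall g : grid, good_grid u s t d g -> forall r, inbox K r ->
      `|cofun i (leb_part g.1.1 g.1.2 g.2 i) G r - cofun i (leb_int s t i) G r| <= e.
  move=> i G e il cG e0.
  have K1 : 0 < 2 * K + 1 by rewrite ltr_wpDl// mulr_ge0.
  have [d d0 H] := cont_path_unif K cG (divr_gt0 e0 K1).
  exists d => // g [gr ms] r rK.
  have gr1 : grid1 K d (s i) (t i) (g.1.1 i) (g.1.2 i) (g.2 i).
    by apply: (is_grid_grid1 sK tK gr ms); rewrite inu.
  have o0 : 0 <= e / (2 * K + 1) by rewrite divr_ge0// ltW.
  apply: (le_trans (leb_sum_approx gr1 (@cont_path_line _ _ G i r cG) o0 (line_modulus i H d0 rK))).
  by rewrite -mulrA ler_piMr ?(ltW e0)// mulrC ler_pdivrMr// mul1r lerDl.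
have [d d0 H] := @cofunl_approx R N grid (good_grid u s t)
  (fun g => leb_part g.1.1 g.1.2 g.2) (leb_int s t) K (2 * K) l
  (mulr_ge0 (ler0n R 2) K0) hyp1 hyp2 hyp3 hyp4 F (eps / 2) cF (divr_gt0 eps0 (ltr0Sn R 1)).
exists d => // m p xi gr ms.
rewrite (RSsum_leb _ _ _ _ ul uE).
have -> : cofunl l (leb_part m p xi) F (fun i => xi i 0%N) = cofunl l (leb_part m p xi) F s.
  by apply: (@depends_cofunl R N _ l (leb_part m p xi) F dF) => i; rewrite inu; case: (i \in l).
apply: (le_lt_trans (H (m, p, xi) _ s sK)); first by split.
by rewrite ltr_pdivrMr// ltr_pMr// ltr1n.
Qed.

Lemma Eall_dif th i l s t F : cont_path F -> i \notin l ->
  Eall th l (dif i s t F) = dif i s t (Eall th l F).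
Proof.
move=> cF; elim: l => //= j l IH; rewrite inE negb_or => /andP[ij /IH ->].
rewrite -[dif i s t (lop _ _ _)]/(incr [:: i] s t (lop _ _ _)) incr_lop//.
- exact: line_op_eop.
- exact: Eall_cont.
- by rewrite inE eq_sym.
Qed.

Lemma cofunl_exp_int th l s t F : uniq l -> cont_path F ->
  cofunl l (exp_int th s t) F = incr l s t (Eall th (rev l) F).
Proof.
elim: l F => //= i l IH F /andP[il ul] cF.
have cE : cont_path (lop i (eop (th i)) F) by apply: lop_cont => //; exact: line_op_eop.
rewrite cofun_exp_int IH//; last exact: dif_cont.
rewrite Eall_dif ?mem_rev// incr_dif rev_cons -cats1 /Eall foldr_cat/=.
by rewrite incr_cons.
Qed.

Lemma RSint_exp th s t G : cont_path G ->
  RSint [set: 'I_N]%SET s t (fun x => expR (dotv th x)) (fun a b => rect_incr G a b)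
    (rect_incr (Eall th (enum 'I_N) G) s t).
Proof.
move=> cG eps eps0.
(* [cofunl] applies the head of its list first and [Eall] applies it last; the reversal yields
   [Eall] over [enum 'I_N]. *)
pose l := rev (enum 'I_N).
have pl : perm_eq l (enum 'I_N) by rewrite perm_rev.
have ul : uniq l by rewrite rev_uniq enum_uniq.
have -> : rect_incr (Eall th (enum 'I_N) G) s t = cofunl l (exp_int th s t) G s.
  rewrite cofunl_exp_int// /l revK -incr_partE//.
  by rewrite /rect_incr; congr (incr_part _ _ _ _ _); apply/finset.setP => i; rewrite !inE mem_rev mem_enum.
set K := hull s t; have K0 : 0 <= K := hull_ge0 s t.
have sK := @hull_inboxl s t; have tK := @hull_inboxr s t.
pose C := \sum_i exp_lip (th i) K.
have CE i : exp_lip (th i) K <= C.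
  by rewrite /C (bigD1 i)//= lerDl sumr_ge0// => j _; exact: exp_lip_ge0.
have C0 : 0 <= C by apply: sumr_ge0 => j _; exact: exp_lip_ge0.
have hyp1 : forall d d' (g : grid), d <= d' -> good_grid [set: 'I_N]%SET s t d g -> good_grid [set: 'I_N]%SET s t d' g.
  move=> d1 d2 g d12 [gr ms]; split=> // i iu j jm.
  by apply: (lt_le_trans (ms i iu j jm)).
have hyp2 : forall i d (g : grid), i \in l -> good_grid [set: 'I_N]%SET s t d g -> lipschitz_fun K C (exp_part th g.1.1 g.1.2 g.2 i).
  move=> i d g il [gr ms] phi psi M HM.
  have M0 : 0 <= M by exact: (le_trans (normr_ge0 _) (HM _ (sK i))).
  have gr1 := is_grid_grid1 sK tK gr ms (finset.in_setT i).
  by apply: (le_trans (@exp_sum_lip R (th i) K d _ _ _ _ _ gr1 phi psi M HM)); apply: ler_wpM2r.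
have hyp3 : forall i G, i \in l -> cont_path G -> cont_path (cofun i (exp_int th s t i) G).
  move=> i F il cF; rewrite cofun_exp_int; apply: dif_cont; apply: lop_cont => //.
  exact: line_op_eop.
have hyp4 : forall i G e, i \in l -> cont_path G -> 0 < e -> exists2 d, 0 < d &
    forall g : grid, good_grid [set: 'I_N]%SET s t d g -> forall r, inbox K r ->
      `|cofun i (exp_part th g.1.1 g.1.2 g.2 i) G r - cofun i (exp_int th s t i) G r| <= e.
  move=> i F e il cF e0.
  have K1 : 0 < exp_lip (th i) K + 1 by rewrite ltr_wpDl// exp_lip_ge0.
  have [d d0 H] := cont_path_unif K cF (divr_gt0 e0 K1).
  exists d => // g [gr ms] r rK.
  have gr1 := is_grid_grid1 sK tK gr ms (finset.in_setT i).
  have o0 : 0 <= e / (exp_lip (th i) K + 1) by rewrite divr_ge0// ltW.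
  apply: (le_trans (exp_sum_approx (th i) d0 gr1 (@cont_path_line _ _ F i r cF) o0 (line_modulus i H d0 rK))).
  rewrite -mulrA ler_piMr ?(ltW e0)// mulrC ler_pdivrMr// mul1r.
  by rewrite (le_trans (exp_lip_ge _ _))// lerDl.
have [d d0 H] := @cofunl_approx R N grid (good_grid [set: 'I_N]%SET s t)
  (fun g => exp_part th g.1.1 g.1.2 g.2) (exp_int th s t) K C l
  C0 hyp1 hyp2 hyp3 hyp4 G (eps / 2) cG (divr_gt0 eps0 (ltr0Sn R 1)).
exists d => // m p xi gr ms.
rewrite (RSsum_exp _ _ _ _ _ s pl).
apply: (le_lt_trans (H (m, p, xi) _ s sK)); first by split.
by rewrite ltr_pdivrMr// ltr_pMr// ltr1n.
Qed.

(** Admissible grids of every mesh exist, for instance equal steps tagged at their starting points,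
    so one sum is close to both values. *)
Lemma RSint_unique u s t g incrf I I' : RSint u s t g incrf I -> RSint u s t g incrf I' -> I = I'.
Proof.
move=> H H'; apply/eqP; rewrite -subr_eq0 -normr_le0 leNgt; apply/negP => e0.
have [d d0 Hd] := H _ (divr_gt0 e0 (ltr0Sn R 1)).
have [d' d'0 Hd'] := H' _ (divr_gt0 e0 (ltr0Sn R 1)).
pose D := Num.min d d'.
have D0 : 0 < D by rewrite lt_min d0.
pose L := \sum_i `|t i - s i|.
pose n := (Num.truncn (L / D)).+1.
have n0 : 0 < n%:R :> R by rewrite ltr0n.
have Ln : L / n%:R < D.
  by rewrite ltr_pdivrMr// mulrC -ltr_pdivrMr//; exact: truncnS_gt.
pose p i (j : nat) := s i + (t i - s i) * (j%:R / n%:R).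
have step i (j : nat) : p i j.+1 - p i j = (t i - s i) / n%:R.
  by rewrite /p -natr1; field; rewrite gt_eqF.
have gr : is_grid u s t (fun=> n) p p.
  move=> i iu; split=> //.
  - by rewrite /p mul0r mulr0 addr0.
  - by rewrite /p divff ?gt_eqF// mulr1 addrC subrK.
  - move=> j jn; split.
    + by move=> st; rewrite -subr_ge0 step divr_ge0 ?subr_ge0.
    + by move=> ts; rewrite -subr_le0 step pmulr_lle0 ?invr_gt0// subr_le0.
    + by rewrite ge_min le_max lexx.
have ms : mesh_lt u D (fun=> n) p.
  move=> i iu j jn; rewrite step normrM normfV (gtr0_norm n0).
  apply: (le_lt_trans _ Ln); apply: ler_wpM2r; first by rewrite invr_ge0 ltW.
  by rewrite /L (bigD1 i)//= lerDl sumr_ge0.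
have ms1 : mesh_lt u d (fun=> n) p.
  by move=> i iu j jn; apply: (lt_le_trans (ms i iu j jn)); rewrite ge_min lexx.
have ms2 : mesh_lt u d' (fun=> n) p.
  by move=> i iu j jn; apply: (lt_le_trans (ms i iu j jn)); rewrite ge_min lexx orbT.
have := Hd _ _ _ gr ms1; have := Hd' _ _ _ gr ms2.
set S := RSsum _ _ _ _ _ _ => h1 h2.
have := ler_normB (S - I') (S - I).
have -> : S - I' - (S - I) = I - I' by ring.
move=> h3; have : `|I - I'| < `|I - I'| by lra.
by rewrite ltxx.
Qed.

End multiple_integrals.

(** * The Langevin equation along a path *)

Section langevin.
Context {R : realType} {N : nat}.
Notation vec := ('I_N -> R).
Implicit Types (F G : vec -> R) (t s r a th : vec) (i j : 'I_N) (l : seq 'I_N) (u : {set 'I_N}).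
Implicit Types alpha : (R -> R) -> R -> R.

Lemma incr_perm l l' s t F : perm_eq l l' -> incr l s t F = incr l' s t F.
Proof.
elim: l l' => [|i l IH] l'; first by rewrite perm_sym => /perm_nilP ->.
move=> pl; have il' : i \in l' by rewrite -(perm_mem pl) mem_head.
rewrite (incr_rem _ _ _ il') !incr_cons (IH (rem i l'))//.
by rewrite -(perm_cons i) (perm_trans pl)// perm_to_rem.
Qed.

Lemma rect_incr_perm l F s t r : perm_eq l (enum 'I_N) -> rect_incr F s t = incr l s t F r.
Proof. by move=> pl; rewrite (rect_incrE _ _ _ r) (incr_perm _ _ _ pl). Qed.

(** Replacing a function by its increments from the corner [a] subtracts terms in which some
    coordinate is frozen at its value in [a], and such terms have no increments. *)
Lemma null_cut l a F : uniq l -> null (fun t => incr l a t F t - F t).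
Proof.
elim: l => [|i l IH] /=.
  by move=> _ s t; rewrite rect_incrB subrr.
move=> /andP[il /IH n1].
have n2 : null (fun t => incr l a t F (upd i (a i) t)).
  apply: (@null_cst _ _ i) => x t.
  rewrite updK (@incr_ext R N l a (upd i x t) a t)// => j jl.
  by rewrite upd_other//; apply: contraNneq il => <-.
have := nullB n1 n2; congr null; apply/funext => t.
by rewrite incr_cons /dif upd_id; ring.
Qed.

Lemma rect_incr_cut F a s t : rect_incr (fun t => rect_incr F a t) s t = rect_incr F s t.
Proof.
have := @null_cut (enum 'I_N) a F (enum_uniq _) s t.
rewrite rect_incrB => /eqP; rewrite subr_eq0 => /eqP <-.
by congr (rect_incr _ s t); apply/funext => x; exact: rect_incrE.
Qed.

Lemma null_base a F : (forall t, rect_incr F a t = 0) -> null F.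
Proof.
move=> H s t; rewrite -(rect_incr_cut F a) (_ : (fun t => _) = fun=> 0).
  by rewrite (rect_incrE _ _ _ s) incr0.
by apply/funext.
Qed.

Definition Pall l F : vec -> R := foldr (fun i H => lop i (@prim R) H) F l.

Lemma Pall_cont l F : cont_path F -> cont_path (Pall l F).
Proof. by move=> cF; elim: l => //= i l IH; apply: lop_cont => //; exact: line_op_prim. Qed.

Lemma Pall_incr l l' s t F : cont_path F -> (forall i, i \in l -> i \notin l') ->
  Pall l (incr l' s t F) = incr l' s t (Pall l F).
Proof.
move=> cF; elim: l => //= i l IH dis; rewrite IH; last first.
  by move=> j jl; apply: dis; rewrite inE jl orbT.
rewrite incr_lop//; first exact: line_op_prim.
  exact: Pall_cont.
by apply: dis; rewrite mem_head.
Qed.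

Lemma cofunl_leb_int l s t F : uniq l -> cont_path F ->
  cofunl l (leb_int s t) F = incr l s t (Pall (rev l) F).
Proof.
elim: l F => //= i l IH F /andP[il ul] cF.
have cE : cont_path (lop i (@prim R) F) by apply: lop_cont => //; exact: line_op_prim.
rewrite cofun_leb_int IH//; last exact: dif_cont.
rewrite -[dif i s t _]/(incr [:: i] s t (lop i (@prim R) F)) Pall_incr//; last first.
  by move=> j; rewrite mem_rev inE => jl; apply: contraNneq il => <-.
rewrite -incr_cat rev_cons -(cats1 (rev l)) /Pall foldr_cat/=.
by rewrite (@incr_perm (l ++ [:: i]) (i :: l))// perm_catC.
Qed.

Lemma lop_sum i alpha (I : Type) (q : seq I) (p : pred I) (c : I -> R) (H : I -> vec -> R) :
  line_op alpha -> (forall k, cont_path (H k)) ->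
  lop i alpha (fun t => \sum_(k <- q | p k) c k * H k t) =
  (fun t => \sum_(k <- q | p k) c k * lop i alpha (H k) t).
Proof.
move=> la cH; elim: q => [|k q IH].
  have := @lop_lin R N i alpha (fun=> 0) (fun=> 0) 0 0 la (@cont_path_cst _ _ 0) (@cont_path_cst _ _ 0).
  rewrite (_ : (fun t => _) = (fun t => \sum_(k <- [::] | p k) c k * H k t)).
    by move=> ->; apply/funext => t; rewrite big_nil !mul0r addr0.
  by apply/funext => t; rewrite big_nil !mul0r addr0.
have cS : cont_path (fun t => \sum_(k <- q | p k) c k * H k t).
  by apply: cont_path_sum => k' _; apply: cont_pathM => //; exact: cont_path_cst.
case: (boolP (p k)) => pk; last first.
  by under eq_fun do rewrite big_cons (negbTE pk); rewrite IH; apply/funext => t; rewrite big_cons (negbTE pk).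
rewrite (_ : (fun t => _) = (fun t => c k * H k t + 1 * (\sum_(k <- q | p k) c k * H k t))).
  rewrite (lop_lin i (c k) 1 la (cH k) cS) IH.
  by apply/funext => t; rewrite big_cons pk mul1r.
by apply/funext => t; rewrite big_cons pk mul1r.
Qed.

Definition Tall th l F : vec -> R :=
  foldr (fun i H t => H t + th i * lop i (@prim R) H t) F l.

(** Expanding the product of the operators [1 + th i P_i] over subsets produces one term for each
    [u] in the Langevin equation. *)
Lemma Tall_expand th l F : uniq l -> cont_path F ->
  Tall th l F = (fun t => \sum_(u : {set 'I_N} | u \subset [set x in l]%SET)
     (\prod_(i in u) th i) * Pall [seq i <- l | i \in u] F t).
Proof.
move=> + cF; elim: l => [|i l IH] /=.
  move=> _; apply/funext => t; rewrite (big_pred1 finset.set0) ?big_set0 ?mul1r//.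
  by move=> u; rewrite (_ : [set x in [::]]%SET = finset.set0) ?finset.subset0//; apply/finset.setP => x; rewrite !inE.
move=> /andP[il ul]; rewrite IH//; apply/funext => t.
rewrite set_cons sum_subsets_setU1 ?inE//; congr (_ + _).
  apply: eq_bigr => u uV; rewrite ifF//.
  by apply: contraNF il => /(fintype.subsetP uV); rewrite inE.
rewrite lop_sum; [|exact: line_op_prim|by move=> u; exact: Pall_cont].
rewrite mulr_sumr; apply: eq_bigr => u uV.
have iu : i \notin u by apply: contra il => /(fintype.subsetP uV); rewrite inE.
rewrite big_setU1//= finset.setU11/= mulrA; congr (_ * lop i _ _ t).
congr (Pall _ F); apply: eq_in_filter => x xl /=.
by rewrite !inE; case: eqP => // xi; rewrite xi (negbTE il) in xl.
Qed.

Lemma lop_mul i j alpha (c : R -> R) F : line_op alpha -> cont_path F -> i != j ->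
  lop j alpha (fun t => c (t i) * F t) = (fun t => c (t i) * lop j alpha F t).
Proof.
move=> [_ lin _] cF ij; apply/funext => t; rewrite /lop.
have := lin _ _ (c (t i)) 0 (@cont_path_line _ _ F j t cF) (@cont_path_line _ _ F j t cF).
rewrite (_ : (fun x => _) = (fun x => c ((upd j x t) i) * F (upd j x t))).
  by move=> ->; rewrite mul0r addr0.
by apply/funext => x; rewrite upd_other// mul0r addr0.
Qed.

Lemma Eall_mul th l i (c : R -> R) F : cont_path F -> i \notin l ->
  Eall th l (fun t => c (t i) * F t) = (fun t => c (t i) * Eall th l F t).
Proof.
move=> cF; elim: l => //= j l IH; rewrite inE negb_or => /andP[ij /IH ->].
by rewrite lop_mul//; [exact: line_op_eop|exact: Eall_cont].
Qed.

Lemma lop_eop_mul i (q : R) F : cont_path F ->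
  lop i (eop (- q)) (fun t => expR (q * t i) * F t) = (fun t => F t + q * lop i (@prim R) F t).
Proof.
move=> cF; apply/funext => t; rewrite /lop /eop upd_id mulrA -expRD.
rewrite -mulrDl addNr mul0r expR0 mul1r mulNr opprK.
congr (_ + q * prim _ _); apply/funext => y.
by rewrite upd_same mulrA -expRD -mulrDl addNr mul0r expR0 mul1r.
Qed.

Lemma TallE th l F : uniq l -> cont_path F ->
  Tall th l F = Eall (fun i => - th i) l (fun t => expR (\sum_(i <- l) th i * t i) * F t).
Proof.
move=> + cF; elim: l => [|i l IH] /=.
  by move=> _; apply/funext => t; rewrite big_nil expR0 mul1r.
move=> /andP[il ul]; rewrite IH//.
set Y := (fun t => expR (\sum_(i <- l) th i * t i) * F t).
have cY : cont_path Y.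
  apply: cont_pathM => //; apply: (cont_path_comp (f := expR)); first exact: continuous_expR.
  by apply: cont_path_sum => k _; apply: cont_pathM; [exact: cont_path_cst|exact: cont_path_coord].
rewrite (_ : (fun t => expR _ * F t) = (fun t => expR (th i * t i) * Y t)).
  rewrite (@Eall_mul _ _ i (fun x => expR (th i * x)))// lop_eop_mul//; exact: Eall_cont.
by apply/funext => t; rewrite big_cons expRD mulrA.
Qed.

Lemma cont_path_dotv th : cont_path (fun t => dotv th t).
Proof.
by apply: cont_path_sum => i _; apply: cont_pathM; [exact: cont_path_cst|exact: cont_path_coord].
Qed.

Definition expmul th F : vec -> R := fun t => expR (dotv th t) * F t.

Lemma expmul_cont th F : cont_path F -> cont_path (expmul th F).
Proof.
move=> cF; apply: cont_pathM => //; apply: (cont_path_comp (f := expR)); first exact: continuous_expR.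
exact: cont_path_dotv.
Qed.

(* By [lop_eop_mul] this is the product over i of the operators F + th_i int_0^(t_i) F; its increment on [0, t]
   is the left-hand side of the Langevin equation. *)
Definition langevin_op th F : vec -> R := Eall (fun i => - th i) (rev (enum 'I_N)) (expmul th F).

Lemma langevin_op_cont th F : cont_path F -> cont_path (langevin_op th F).
Proof. by move=> cF; apply: Eall_cont; exact: expmul_cont. Qed.

Lemma langevin_opE th F : cont_path F -> langevin_op th F = Tall th (rev (enum 'I_N)) F.
Proof.
move=> cF; rewrite TallE ?rev_uniq ?enum_uniq//; congr Eall; apply/funext => t.
have pl : perm_eq (rev (enum 'I_N)) (enum 'I_N) by rewrite perm_rev.
by rewrite /expmul /dotv (perm_big _ pl)/= big_enum.
Qed.

Lemma incr_part_enumE F (v : {set 'I_N}) r s t : incr_part F v r s t = incr (enum v) s t F r.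
Proof.
rewrite -incr_partE ?enum_uniq//; congr incr_part.
by apply/finset.setP => i; rewrite inE mem_enum.
Qed.

(** In the term of [u] the coordinates in [u] are integrated over, and the others incremented over,
    the same box from 0 to [t]. The term is thus the full increment of an iterated primitive of [x],
    and the terms add up by [Tall_expand]. *)
Lemma langevin_lhs th x t : cont_path x -> exists I : {set 'I_N} -> R,
  (forall u, RSint u (@zerov R N) t (fun r => incr_part x (~: u)%SET r (@zerov R N) t)
     (leb_incr u) (I u)) /\
  \sum_(u : {set 'I_N}) (\prod_(i in u) th i) * I u = rect_incr (langevin_op th x) (@zerov R N) t.
Proof.
move=> cx; pose z := @zerov R N; pose L := rev (enum 'I_N).
(* The second reversal makes [cofunl_leb_int] return the primitives in the order used by
   [Tall_expand]. *)
pose l (u : {set 'I_N}) := rev [seq i <- L | i \in u].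
have lE u i : (i \in l u) = (i \in u) by rewrite mem_rev mem_filter mem_rev mem_enum andbT.
have ul u : uniq (l u) by rewrite rev_uniq filter_uniq// rev_uniq enum_uniq.
have uE u : u = [set i in l u]%SET by apply/finset.setP => i; rewrite inE lE.
pose F u r := incr_part x (~: u)%SET r z t.
have FE u : F u = incr (enum (~: u)%SET) z t x.
  by apply/funext => r; exact: incr_part_enumE.
have cF u : cont_path (F u) by rewrite FE; exact: incr_cont.
exists (fun u => cofunl (l u) (leb_int z t) (F u) z); split.
  move=> u; apply: (RSint_leb z t (ul u) (uE u) (cF u)) => r r' rr'.
  rewrite FE; apply: incr_ext_base => i.
  by rewrite mem_enum inE negbK; exact: rr'.
rewrite langevin_opE// Tall_expand ?rev_uniq ?enum_uniq//.
have pl : perm_eq L (enum 'I_N) by rewrite perm_rev.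
rewrite (rect_incrE _ _ _ z) incr_sum; apply: eq_big => u.
  by rewrite -[u \subset _]/(_ : bool); apply/esym/fintype.subsetP => i _; rewrite inE mem_rev mem_enum.
move=> _; rewrite incrZ; congr (_ * _).
rewrite cofunl_leb_int// revK FE Pall_incr//; last first.
  by move=> i; rewrite mem_filter mem_enum inE => /andP[/= -> _].
rewrite -incr_cat; apply: (congr1 (fun f => f z)); apply: incr_perm.
apply: uniq_perm; rewrite ?enum_uniq// ?cat_uniq ?ul ?enum_uniq ?andbT/=.
  by apply/hasPn => i; rewrite mem_enum inE lE.
by move=> i; rewrite mem_cat lE !mem_enum !inE orbN.
Qed.

(** The equation speaks of boxes with one corner at 0; [null_base] extends it to all boxes.
    Uniqueness of the integrals identifies the given [I] with the computed one. *)
Lemma langevin_pathP th x g : cont_path x ->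
  langevin_path th x g <-> null (fun t => g t - langevin_op th x t).
Proof.
move=> cx; split=> H.
  apply: (@null_base (@zerov R N)) => t; rewrite rect_incrB.
  have [I [HI <-]] := H t; have [I' [HI' <-]] := langevin_lhs th t cx.
  rewrite (_ : I = I') ?subrr//; apply/funext => u.
  exact: RSint_unique (HI u) (HI' u).
move=> t; have [I [HI E]] := langevin_lhs th t cx; exists I; split=> //.
by rewrite E; apply/esym/eqP; rewrite -subr_eq0 -rect_incrB H.
Qed.

(** The two conditions are exchanged by [Eall th (enum 'I_N)] and its inverse, both of which
    preserve [null]. *)
Lemma langevin_op_null th x g : cont_path x -> cont_path g ->
  null (fun t => g t - langevin_op th x t) <->
  null (fun t => Eall th (enum 'I_N) g t - expmul th x t).
Proof.
move=> cx cg; have cT := langevin_op_cont th cx; have ce := expmul_cont th cx.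
split=> H.
  have := Eall_congr th (enum 'I_N) cg cT H.
  by rewrite {1}/langevin_op EallVK.
have := Eall_congr (fun i => - th i) (rev (enum 'I_N)) (Eall_cont th (enum 'I_N) cg) ce H.
by rewrite EallK.
Qed.

End langevin.

(** * Integrals over the simplices T_v(t) *)

Section half_line_sums.
Context {R : realType}.
Implicit Types (phi psi : R -> R) (h : R -> bool).

(** The integrand jumps at [c], and [h c] is arbitrary. Cells away from [c] obey the continuous
    estimate; a cell touching [c] costs at most [2 * M * d], and the total weight of such cells is
    at most 2. *)
Lemma leb_sum_half_line (K d a b c om M : R) m p xi phi h :
  grid1 K d a b m p xi -> a <= c <= b -> 0 < d ->
  continuous phi -> 0 <= om ->
  (forall x y, `|x| <= K -> `|y| <= K -> `|x - y| < d -> `|phi x - phi y| <= om) ->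
  (forall x, `|x| <= K -> `|phi x| <= M) ->
  (forall x, x < c -> h x = false) -> (forall x, c < x -> h x = true) ->
  `|leb_sum m p xi (fun x => if h x then phi x else 0) - (prim phi b - prim phi c)|
    <= om * (2 * K) + 4 * M * d.
Proof.
move=> gr /andP[ac cb] d0 cphi om0 H bphi hF hT; have [mp [p0 pm] tg ms [aK bK]] := gr.
have ab : a <= b by exact: le_trans cb.
have M0 : 0 <= M by exact: (le_trans (normr_ge0 _) (bphi _ aK)).
(* As [a <= b], a decreasing grid is possible only for [a = b], and then all its points coincide. *)
have inc j : (j < m)%N -> p j <= p j.+1.
  move=> jm; case: mp => [up|dn]; first exact: up.
  have eqp k : (k <= m)%N -> p k = a.
    move=> km; have := @monoseq_between R m p k (or_intror dn) km.
    have /= := @monoseq_between R m p m (or_intror dn) (leqnn m).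
    have pm0 : p m <= p 0%N.
      have tel := telescope_sumr p (leq0n m).
      rewrite -subr_le0 -tel big_nat_cond; apply: sumr_le0 => i /andP[/andP[_ im] _].
      by rewrite subr_le0 dn.
    have pab : a = b by apply/eqP; rewrite eq_le ab -p0 -pm pm0.
    by rewrite p0 pm -pab minxx maxxx => _ /andP[? ?]; apply/eqP; rewrite eq_le; apply/andP.
  by rewrite !eqp// ltnW.
have pK k : (k <= m)%N -> `|p k| <= K.
  by move=> km; apply: (monoseq_inbox mp) => //; rewrite ?p0 ?pm.
have xiK j : (j < m)%N -> `|xi j| <= K by move=> jm; exact: grid1_tag gr jm.
have xij j : (j < m)%N -> p j <= xi j <= p j.+1.
  by move=> jm; have := tg j jm; rewrite min_l ?max_r ?inc.
(* This is a primitive of the integrand cut off below [c], so its increments telescope to the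
   claimed value. *)
pose psi x := prim phi (Num.max x c).
have cK : `|c| <= K by move: aK bK; rewrite !ler_norml => /andP[? ?] /andP[? ?]; apply/andP; split; lra.
(* [u] and [v] detect the cells containing c; their decrements telescope, so that degenerate cells are harmless. *)
pose u (x : R) : R := ((x < c)%R%:R).
pose v (x : R) : R := ((x <= c)%R%:R).
have uv j : (j < m)%N -> 0 <= u (p j) - u (p j.+1) /\ 0 <= v (p j) - v (p j.+1).
  move=> jm; have := inc j jm; rewrite /u /v !subr_ge0 !ler_nat => pp; split.
    by case: (ltP (p j.+1) c) => // /(le_lt_trans pp) ->.
  by case: (leP (p j.+1) c) => // /(le_trans pp) ->.
have cell j : (j < m)%N ->
  `|(if h (xi j) then phi (xi j) else 0) * (p j.+1 - p j) - (psi (p j.+1) - psi (p j))| <=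
   om * (p j.+1 - p j) + 2 * M * d * ((u (p j) - u (p j.+1)) + (v (p j) - v (p j.+1))).
  move=> jm; have ppj := inc j jm; have /andP[x1 x2] := xij j jm; have [u0 v0] := uv j jm.
  have D0 : 0 <= p j.+1 - p j by rewrite subr_ge0.
  have omD : 0 <= om * (p j.+1 - p j) by exact: mulr_ge0.
  have Md : 0 <= 2 * M * d by rewrite mulr_ge0 ?(ltW d0)// mulr_ge0.
  have Duv : 0 <= (u (p j) - u (p j.+1)) + (v (p j) - v (p j.+1)) by exact: addr_ge0.
  have := ms j jm; rewrite (ger0_norm D0) => Dd.
  have [cp|pc] := ltP c (p j).
    rewrite hT ?(lt_le_trans cp)//.
    rewrite /psi !max_l; [|exact: ltW|exact: (le_trans (ltW cp))].
    have [z zp ->] := prim_mean (p j) (p j.+1) cphi.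
    rewrite -mulrBl normrM (ger0_norm D0).
    apply: ler_wpDr; first exact: mulr_ge0.
    apply: ler_wpM2r => //; move: zp; rewrite min_l// max_r// => /andP[z1 z2].
    apply: H; first exact: xiK.
      move: (pK _ (ltnW jm)) (pK _ jm); rewrite !ler_norml => /andP[? ?] /andP[? ?].
      by apply/andP; split; lra.
    by rewrite ltr_norml; apply/andP; split; lra.
  have [pc'|cp'] := ltP (p j.+1) c.
    rewrite hF ?(le_lt_trans x2)// mul0r /psi !max_r ?(ltW pc')//.
      by rewrite !subrr normr0; apply: addr_ge0 => //; exact: mulr_ge0.
  have [eqp|neqp] := eqVneq (p j) (p j.+1).
    by rewrite eqp !subrr addr0 !mulr0 subr0 normr0 addr0.
  have ppl : p j < p j.+1 by rewrite lt_neqAle neqp.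
  have one : 1 <= (u (p j) - u (p j.+1)) + (v (p j) - v (p j.+1)).
    have up' : u (p j.+1) = 0 by rewrite /u ltNge cp'.
    have vp : v (p j) = 1 by rewrite /v pc.
    have [pcl|cpj] := ltP (p j) c.
      by rewrite up' {1}/u pcl subr0 lerDl.
    have vp' : v (p j.+1) = 0 by rewrite /v leNgt (le_lt_trans cpj).
    by rewrite vp vp' subr0 lerDr.
  have t1 : `|(if h (xi j) then phi (xi j) else 0) * (p j.+1 - p j)| <= M * d.
    rewrite normrM (ger0_norm D0); apply: ler_pM => //; last exact: ltW.
    by case: ifP; rewrite ?normr0// => _; apply: bphi; exact: xiK.
  have t2 : `|psi (p j.+1) - psi (p j)| <= M * d.
    rewrite /psi (max_l cp') (max_r pc).
    have [z zp ->] := prim_mean c (p j.+1) cphi.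
    rewrite normrM; apply: ler_pM => //.
      by apply: bphi; apply: (between_inbox _ _ zp) => //; exact: pK.
    by rewrite ger0_norm ?subr_ge0//; lra.
  apply: (le_trans (ler_normB _ _)); apply: (le_trans (lerD t1 t2)).
  apply: ler_wpDl => //.
  have : 2 * M * d * 1 <= 2 * M * d * ((u (p j) - u (p j.+1)) + (v (p j) - v (p j.+1))).
    exact: ler_wpM2l.
  lra.
have E : prim phi b - prim phi c = \sum_(j < m) (psi (p j.+1) - psi (p j)).
  rewrite -(big_mkord predT (fun j => psi (p j.+1) - psi (p j))) (telescope_sumr (fun j => psi (p j)))//.
  by rewrite pm p0 /psi (max_l cb) (max_r ac).
rewrite E /leb_sum -sumrB; apply: (le_trans (ler_norm_sum _ _ _)).
apply: (@le_trans _ _ (\sum_(j < m) (om * (p j.+1 - p j) +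
    2 * M * d * ((u (p j) - u (p j.+1)) + (v (p j) - v (p j.+1)))))).
  by apply: ler_sum => j _; exact: cell.
rewrite big_split/= -!mulr_sumr.
have tel (f : R -> R) : \sum_(j < m) (f (p j.+1) - f (p j)) = f b - f a.
  by rewrite -(big_mkord predT (fun j => f (p j.+1) - f (p j))) (telescope_sumr (fun j => f (p j)))// pm p0.
have teln (f : R -> R) : \sum_(j < m) (f (p j) - f (p j.+1)) = f a - f b.
  by rewrite -[RHS]opprB -tel -sumrN; apply: eq_bigr => j _; rewrite opprB.
have tid : \sum_(j < m) (p j.+1 - p j) = b - a by exact: (tel id).
rewrite tid big_split/= (teln u) (teln v).
have bu : u a - u b <= 1 by rewrite /u; case: (a < c); case: (b < c); rewrite ?subr0 ?subrr ?sub0r//; lra.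
have bv : v a - v b <= 1 by rewrite /v; case: (a <= c); case: (b <= c); rewrite ?subr0 ?subrr ?sub0r//; lra.
have := grid1_length gr; rewrite ger0_norm ?subr_ge0// => bl.
have h1 : om * (b - a) <= om * (2 * K) by exact: ler_wpM2l.
have h2 : 2 * M * d * (u a - u b + (v a - v b)) <= 2 * M * d * 2.
  by apply: ler_wpM2l; [rewrite mulr_ge0 ?(ltW d0)// mulr_ge0|lra].
lra.
Qed.

(** The sum over the left half-line is the full sum minus that over the right one; the two errors
    give [2 * K + 2 * K]. *)
Lemma leb_sum_half_line_left (K d a b c om M : R) m p xi phi h :
  grid1 K d a b m p xi -> a <= c <= b -> 0 < d ->
  continuous phi -> 0 <= om ->
  (forall x y, `|x| <= K -> `|y| <= K -> `|x - y| < d -> `|phi x - phi y| <= om) ->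
  (forall x, `|x| <= K -> `|phi x| <= M) ->
  (forall x, x < c -> h x = true) -> (forall x, c < x -> h x = false) ->
  `|leb_sum m p xi (fun x => if h x then phi x else 0) - (prim phi c - prim phi a)|
    <= om * (4 * K) + 4 * M * d.
Proof.
move=> gr acb d0 cphi om0 H bphi hF hT.
have h1 := leb_sum_approx gr cphi om0 H.
have h2 := @leb_sum_half_line K d a b c om M m p xi phi (fun x => ~~ h x) gr acb d0 cphi om0 H bphi.
have {}h2 := h2 (fun x xc => negbF (hF x xc)) (fun x cx => negbT (hT x cx)).
have E : leb_sum m p xi (fun x => if h x then phi x else 0) =
  leb_sum m p xi phi - leb_sum m p xi (fun x => if ~~ h x then phi x else 0).
  rewrite /leb_sum -sumrB; apply: eq_bigr => j _.
  by case: (h _) => /=; rewrite ?mul0r ?subr0 ?subrr.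
rewrite E; set A := leb_sum m p xi phi in h1 *; set B := leb_sum _ _ _ _ in h2 *.
have -> : A - B - (prim phi c - prim phi a) =
  (A - (prim phi b - prim phi a)) - (B - (prim phi b - prim phi c)) by ring.
by apply: (le_trans (ler_normB _ _)); lra.
Qed.

End half_line_sums.

(** * Integration from the hyperplane of vanishing coordinate sum *)

Section half_space_integrals.
Context {R : realType} {N : nat}.
Notation vec := ('I_N -> R).
Notation grid := (('I_N -> nat) * ('I_N -> nat -> R) * ('I_N -> nat -> R))%type.
Implicit Types (F G f : vec -> R) (t s r y z : vec) (i j : 'I_N) (l : seq 'I_N) (v : {set 'I_N}).

Definition tot t : R := \sum_(i < N) t i.

Lemma tot_upd i x t : tot (upd i x t) = tot t - t i + x.
Proof.
rewrite /tot (bigD1 i)//= [in RHS](bigD1 i)//= upd_same.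
rewrite (eq_bigr (fun j => t j)); first by ring.
by move=> j ji; rewrite upd_other.
Qed.

(* Integration in the i-th coordinate from the hyperplane [tot = 0] to t. *)
Definition Qop i F : vec -> R :=
  fun t => lop i (@prim R) F t - lop i (@prim R) F (upd i (t i - tot t) t).

Lemma cont_path_tot : cont_path tot.
Proof. by apply: cont_path_sum => i _; exact: cont_path_coord. Qed.

Lemma cont_map_proj i : cont_map (fun t => upd i (t i - tot t) t).
Proof.
apply: cont_map_upd; last exact: cont_map_id.
by apply: cont_pathB; [exact: cont_path_coord|exact: cont_path_tot].
Qed.

Lemma Qop_cont i F : cont_path F -> cont_path (Qop i F).
Proof.
move=> cF; have cP : cont_path (lop i (@prim R) F) by apply: lop_cont => //; exact: line_op_prim.
by apply: cont_pathB => //; apply: cont_path_map => //; exact: cont_map_proj.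
Qed.

Definition Qall l F : vec -> R := foldr Qop F l.

Lemma Qall_cont l F : cont_path F -> cont_path (Qall l F).
Proof. by move=> cF; elim: l => //= i l; exact: Qop_cont. Qed.

Lemma Qop_scale i F (c : R) : cont_path F -> Qop i (fun t => c * F t) = (fun t => c * Qop i F t).
Proof.
move=> cF; apply/funext => t; rewrite /Qop.
have -> : lop i (@prim R) (fun t => c * F t) = (fun t => c * lop i (@prim R) F t).
  have := lop_lin i c 0 line_op_prim cF cF.
  rewrite (_ : (fun t => c * F t + 0 * F t) = (fun t => c * F t)); last first.
    by apply/funext => x; rewrite mul0r addr0.
  by move=> ->; apply/funext => x; rewrite mul0r addr0.
by rewrite mulrBr.
Qed.

(** Projecting to the hyperplane along direction [i] forgets coordinate [i]. Terms evaluated at the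
    projection are therefore invisible to increments. *)
Lemma proj_upd i x t : upd i (upd i x t i - tot (upd i x t)) (upd i x t) =
  upd i (t i - tot t) t.
Proof. by rewrite updK tot_upd upd_same; congr upd; ring. Qed.

Lemma dif_Qop i s t F : dif i s t (Qop i F) = dif i s t (lop i (@prim R) F).
Proof. by apply/funext => r; rewrite /dif /Qop !proj_upd; ring. Qed.

(** The outermost [Qop] and primitive have equal differences in their own coordinate; that
    difference commutes with the others, and the remaining increments then pass inside the primitive
    to meet the induction hypothesis. *)
Lemma incr_Qall l s t F : uniq l -> cont_path F ->
  incr l s t (Qall l F) = incr l s t (Pall l F).
Proof.
move=> + cF; elim: l => //= i l IH /andP[il /IH E].
have cQ := Qall_cont l cF; have cP := Pall_cont l cF.
rewrite !incr_cons -!incr_dif dif_Qop !incr_dif.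
rewrite !incr_lop//; try exact: line_op_prim.
by rewrite E.
Qed.

Lemma rect_incr_Qall l s t F : uniq l -> cont_path F ->
  rect_incr (Qall l F) s t = rect_incr (Pall l F) s t.
Proof.
move=> ul cF; pose l' := [seq i <- enum 'I_N | i \notin l].
have pl : perm_eq (l' ++ l) (enum 'I_N).
  have ul' : uniq l' by apply: filter_uniq; exact: enum_uniq.
  apply: uniq_perm; rewrite ?enum_uniq// ?cat_uniq ?ul ?ul' ?andbT/=.
    by apply/hasPn => i il; rewrite mem_filter il.
  by move=> i; rewrite mem_cat mem_filter mem_enum andbT; rewrite orNb.
by rewrite !(rect_incr_perm _ _ _ s pl) !incr_cat incr_Qall.
Qed.

Lemma Qall_tot0 l F t : l != [::] -> tot t = 0 -> Qall l F t = 0.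
Proof.
case: l => //= i l _ t0; rewrite /Qop t0 subr0 upd_id subrr//.
Qed.

Lemma cofunl_congr m (p xi : 'I_N -> nat -> R) l F G r0 : uniq l ->
  (forall r, (forall k, k \notin l -> r k = r0 k) ->
     (forall k, k \in l -> exists2 j, (j < m k)%N & r k = xi k j) -> F r = G r) ->
  cofunl l (leb_part m p xi) F r0 = cofunl l (leb_part m p xi) G r0.
Proof.
elim: l F G => [|i l IH] F G /=; first by move=> _; apply.
move=> /andP[il ul] H; apply: IH => // r rout rin.
rewrite /cofun /leb_part /leb_sum; apply: eq_bigr => j _; congr (_ * _).
apply: H => k; rewrite inE ?negb_or.
  by move=> /andP[ki kl]; rewrite upd_other// rout.
case: (eqVneq k i) => [-> _|ki /= kl].
  by exists j => //; rewrite upd_same.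
by rewrite upd_other//; exact: rin.
Qed.

Section fixed_point.
Variable t : vec.
Let S := tot t.
Let lo : vec := fun i => Num.min (t i) (t i - S).
Let hi : vec := fun i => Num.max (t i) (t i - S).
(** Orientation: for negative [S] the region lies above [t], so its integrals run from [t i] up to
    the hyperplane, opposite to [Qop]. *)
Let sg : R := if 0 <= S then 1 else -1.
Let ind y : bool := if 0 <= S then 0 <= tot y else tot y <= 0.
Let cut F : vec -> R := fun y => if ind y then F y else 0.
(** The box between [t] and the points [t i - S]. It contains all points met by the sums, and the
    slice estimates below hold only inside it. *)
Let region r := forall i, lo i <= r i <= hi i.
Let K := hull lo hi.

Let lohi i : lo i <= hi i.
Proof. by rewrite /lo /hi; case: (leP (t i)) => // /ltW. Qed.

Let region_t : region t.
Proof. by move=> i; rewrite /lo /hi ge_min lexx le_max lexx. Qed.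

Let region_inbox r : region r -> inbox K r.
Proof.
move=> rr i; apply: (between_inbox (hull_inboxl lo hi i) (hull_inboxr lo hi i)).
by rewrite min_l ?max_r.
Qed.

Let region_upd i x r : lo i <= x <= hi i -> region r -> region (upd i x r).
Proof. by move=> xi rr j; rewrite /upd; case: eqP => // ->. Qed.

Lemma leb_part_lip_region d (g : grid) i F G M : grid1 K d (lo i) (hi i) (g.1.1 i) (g.1.2 i) (g.2 i) ->
  (forall r, region r -> `|F r - G r| <= M) -> forall r, region r ->
  `|cofun i (leb_part g.1.1 g.1.2 g.2 i) F r - cofun i (leb_part g.1.1 g.1.2 g.2 i) G r| <= 2 * K * M.
Proof.
move=> gr H r rr; have [mp [p0 pm] tg _ _] := gr.
have M0 : 0 <= M by exact: (le_trans (normr_ge0 _) (H _ rr)).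
rewrite /cofun /leb_part /leb_sum -sumrB; apply: (le_trans (ler_norm_sum _ _ _)).
apply: (@le_trans _ _ (M * \sum_(j < g.1.1 i) `|g.1.2 i j.+1 - g.1.2 i j|)).
  rewrite mulr_sumr; apply: ler_sum => j _; rewrite -mulrBl normrM.
  apply: ler_wpM2r => //; apply: H; apply: region_upd => //.
  have /andP[x1 x2] := tg j (ltn_ord j).
  have /andP[a1 a2] := monoseq_between mp (ltnW (ltn_ord j)).
  have /andP[b1 b2] := monoseq_between mp (ltn_ord j).
  rewrite p0 pm (min_l (lohi i)) (max_r (lohi i)) in a1 a2 b1 b2.
  rewrite (le_trans _ x1) ?le_min ?a1//= (le_trans x2)// ge_max a2//.
rewrite (monoseq_sum mp) p0 pm mulrC; apply: ler_wpM2r => //.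
exact: grid1_length gr.
Qed.

Lemma cofunl_lip_region d (g : grid) l F G M :
  (forall i, i \in l -> grid1 K d (lo i) (hi i) (g.1.1 i) (g.1.2 i) (g.2 i)) ->
  (forall r, region r -> `|F r - G r| <= M) -> forall r, region r ->
  `|cofunl l (leb_part g.1.1 g.1.2 g.2) F r - cofunl l (leb_part g.1.1 g.1.2 g.2) G r|
    <= (2 * K) ^+ size l * M.
Proof.
elim: l F G M => [|i l IH] F G M gr FG r rr /=; first by rewrite expr0 mul1r; exact: FG.
rewrite exprSr -mulrA; apply: IH => // [j jl|]; first by apply: gr; rewrite inE jl orbT.
by apply: leb_part_lip_region FG; apply: gr; exact: mem_head.
Qed.

Let F' i F : vec -> R := fun y => sg * Qop i F y.

(** For nonnegative [S], and [z] equal to [y] with i-th coordinate [t i], the slice of the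
    half-space along direction [i] runs from [t i - tot z] to [t i], and is empty if [tot z < 0].
    The slice integral is therefore [Qop i F z] cut off by the same half-space; negative [S] is the
    mirror image. *)
Lemma half_space_step i F e : cont_path F -> 0 < e ->
  exists2 d, 0 < d & forall g : grid, grid1 K d (lo i) (hi i) (g.1.1 i) (g.1.2 i) (g.2 i) ->
    forall y, region y ->
    `|cofun i (leb_part g.1.1 g.1.2 g.2 i) (cut F) y - cut (F' i F) (upd i (t i) y)| <= e.
Proof.
move=> cF e0; have [M M0 bM] := cont_path_bounded K cF.
have K0 : 0 <= K := hull_ge0 lo hi.
have K1 : 0 < 8 * K + 1 by rewrite ltr_wpDl// mulr_ge0.
have M1 : 0 < 8 * M + 1 by rewrite ltr_wpDl// mulr_ge0.
have [d d0 H] := cont_path_unif K cF (divr_gt0 e0 K1).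
have eM : 0 < e / (8 * M + 1) by rewrite divr_gt0.
exists (Num.min d (e / (8 * M + 1))); first by rewrite lt_min d0.
set d' := Num.min _ _; have d'0 : 0 < d' by rewrite lt_min d0.
move=> g gr y ry.
have o0 : 0 <= e / (8 * K + 1) by rewrite divr_ge0// ltW.
pose phi x := F (upd i x y).
have cphi : continuous phi by exact: cont_path_line.
have mphi x x' : `|x| <= K -> `|x'| <= K -> `|x - x'| < d' -> `|phi x - phi x'| <= e / (8 * K + 1).
  move=> xK x'K; rewrite lt_min => /andP[xx _].
  exact: (line_modulus i H d0 (region_inbox ry)).
have bphi x : `|x| <= K -> `|phi x| <= M.
  by move=> xK; apply: bM; apply: inbox_upd => //; exact: region_inbox.
have err : e / (8 * K + 1) * (4 * K) + 4 * M * d' <= e.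
  have h1 : e / (8 * K + 1) * (8 * K) <= e.
    by rewrite mulrAC ler_pdivrMr// ler_pM2l// lerDl.
  have h2 : 8 * M * d' <= e.
    apply: (@le_trans _ _ (8 * M * (e / (8 * M + 1)))).
      by apply: ler_wpM2l; [rewrite mulr_ge0|rewrite ge_min lexx orbT].
    by rewrite mulrA ler_pdivrMr// mulrC ler_pM2l// lerDl.
  lra.
set z := upd i (t i) y.
have zi : z i = t i by rewrite /z upd_same.
have rz : region z by apply: region_upd => //; exact: region_t.
pose h x := ind (upd i x y).
have hE x : tot (upd i x y) = tot z - t i + x.
  by rewrite /z !tot_upd; ring.
have LE : cofun i (leb_part g.1.1 g.1.2 g.2 i) (cut F) y =
   leb_sum (g.1.1 i) (g.1.2 i) (g.2 i) (fun x => if h x then phi x else 0) by [].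
rewrite LE.
have QE : Qop i F z = prim phi (t i) - prim phi (t i - tot z).
  rewrite /Qop /lop upd_same zi; congr (prim _ _ - prim _ _).
    by apply/funext => x; rewrite /z updK.
  by apply/funext => x; rewrite /z !updK.
have tagK (j : nat) : (j < g.1.1 i)%N -> lo i <= g.2 i j <= hi i.
  move=> jm; have [mp [p0 pm] tg _ _] := gr.
  have /andP[x1 x2] := tg j jm.
  have /andP[a1 a2] := monoseq_between mp (ltnW jm).
  have /andP[b1 b2] := monoseq_between mp jm.
  rewrite p0 pm (min_l (lohi i)) (max_r (lohi i)) in a1 a2 b1 b2.
  by rewrite (le_trans _ x1) ?le_min ?a1//= (le_trans x2)// ge_max a2.
have vanish : (forall j : nat, (j < g.1.1 i)%N -> h (g.2 i j) = false) ->
    leb_sum (g.1.1 i) (g.1.2 i) (g.2 i) (fun x => if h x then phi x else 0) = 0.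
  by move=> h0; rewrite /leb_sum; apply: big1 => j _; rewrite (h0 j (ltn_ord j)) mul0r.
rewrite /cut /F' /sg /ind; have [S0|S0] := leP 0 S.
  have lE : lo i = t i - S by rewrite /lo min_r// gerBl.
  have uE : hi i = t i by rewrite /hi max_l// gerBl.
  have hx x : h x = (t i - tot z <= x).
    by rewrite /h /ind S0 hE; apply/idP/idP; lra.
  have [tz|tz] := leP 0 (tot z); last first.
    rewrite vanish ?subrr ?normr0 ?(ltW e0)// => j /tagK.
    by rewrite uE hx => /andP[_ ?]; apply/negbTE; rewrite -ltNge; lra.
  (* No coordinate of [z] exceeds that of [t], hence the cut point [hi i - tot z] does not fall
     below [lo i], as the one-dimensional estimate requires. *)
  have zS : tot z <= S.
    apply: ler_sum => k _; have := rz k; rewrite /lo /hi => /andP[_].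
    by rewrite max_l// gerBl.
  rewrite QE mul1r -uE; apply: le_trans err.
  apply: (le_trans (@leb_sum_half_line R K d' (lo i) (hi i) (hi i - tot z) _ M _ _ _ phi h gr _ d'0 cphi o0 mphi bphi _ _)).
  - by rewrite lE uE; apply/andP; split; lra.
  - by move=> x xc; rewrite hx -uE; apply/negbTE; rewrite -ltNge.
  - by move=> x xc; rewrite hx -uE ltW.
  by rewrite lerD2r; apply: ler_wpM2l => //; apply: ler_wpM2r => //; rewrite ler_nat.
have lE : lo i = t i by rewrite /lo min_l// lerDl oppr_ge0 ltW.
have uE : hi i = t i - S by rewrite /hi max_r// lerDl oppr_ge0 ltW.
have hx x : h x = (x <= t i - tot z).
  by rewrite /h /ind leNgt S0/= hE; apply/idP/idP; lra.
have [tz|tz] := leP (tot z) 0; last first.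
  rewrite vanish ?subrr ?normr0 ?(ltW e0)// => j /tagK.
  by rewrite lE hx => /andP[? _]; apply/negbTE; rewrite -ltNge; lra.
have zS : S <= tot z.
  apply: ler_sum => k _; have := rz k; rewrite /lo /hi => /andP[+ _].
  by rewrite min_l// lerDl oppr_ge0 ltW.
rewrite QE mulN1r opprB -lE; apply: le_trans err.
apply: (@leb_sum_half_line_left R K d' (lo i) (hi i) (lo i - tot z) _ M _ _ _ phi h gr _ d'0 cphi o0 mphi bphi).
- by rewrite lE uE; apply/andP; split; lra.
- by move=> x xc; rewrite hx -lE ltW.
- by move=> x xc; rewrite hx -lE; apply/negbTE; rewrite -ltNge.
Qed.

Lemma cofunl_upd m (p xi : 'I_N -> nat -> R) l i G c r : i \notin l ->
  cofunl l (leb_part m p xi) (fun y => G (upd i c y)) r = cofunl l (leb_part m p xi) G (upd i c r).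
Proof.
elim: l G => //= j l IH G; rewrite inE negb_or => /andP[ij il].
rewrite -IH//; congr (cofunl l _ _ r); apply/funext => y.
by rewrite /cofun; congr leb_part; apply/funext => x; rewrite updC.
Qed.

(** The cut function is discontinuous, so [cofunl_approx] does not apply. The same induction runs
    because one summation turns a cut continuous function into a cut continuous function, up to a
    uniform error on [region]. *)
Lemma half_space_limit l F e : uniq l -> cont_path F -> 0 < e ->
  exists2 d, 0 < d & forall g : grid,
    (forall i, i \in l -> grid1 K d (lo i) (hi i) (g.1.1 i) (g.1.2 i) (g.2 i)) ->
    `|cofunl l (leb_part g.1.1 g.1.2 g.2) (cut F) t - sg ^+ size l * Qall (rev l) F t| <= e.
Proof.
have K0 : 0 <= K := hull_ge0 lo hi.
elim: l F e => [|i l IH] F e /=.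
  move=> _ _ e0; exists 1 => // g _; rewrite /cut expr0 mul1r /ind -/S.
  by have [S0|S0] := leP 0 S; rewrite ?S0 ?(ltW S0) subrr normr0 ltW.
move=> /andP[il ul] cF e0.
have cF' : cont_path (F' i F) by apply: cont_pathM; [exact: cont_path_cst|exact: Qop_cont].
have Cl : 0 < (2 * K) ^+ size l + 1 by rewrite ltr_wpDl// exprn_ge0// mulr_ge0.
have e2 : 0 < e / 2 by rewrite divr_gt0.
have [d1 d10 H1] := IH (F' i F) (e / 2) ul cF' e2.
have [d2 d20 H2] := half_space_step i cF (divr_gt0 e2 Cl).
exists (Num.min d1 d2); first by rewrite lt_min d10.
move=> g gr.
have gmono d (dd : Num.min d1 d2 <= d) k : k \in i :: l ->
    grid1 K d (lo k) (hi k) (g.1.1 k) (g.1.2 k) (g.2 k).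
  move=> kl; have [a b c ms ab] := gr k kl; split=> // j jm.
  exact: (lt_le_trans (ms j jm)).
have gr1 k : k \in l -> grid1 K d1 (lo k) (hi k) (g.1.1 k) (g.1.2 k) (g.2 k).
  by move=> kl; apply: gmono; [rewrite ge_min lexx|rewrite inE kl orbT].
have gr2 : grid1 K d2 (lo i) (hi i) (g.1.1 i) (g.1.2 i) (g.2 i).
  by apply: gmono; [rewrite ge_min lexx orbT|rewrite mem_head].
have h1 := H1 g gr1.
have h2 := cofunl_lip_region gr1 (H2 g gr2) region_t.
have E : cofunl l (leb_part g.1.1 g.1.2 g.2) (fun y => cut (F' i F) (upd i (t i) y)) t =
   cofunl l (leb_part g.1.1 g.1.2 g.2) (cut (F' i F)) t.
  by rewrite cofunl_upd// upd_id.
rewrite E in h2.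
have QE : sg ^+ (size l).+1 * Qall (rev (i :: l)) F t = sg ^+ size l * Qall (rev l) (F' i F) t.
  rewrite exprSr -mulrA; congr (_ * _); rewrite rev_cons -cats1 /Qall foldr_cat/=.
  have sc l' : Qall l' (F' i F) = (fun y => sg * Qall l' (Qop i F) y).
    elim: l' => //= k l' ->; rewrite Qop_scale//; apply: Qall_cont; exact: Qop_cont.
  by rewrite -/(Qall (rev l) (F' i F)) sc.
rewrite QE; set A := cofunl _ _ _ t in h2 *; set B := cofunl _ _ _ t in h1 h2 *.
rewrite -(subrK B A) -addrA; apply: (le_trans (ler_normD _ _)); rewrite (splitr e).
apply: lerD => //; apply: (le_trans h2).
by rewrite mulrCA ler_piMr ?(ltW e2)// ler_pdivrMr// mul1r lerDl.
Qed.

Lemma tot_merge v r : tot (Defs.merge v r t) = \sum_(i in v) r i + \sum_(i in (~: v)%SET) t i.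
Proof.
rewrite /tot (bigID (mem v))/=; congr (_ + _).
  by apply: eq_bigr => i iv; rewrite /Defs.merge iv.
by apply: eq_big => [i|i /negbTE iv]; rewrite ?inE// /Defs.merge iv.
Qed.

Lemma RSint_half_space v l f : uniq l -> v = [set i in l]%SET -> cont_path f ->
  RSint v lo hi (fun r => if inT v t r then f (Defs.merge v r t) else 0) (leb_incr v)
    (sg ^+ size l * Qall (rev l) f t).
Proof.
move=> ul vE cf eps eps0.
have inv i : (i \in v) = (i \in l) by rewrite vE inE.
have [d d0 H] := half_space_limit ul cf (divr_gt0 eps0 (ltr0Sn R 1)).
exists d => // m p xi gr ms.
have gr1 i : i \in l -> grid1 K d (lo i) (hi i) (m i) (p i) (xi i).
  rewrite -inv => iv; exact: (is_grid_grid1 (@hull_inboxl R N lo hi) (@hull_inboxr R N lo hi) gr ms iv).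
rewrite (RSsum_leb _ _ _ _ ul vE).
set F := (fun r => if inT v t r then _ else _).
have dF : depends_on (fun i => i \in v) F.
  move=> r r' rr'; rewrite /F.
  have -> : Defs.merge v r t = Defs.merge v r' t.
    by apply/funext => i; rewrite /Defs.merge; case: ifP => // /rr'.
  suff -> : inT v t r = inT v t r' by [].
  have sE : \sum_(i in v) r i = \sum_(i in v) r' i by apply: eq_bigr => i iv; exact: rr'.
  rewrite /inT sE.
  by case: ifP => _; congr (_ && _); apply: eq_forallb => i;
    case: (boolP (i \in v)) => //= iv; rewrite (rr' i iv).
have -> : cofunl l (leb_part m p xi) F (fun i => xi i 0%N) = cofunl l (leb_part m p xi) F t.
  by apply: (@depends_cofunl R N _ l (leb_part m p xi) F dF) => i; rewrite inv; case: (i \in l).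
(* At actual tags the constraints of [inT] comparing each coordinate with [t] hold automatically, so
   only the half-space condition is left. *)
have -> : cofunl l (leb_part m p xi) F t = cofunl l (leb_part m p xi) (cut f) t.
  apply: cofunl_congr => // r rout rin.
  have mE : Defs.merge v r t = r.
    by apply/funext => k; rewrite /Defs.merge inv; case: ifP => // /negbT /rout ->.
  have rlo k : k \in l -> lo k <= r k <= hi k.
    move=> kl; have [j jm ->] := rin k kl; have [mp [p0 pm] tg _ _] := gr1 k kl.
    have /andP[x1 x2] := tg j jm.
    have /andP[a1 a2] := monoseq_between mp (ltnW jm).
    have /andP[b1 b2] := monoseq_between mp jm.
    rewrite p0 pm (min_l (lohi k)) (max_r (lohi k)) in a1 a2 b1 b2.
    by rewrite (le_trans _ x1) ?le_min ?a1//= (le_trans x2)// ge_max a2.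
  rewrite /F /cut mE; suff -> : inT v t r = ind r by [].
  have totE := tot_merge v r; rewrite mE in totE.
  rewrite /inT -totE -/(tot t) -/S /ind.
  have [S0|S0] := leP 0 S.
    rewrite (_ : [forall i in v, _] = true)//; apply/forallP => i; apply/implyP; rewrite inv => il.
    by have /andP[_] := rlo i il; rewrite /hi max_l// gerBl.
  rewrite (_ : [forall i in v, _] = true)//; apply/forallP => i; apply/implyP; rewrite inv => il.
  by have /andP[+ _] := rlo i il; rewrite /lo min_l// lerDl oppr_ge0 ltW.
apply: (le_lt_trans (H (m, p, xi) gr1)).
by rewrite ltr_pdivrMr// ltr_pMr// ltr1n.
Qed.

(** For negative [S] both [epsv] and the orientation of the integral contribute a power of -1 with
    exponent [#|v|], and these cancel. *)
Lemma regintE v l f : uniq l -> v = [set i in l]%SET -> cont_path f ->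
  epsv v t * regint v t f = Qall (rev l) f t.
Proof.
move=> ul vE cf; have HR := RSint_half_space ul vE cf.
have sz : #|v| = size l by rewrite vE cardsE; apply/card_uniqP.
have -> : regint v t f = sg ^+ size l * Qall (rev l) f t.
  rewrite /regint; set A := (X in xget 0 X).
  have : A (xget 0 A) by apply: (@xgetPex _ 0 A); exists (sg ^+ size l * Qall (rev l) f t).
  by move=> HA; exact: RSint_unique HA HR.
rewrite /epsv -/(tot t) -/S sz /sg; case: ifP => _.
  by rewrite expr1n !mul1r.
by rewrite mulrA -exprMn mulrNN mulr1 expr1n mul1r.
Qed.

End fixed_point.
End half_space_integrals.

(** * The noise of a path *)

Section noise_path.
Context {R : realType} {N : nat}.
Notation vec := ('I_N -> R).
Implicit Types (x : vec -> R) (t s th : vec) (v : {set 'I_N}).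

(** The path form of [Mop] after [lamperti]: the exponential weights of the two cancel. *)
Definition noise_path th x t : R :=
  x t - N%:R^-1 * \sum_(l < N) x (tildev t l) +
  \sum_(v : {set 'I_N} | v != finset.set0) epsv v t * (\prod_(j in v) th j) * regint v t x.

Lemma Mop_lamperti (Omega : Type) th (X : vec -> Omega -> R) t w :
  Mop th (lamperti th X) t w = noise_path th (fun s => X s w) t.
Proof.
have E s : expR (- dotv th s) * lamperti th X (expv s) w = X s w.
  rewrite /lamperti (_ : (fun i => ln (expv s i)) = s).
    by rewrite mulrA -expRD addNr expR0 mul1r.
  by apply/funext => i; rewrite /expv expRK.
rewrite /Mop E /noise_path (_ : (fun x : vec => expR (- dotv th x) * lamperti th X (expv x) w) = (fun s => X s w)); last first.
  by apply/funext => s; exact: E.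
by congr (_ - _ * _ + _); apply: eq_bigr => l _; exact: E.
Qed.

Lemma tildevE t l : tildev t l = upd l (t l - tot t) t.
Proof.
apply/funext => i; rewrite /tildev /upd; case: eqP => // _.
by rewrite /tot [X in _ = _ - X](bigD1 l)//= opprD addrA subrr add0r.
Qed.

(** The signed integrals over regions are replaced by [Qall], a form that is visibly continuous and
    measurable; the reversed enumeration matches [langevin_op]. *)
Definition regular_noise_path th x t : R :=
  x t - N%:R^-1 * \sum_(l < N) x (upd l (t l - tot t) t) +
  \sum_(v : {set 'I_N} | v != finset.set0)
    (\prod_(j in v) th j) * Qall [seq i <- rev (enum 'I_N) | i \in v] x t.

Lemma noise_pathE th x t : cont_path x -> noise_path th x t = regular_noise_path th x t.
Proof.
move=> cx; rewrite /noise_path /regular_noise_path; congr (_ - _ * _ + _).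
  by apply: eq_bigr => l _; rewrite tildevE.
apply: eq_bigr => v _; rewrite mulrAC mulrC; congr (_ * _).
rewrite (@regintE R N t v (rev [seq i <- rev (enum 'I_N) | i \in v]))//.
- by rewrite revK.
- by rewrite rev_uniq filter_uniq// rev_uniq enum_uniq.
- by apply/finset.setP => i; rewrite inE mem_rev mem_filter mem_rev mem_enum andbT.
Qed.

Lemma regular_noise_path_cont th x : cont_path x -> cont_path (regular_noise_path th x).
Proof.
move=> cx; apply: cont_pathD.
  apply: cont_pathB => //; apply: cont_pathM; first exact: cont_path_cst.
  by apply: cont_path_sum => l _; apply: cont_path_map => //; exact: cont_map_proj.
apply: cont_path_sum => v _; apply: cont_pathM; first exact: cont_path_cst.
exact: Qall_cont.
Qed.

(** On the hyperplane every projection is the identity, so the average of the N projected values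
    cancels [x t], and each [Qop] integrates over a single point. *)
Lemma regular_noise_path_tot0 th x t : (0 < N)%N -> tot t = 0 -> regular_noise_path th x t = 0.
Proof.
move=> N0 t0; rewrite /regular_noise_path t0.
under eq_bigr do rewrite subr0 upd_id.
rewrite sumr_const card_ord -[x t *+ N]mulr_natl mulrA mulVf ?pnatr_eq0 -?lt0n// mul1r subrr add0r.
apply: big1 => v v0; rewrite Qall_tot0 ?mulr0//.
have [i iv] := set0Pn _ v0.
have : i \in [seq i <- rev (enum 'I_N) | i \in v] by rewrite mem_filter mem_rev mem_enum iv.
by case: [seq _ <- _ | _].
Qed.

Lemma rect_incr_sum (I : Type) (q : seq I) (p : pred I) (c : I -> R) (H : I -> vec -> R) s t :
  rect_incr (fun r => \sum_(k <- q | p k) c k * H k r) s t =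
  \sum_(k <- q | p k) c k * rect_incr (H k) s t.
Proof.
rewrite (rect_incrE _ _ _ s) incr_sum; apply: eq_bigr => k _.
by rewrite incrZ (rect_incrE _ _ _ s).
Qed.

(** Each projected value ignores one coordinate and has no increments; [Qall] may be replaced by
    [Pall]; the bare [x] is the term of the empty set in [Tall_expand]. *)
Lemma rect_incr_noise_path th x s t : cont_path x ->
  rect_incr (regular_noise_path th x) s t = rect_incr (langevin_op th x) s t.
Proof.
move=> cx; rewrite langevin_opE// Tall_expand ?rev_uniq ?enum_uniq// rect_incr_sum.
have -> : [set i in rev (enum 'I_N)]%SET = [set: 'I_N]%SET.
  by apply/finset.setP => i; rewrite !inE mem_rev mem_enum.
rewrite /regular_noise_path rect_incrD rect_incrB rect_incrZ rect_incr_sum.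
have -> : rect_incr (fun t => \sum_(l < N) x (upd l (t l - tot t) t)) s t = 0.
  have -> : (fun t => \sum_(l < N) x (upd l (t l - tot t) t)) =
            (fun t => \sum_(l < N) 1 * x (upd l (t l - tot t) t)).
    by apply/funext => r; apply: eq_bigr => l _; rewrite mul1r.
  rewrite rect_incr_sum big1// => l _; rewrite (@null_cst _ _ l _) ?mulr0// => y r.
  by rewrite proj_upd.
rewrite mulr0 subr0 [RHS](bigD1 finset.set0) ?finset.sub0set//= big_set0 mul1r.
rewrite (_ : [seq i <- _ | _] = [::]); last first.
  by rewrite (eq_filter (a2 := pred0)) ?filter_pred0// => i; rewrite inE.
congr (_ + _); apply: eq_big => [v|v _]; first by rewrite finset.subsetT.
congr (_ * _); apply: rect_incr_Qall => //.
by rewrite filter_uniq// rev_uniq enum_uniq.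
Qed.

Lemma null_noise_path th x : cont_path x ->
  null (fun t => regular_noise_path th x t - langevin_op th x t).
Proof. by move=> cx s t; rewrite rect_incrB rect_incr_noise_path// subrr. Qed.

Lemma Eall_noise_path th x s t : cont_path x ->
  rect_incr (Eall th (enum 'I_N) (regular_noise_path th x)) s t = rect_incr (expmul th x) s t.
Proof.
move=> cx; have cn := regular_noise_path_cont th cx.
have := proj1 (langevin_op_null th cx cn) (null_noise_path th cx) s t.
by rewrite rect_incrB => /eqP; rewrite subr_eq0 => /eqP.
Qed.

End noise_path.

(** * Finite-dimensional laws *)

Lemma measurable_lincomb (d : measure_display) (T : measurableType d) (R : realType)
    (I : Type) (q : seq I) (c : I -> R) (A : I -> T -> R) :
  (forall i, measurable_fun setT (A i)) ->
  measurable_fun setT (fun w => \sum_(i <- q) c i * A i w).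
Proof.
move=> mA; elim: q => [|i q IH].
  by under eq_fun do rewrite big_nil; exact: measurable_cst.
under eq_fun do rewrite big_cons.
apply: measurable_funD => //.
by apply: measurable_funM => //; exact: measurable_cst.
Qed.

Section orthants.
Context {R : realType} {I : finType}.

(** A joint distribution function evaluates the law on these sets. They are closed under
    intersection, so they determine the law on the sigma-algebra they generate. *)
Definition orthants : set (set (I -> R)) :=
  [set C | exists y : I -> R, C = [set x | forall i, x i <= y i]].

Let GT := g_sigma_algebraType orthants.

Lemma orthants_setI : setI_closed orthants.
Proof.
move=> _ _ [y ->] [z ->]; exists (fun i => Num.min (y i) (z i)).
apply/seteqP; split=> x /=; first by move=> [xy xz] i; rewrite le_min xy xz.
by move=> H; split=> i; have := H i; rewrite le_min => /andP[].
Qed.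

Lemma orthants_cover :
  \bigcup_n [set x : I -> R | forall i, x i <= n%:R] = setT.
Proof.
rewrite -subTset => x _.
exists (Num.truncn (\sum_i `|x i|)).+1 => //= i.
apply: (le_trans (ler_norm _)); apply: (le_trans _ (ltW (truncnS_gt _))).
by rewrite (bigD1 i)//= lerDl sumr_ge0.
Qed.

Lemma measurable_orthant_coord (i : I) :
  measurable_fun setT (fun x : GT => x i : R).
Proof.
apply: (measurability _ (RGenOInfty.measurableE R)) => //.
move=> /= _ [_ [a ->] <-]; rewrite setTI.
(* Letting the bounds of all coordinates but [i] tend to infinity exhausts the half-space [x i <= a]
   by orthants. *)
rewrite (_ : _ @^-1` _ = ~` \bigcup_n [set x : I -> R | forall j, x j <= if j == i then a else n%:R]).
  apply: measurableC; apply: bigcupT_measurable => n; apply: sub_sigma_algebra.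
  by exists (fun j => if j == i then a else n%:R).
apply/seteqP; split=> x /=; rewrite in_itv/= andbT.
  by move=> ax [n _ /(_ i)]; rewrite eqxx leNgt ax.
move=> H; rewrite ltNge; apply/negP => xa; apply: H.
have : [set: I -> R] x by [].
rewrite -orthants_cover => -[n _ xn]; exists n => // j.
by case: eqP => [->|_]//; exact: xn.
Qed.

End orthants.

Lemma measurable_below (d : measure_display) (T : measurableType d) (R : realType) (I : finType)
    (A : I -> T -> R) (x : I -> R) :
  (forall i, measurable_fun setT (A i)) -> measurable [set w | forall i, A i w <= x i].
Proof.
move=> mA.
rewrite (_ : [set w | _] = \bigcap_(i in [set: I]) [set w | A i w <= x i]); last first.
  by apply/seteqP; split=> w /= H i; [move=> _; exact: H|exact: H].
apply: fin_bigcap_measurable => // i _.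
rewrite -[X in measurable X]setTI (_ : [set w | _] = A i @^-1` [set` `]-oo, x i]]).
  exact: mA.
by apply/seteqP; split=> w /=; rewrite in_itv.
Qed.

Section same_laws.
Context {R : realType} {d : measure_display} {Omega : measurableType d}.
Variable P : probability Omega R.
Implicit Types I J : finType.

Definition same_cdf I (A B : I -> Omega -> R) := forall x : I -> R,
  P [set w | forall i, A i w <= x i] = P [set w | forall i, B i w <= x i].

(** The two image measures agree on a generating pi-system that exhausts the space by sets of finite
    measure, hence everywhere. *)
Lemma same_cdf_measurable I (A B : I -> Omega -> R) :
  (forall i, measurable_fun setT (A i)) -> (forall i, measurable_fun setT (B i)) ->
  same_cdf A B -> forall C : set (I -> R), <<s @orthants R I >> C ->
    P [set w | C (A^~ w)] = P [set w | C (B^~ w)].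
Proof.
move=> mA mB AB C mC.
pose GT := g_sigma_algebraType (@orthants R I).
have mf (D : I -> Omega -> R) : (forall i, measurable_fun setT (D i)) ->
    measurable_fun setT (fun w => D^~ w : GT).
  move=> mD; apply: (@measurability _ _ _ GT _ _ (@orthants R I)) => //.
  move=> _ [_ [y ->] <-]; rewrite setTI; exact: measurable_below.
pose m1 := measure_function_pushforward__canonical__measure_function_Measure P (mf A mA).
pose m2 := measure_function_pushforward__canonical__measure_function_Measure P (mf B mB).
apply: (@g_sigma_algebra_measure_unique _ R GT (@orthants R I) _
  (fun n => [set x : I -> R | forall i, x i <= n%:R]) _ _ m1 m2 _ _ _ C mC) => //.
- by move=> D mD; exact: sub_sigma_algebra.
- by move=> n; exists (fun=> n%:R).
- exact: orthants_cover.
- exact: orthants_setI.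
- by move=> _ [y ->]; exact: AB.
- move=> n; apply: (@le_lt_trans _ _ 1%E); last exact: ltry.
  by apply: probability_le1; exact: measurable_below.
Qed.

Lemma same_cdf_lincomb I J (A B : I -> Omega -> R) (c : J -> I -> R) :
  (forall i, measurable_fun setT (A i)) -> (forall i, measurable_fun setT (B i)) ->
  same_cdf A B ->
  same_cdf (fun j w => \sum_i c j i * A i w) (fun j w => \sum_i c j i * B i w).
Proof.
move=> mA mB AB x.
pose C : set (I -> R) := [set y | forall j, \sum_i c j i * y i <= x j].
have mC : <<s @orthants R I >> C.
  apply: (@measurable_below _ (g_sigma_algebraType (@orthants R I)) R J
    (fun j y => \sum_i c j i * y i) x) => j.
  by apply: measurable_lincomb => i; exact: measurable_orthant_coord.
exact: (same_cdf_measurable mA mB AB mC).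
Qed.

Lemma same_cdf_abs I (A B : I -> Omega -> R) (i : I) (e : R) :
  (forall i, measurable_fun setT (A i)) -> (forall i, measurable_fun setT (B i)) ->
  same_cdf A B -> P [set w | e <= `|A i w|] = P [set w | e <= `|B i w|].
Proof.
move=> mA mB AB.
apply: (same_cdf_measurable mA mB AB (C := [set x | e <= `|x i|])).
have mi := @measurable_orthant_coord R I i.
rewrite -[X in <<s _ >> X]setTI.
rewrite (_ : [set x | _] = (fun x : g_sigma_algebraType (@orthants R I) => `|x i|) @^-1` [set` `[e, +oo[]).
  by apply: (measurableT_comp _ mi).
by apply/seteqP; split=> w /=; rewrite in_itv/= andbT.
Qed.

Lemma measurable_ge (A : Omega -> R) (e : R) : measurable_fun setT A ->
  measurable [set w | e <= A w].
Proof.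
move=> mA; rewrite -[X in measurable X]setTI (_ : [set w | _] = A @^-1` [set` `[e, +oo[]).
  exact: mA.
by apply/seteqP; split=> w /=; rewrite in_itv/= andbT.
Qed.

Lemma measurable_absB (A B : Omega -> R) : measurable_fun setT A -> measurable_fun setT B ->
  measurable_fun setT (fun w => `|A w - B w|).
Proof.
move=> mA mB; apply: measurableT_comp => //.
exact: measurable_funB.
Qed.

Lemma le_probability_ae (A B : set Omega) : measurable A -> measurable B ->
  {ae P, forall w, A w -> B w} -> (P A <= P B)%E.
Proof.
move=> mA mB [N [mN N0 sub]].
have AB : A `<=` B `|` N.
  move=> w Aw; have [Bw|nBw] := pselect (B w); first by left.
  by right; apply: sub => /= H; apply: nBw; exact: H.
have E : (P B + P N = P B)%E by rewrite N0 adde0.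
apply: (@le_trans _ _ (P (B `|` N))); last by rewrite -E; exact: measureU2.
by apply: le_measure => //; rewrite inE//; exact: measurableU.
Qed.

Lemma same_cdf_ae I (A B : I -> Omega -> R) :
  (forall i, measurable_fun setT (A i)) -> (forall i, measurable_fun setT (B i)) ->
  (forall i, {ae P, forall w, A i w = B i w}) -> same_cdf A B.
Proof.
move=> mA mB AB x.
have H : {ae P, forall w, forall i, A i w = B i w}.
  have : {ae P, forall w, forall n : nat, forall i, (enum_rank i == n :> nat) -> A i w = B i w}.
    apply: ae_foralln => n.
    have [[i Ei]|nE] := pselect (exists i : I, enum_rank i = n :> nat).
      apply: filterS (AB i) => w ABw j /eqP Ej.
      by have -> : j = i by apply/enum_rank_inj/val_inj; rewrite /= Ei Ej.
    by apply: aeW => w j /eqP Ej; exfalso; apply: nE; exists j.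
  by apply: filterS => w Hw i; apply: (Hw (enum_rank i)).
by apply/eqP; rewrite eq_le; apply/andP; split; apply: le_probability_ae;
  try exact: measurable_below; apply: filterS H => w Hw HH i; have := HH i; rewrite Hw.
Qed.

Lemma same_cdf_sym I (A B : I -> Omega -> R) : same_cdf A B -> same_cdf B A.
Proof. by move=> H x; rewrite H. Qed.

Lemma same_cdf_trans I (A B C : I -> Omega -> R) : same_cdf A B -> same_cdf B C -> same_cdf A C.
Proof. by move=> H H' x; rewrite H H'. Qed.

End same_laws.

(** * Convergence in probability *)

Section convergence_in_probability.
Context {R : realType} {d : measure_display} {Omega : measurableType d}.
Variable P : probability Omega R.

(** An arbitrary filter, since both real corners tending to infinity and integer Riemann sums
    occur. *)
Definition cvgp (T : Type) (F : set_system T) (Z : T -> Omega -> R) (L : Omega -> R) :=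
  forall eps eta : R, 0 < eps -> 0 < eta ->
    \forall s \near F, (P [set w | (eps <= `|Z s w - L w|)%R] <= eta%:E)%E.

Lemma measurable_dist_ge (A B : Omega -> R) (eps : R) :
  measurable_fun setT A -> measurable_fun setT B ->
  measurable [set w | (eps <= `|A w - B w|)%R].
Proof. by move=> mA mB; apply: measurable_ge; exact: measurable_absB. Qed.

Lemma probability_fine (A : set Omega) : measurable A -> P A = (fine (P A))%:E.
Proof. by move=> mA; rewrite fineK// fin_num_measure. Qed.

Lemma cvgpP (T : Type) (F : set_system T) {FF : Filter F} (Z : T -> Omega -> R) (L : Omega -> R) :
  (forall s, measurable_fun setT (Z s)) -> measurable_fun setT L ->
  cvgp F Z L <-> (forall eps : R, 0 < eps ->
    P [set w | (eps <= `|Z s w - L w|)%R] @[s --> F] --> 0%E).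
Proof.
move=> mZ mL; split=> H eps.
  move=> eps0; have mE s := measurable_dist_ge eps (mZ s) mL.
  rewrite (_ : (fun s => _) = (fun s => (fine (P [set w | (eps <= `|Z s w - L w|)%R]))%:E)); last first.
    by apply/funext => s; exact: probability_fine.
  apply: cvg_EFin; first by apply: nearW => s.
  apply/cvgrPdist_le => eta eta0; apply: filterS (H eps eta eps0 eta0) => s.
  rewrite (probability_fine (mE s)) lee_fin sub0r normrN/= => h.
  by rewrite ger0_norm// fine_ge0.
move=> eta eps0 eta0; have mE s := measurable_dist_ge eps (mZ s) mL.
have /fine_cvgP[_ /cvgrPdist_le/(_ eta eta0)] := H eps eps0.
apply: filterS => s /=; rewrite sub0r normrN (probability_fine (mE s)) lee_fin => h.
exact: le_trans (ler_norm _) h.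
Qed.

Lemma cvgp_ae (T : Type) (F : set_system T) {FF : Filter F} (Z Z' : T -> Omega -> R) (L L' : Omega -> R) :
  (forall s, measurable_fun setT (Z s)) -> measurable_fun setT L ->
  (forall s, measurable_fun setT (Z' s)) -> measurable_fun setT L' ->
  (forall s, {ae P, forall w, Z s w = Z' s w}) -> {ae P, forall w, L w = L' w} ->
  cvgp F Z L -> cvgp F Z' L'.
Proof.
move=> mZ mL mZ' mL' ZZ' LL' H eps eta eps0 eta0.
apply: filterS (H eps eta eps0 eta0) => s; apply: le_trans.
apply: le_probability_ae; [exact: measurable_dist_ge|exact: measurable_dist_ge|].
by apply: filterS2 (ZZ' s) LL' => w /= -> ->.
Qed.

Lemma probabilityU_le (A B C : set Omega) (a b : R) : measurable A -> measurable B -> measurable C ->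
  A `<=` B `|` C -> (P B <= a%:E)%E -> (P C <= b%:E)%E -> (P A <= (a + b)%:E)%E.
Proof.
move=> mA mB mC ABC Ba Cb; apply: (@le_trans _ _ (P B + P C)%E).
  apply: (@le_trans _ _ (P (B `|` C))); last exact: measureU2.
  by apply: le_measure => //; rewrite inE//; exact: measurableU.
by rewrite EFinD; exact: leeD.
Qed.

Lemma cvgp_add (T : Type) (F : set_system T) {FF : Filter F} (Z Z' : T -> Omega -> R) (L L' : Omega -> R) :
  (forall s, measurable_fun setT (Z s)) -> measurable_fun setT L ->
  (forall s, measurable_fun setT (Z' s)) -> measurable_fun setT L' ->
  cvgp F Z L -> cvgp F Z' L' -> cvgp F (fun s w => Z s w + Z' s w) (fun w => L w + L' w).
Proof.
move=> mZ mL mZ' mL' H H' eps eta eps0 eta0.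
have e2 : 0 < eps / 2 by rewrite divr_gt0.
have eta2 : 0 < eta / 2 by rewrite divr_gt0.
apply: filterS2 (H _ _ e2 eta2) (H' _ _ e2 eta2) => s h h'.
rewrite (splitr eta); apply: probabilityU_le h h'.
- by apply: measurable_dist_ge; apply: measurable_funD.
- exact: measurable_dist_ge.
- exact: measurable_dist_ge.
move=> w /= Hw; have [h1|h1] := leP (eps / 2) `|Z s w - L w|; first by left.
right => /=; have := ler_normD (Z s w - L w) (Z' s w - L' w).
have -> : Z s w - L w + (Z' s w - L' w) = Z s w + Z' s w - (L w + L' w) by ring.
by move=> h2; lra.
Qed.

Lemma cvgp_scale (T : Type) (F : set_system T) {FF : Filter F} (Z : T -> Omega -> R) (L : Omega -> R) (c : R) :
  cvgp F Z L -> cvgp F (fun s w => c * Z s w) (fun w => c * L w).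
Proof.
move=> H eps eta eps0 eta0.
have [c0|c0] := eqVneq c 0.
  apply: nearW => s; rewrite (_ : [set w | _] = set0) ?measure0 ?lee_fin ?ltW//.
  apply/seteqP; split=> w //=; rewrite c0 !mul0r subrr normr0 leNgt => /negP; apply.
  by [].
have c1 : 0 < `|c| by rewrite normr_gt0.
apply: filterS (H _ _ (divr_gt0 eps0 c1) eta0) => s.
apply: le_trans; rewrite (_ : [set w | _] = [set w | (eps / `|c| <= `|Z s w - L w|)%R])//.
by apply/seteqP; split=> w /=; rewrite -mulrBr normrM ler_pdivrMr// mulrC.
Qed.

Lemma cvgp_cst0 (T : Type) (F : set_system T) {FF : Filter F} : cvgp F (fun _ _ => 0) (fun=> 0).
Proof.
move=> eps eta eps0 eta0; apply: nearW => s.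
have -> : [set w : Omega | (eps <= `|(0 : R) - 0|)%R] = set0.
  by apply/seteqP; split=> w //=; rewrite subr0 normr0 leNgt eps0.
by rewrite measure0 lee_fin ltW.
Qed.

Lemma cvgp_lincomb (T : Type) (F : set_system T) {FF : Filter F} (I : Type) (q : seq I) (c : I -> R)
    (Z : I -> T -> Omega -> R) (L : I -> Omega -> R) :
  (forall i s, measurable_fun setT (Z i s)) -> (forall i, measurable_fun setT (L i)) ->
  (forall i, cvgp F (Z i) (L i)) ->
  cvgp F (fun s w => \sum_(i <- q) c i * Z i s w) (fun w => \sum_(i <- q) c i * L i w).
Proof.
move=> mZ mL H; elim: q => [|i q IH].
  rewrite (_ : (fun s w => _) = fun _ _ => 0); last by apply/funext => s; apply/funext => w; rewrite big_nil.
  by rewrite (_ : (fun w => _) = fun=> 0); [exact: cvgp_cst0|apply/funext => w; rewrite big_nil].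
rewrite (_ : (fun s w => _) = fun s w => c i * Z i s w + \sum_(i <- q) c i * Z i s w); last first.
  by apply/funext => s; apply/funext => w; rewrite big_cons.
rewrite (_ : (fun w => \sum_(i <- i :: q) _) = fun w => c i * L i w + \sum_(i <- q) c i * L i w); last first.
  by apply/funext => w; rewrite big_cons.
apply: cvgp_add => //; first 4 last.
- exact: cvgp_scale.
- by move=> s; apply: measurable_funM => //; exact: measurable_cst.
- by apply: measurable_funM => //; exact: measurable_cst.
- by move=> s; exact: measurable_lincomb.
- exact: measurable_lincomb.
Qed.

Lemma le_probability0 (A : set Omega) : measurable A -> (forall eta : R, 0 < eta -> (P A <= eta%:E)%E) -> P A = 0%E.
Proof.
move=> mA H; apply/eqP; rewrite eq_le measure_ge0 andbT.
by apply/lee_addgt0Pr => e e0; rewrite add0e; exact: H.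
Qed.

Lemma cvgp_unique (T : Type) (F : set_system T) {FF : ProperFilter F} (Z : T -> Omega -> R) (L L' : Omega -> R) :
  (forall s, measurable_fun setT (Z s)) -> measurable_fun setT L -> measurable_fun setT L' ->
  cvgp F Z L -> cvgp F Z L' -> {ae P, forall w, L w = L' w}.
Proof.
move=> mZ mL mL' H H'.
have E0 (eps : R) : 0 < eps -> P [set w | (eps <= `|L w - L' w|)%R] = 0%E.
  move=> eps0; apply: le_probability0; first exact: measurable_dist_ge.
  move=> eta eta0.
  have e2 : 0 < eps / 2 by rewrite divr_gt0.
  have eta2 : 0 < eta / 2 by rewrite divr_gt0.
  have [s [h h']] := filter_ex (filterI (H _ _ e2 eta2) (H' _ _ e2 eta2)).
  rewrite (splitr eta); apply: probabilityU_le h h'.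
  - exact: measurable_dist_ge.
  - exact: measurable_dist_ge.
  - exact: measurable_dist_ge.
  move=> w /= Hw; have [h1|h1] := leP (eps / 2) `|Z s w - L w|; first by left.
  right => /=; have := ler_normB (Z s w - L w) (Z s w - L' w).
  have -> : Z s w - L w - (Z s w - L' w) = - (L w - L' w) by ring.
  by rewrite normrN => h2; lra.
have : {ae P, forall w, forall n : nat, `|L w - L' w| < n.+1%:R^-1}.
  apply: ae_foralln => n; exists [set w | (n.+1%:R^-1 <= `|L w - L' w|)%R]; split.
  - exact: measurable_dist_ge.
  - by apply: E0; rewrite invr_gt0.
  - by move=> w /=; rewrite leNgt => /negP.
apply: filterS => w Hw; apply/eqP; rewrite -subr_eq0 -normr_le0 leNgt; apply/negP => e0.
have := Hw (Num.truncn (`|L w - L' w|^-1)).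
rewrite ltNge => /negP; apply.
rewrite -[leRHS]invrK lef_pV2 ?posrE ?invr_gt0//; apply: ltW; exact: truncnS_gt.
Qed.

Lemma tight (L : Omega -> R) (eta : R) : measurable_fun setT L -> 0 < eta ->
  exists M : R, (P [set w | (M <= `|L w|)%R] <= eta%:E)%E.
Proof.
move=> mL eta0; pose E (n : nat) := [set w | (n%:R <= `|L w|)%R].
have mabs : measurable_fun setT (fun w => `|L w|) by exact: measurableT_comp.
have mE n : measurable (E n) by exact: measurable_ge.
have cap0 : \bigcap_n E n = set0.
  apply/seteqP; split=> w //= H; have := H (Num.truncn `|L w|).+1 I.
  by rewrite /E/= leNgt truncnS_gt.
have := @nonincreasing_cvg_mu _ _ _ P E _ mE.
rewrite cap0 measure0 => H.
have {}H : P \o E @ \oo --> 0%E.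
  apply: H => //.
  - by apply: (@le_lt_trans _ _ 1%E); [exact: probability_le1|exact: ltry].
  - move=> m n mn; apply/subsetPset => w /=; rewrite /E/=; apply: le_trans.
    by rewrite ler_nat.
have /fine_cvgP[_ /cvgrPdist_le/(_ eta eta0)] := H.
move=> nearn; have [n /=] := filter_ex nearn.
rewrite sub0r normrN => h; exists n%:R.
rewrite -/(E n) (probability_fine (mE n)) lee_fin.
exact: le_trans (ler_norm _) h.
Qed.

(** A single limit variable is tight, so for large [r] the [Z r] are bounded outside an event of
    small probability, and the exponential factor wins. *)
Lemma cvgp_decay (c : R) (Z : R -> Omega -> R) (L : Omega -> R) :
  (forall s, measurable_fun setT (Z s)) -> measurable_fun setT L -> 0 < c ->
  cvgp (+oo : set_system R) Z L ->
  cvgp (+oo : set_system R) (fun r w => expR (- (c * r)) * Z r w) (fun=> 0).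
Proof.
move=> mZ mL c0 H eps eta eps0 eta0.
have eta2 : 0 < eta / 2 by rewrite divr_gt0.
have [M HM] := tight mL eta2.
have [M' M'0 HM'] : exists2 M' : R, 0 <= M' & (P [set w | (M' <= `|L w|)%R] <= (eta / 2)%:E)%E.
  exists (Num.max 0 M); first by rewrite le_max lexx.
  apply: (le_trans _ HM); apply: le_measure; rewrite ?inE.
  - by apply: measurable_ge; exact: measurableT_comp.
  - by apply: measurable_ge; exact: measurableT_comp.
  - by move=> w /=; rewrite ge_max => /andP[].
near=> r.
rewrite (splitr eta).
apply: (@probabilityU_le _ [set w | (1 <= `|Z r w - L w|)%R] [set w | (M' <= `|L w|)%R]) => //.
- apply: measurable_dist_ge; last exact: measurable_cst.
  by apply: measurable_funM => //; exact: measurable_cst.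
- exact: measurable_dist_ge.
- by apply: measurable_ge; exact: measurableT_comp.
- move=> w /=; rewrite subr0 normrM (ger0_norm (expR_ge0 _)) expRN => h.
  have [h1|h1] := leP 1 `|Z r w - L w|; first by left.
  right => /=; rewrite leNgt; apply/negP => h2.
  have h3 : `|Z r w| < M' + 1.
    rewrite -(subrK (L w) (Z r w)) addrC; apply: (le_lt_trans (ler_normD _ _)).
    exact: ltrD.
  (* The linear bound [1 + x <= expR x] is enough. *)
  have h4 : (M' + 1) / eps <= expR (c * r).
    apply: (le_trans _ (expR_ge1Dx _)).
    have : (M' + 1) / eps / c <= r by near: r; apply: nbhs_pinfty_ge; exact: num_real.
    by rewrite ler_pdivrMr// (mulrC c) => h4; lra.
  have h5 : eps * expR (c * r) <= `|Z r w|.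
    by rewrite -ler_pdivlMr ?expR_gt0// mulrC.
  move: h4; rewrite ler_pdivrMr// mulrC => h4.
  by have := le_lt_trans (le_trans h4 h5) h3; rewrite ltxx.
- near: r; exact: H.
Unshelve. all: by end_near. Qed.

Lemma cvgp_same_law (T : Type) (F : set_system T) (Z Z' : T -> Omega -> R) :
  (forall s, measurable_fun setT (Z s)) -> (forall s, measurable_fun setT (Z' s)) ->
  (forall s, same_cdf P (fun _ : 'I_1 => Z s) (fun _ : 'I_1 => Z' s)) ->
  cvgp F Z (fun=> 0) -> cvgp F Z' (fun=> 0).
Proof.
move=> mZ mZ' ZZ' H eps eta eps0 eta0.
have := H eps eta eps0 eta0; rewrite /prop_near1; congr F.
apply/funext => s /=; congr (_ <= _)%E.
have := same_cdf_abs ord0 eps (fun=> mZ s) (fun=> mZ' s) (ZZ' s).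
under [X in _ -> P X = _ ]eq_set do rewrite subr0.
by under [X in _ -> _ = P X]eq_set do rewrite subr0.
Qed.

(** The events that some index from [n] on deviates by [eps] decrease to the empty set, so their
    probabilities tend to 0. *)
Lemma cvgp_pointwise (Z : nat -> Omega -> R) (L : Omega -> R) :
  (forall n, measurable_fun setT (Z n)) -> measurable_fun setT L ->
  (forall w, Z ^~ w @ \oo --> L w) -> cvgp \oo Z L.
Proof.
move=> mZ mL H eps eta eps0 eta0.
pose E n := \bigcup_(k in [set k | (n <= k)%N]) [set w | (eps <= `|Z k w - L w|)%R].
have mE n : measurable (E n).
  by apply: bigcup_measurable => k _; exact: measurable_dist_ge.
have cap0 : \bigcap_n E n = set0.
  apply/seteqP; split=> w //= HE.
  have /cvgrPdist_lt/(_ eps eps0)[n _ Hn] := H w.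
  have [k /= nk] := HE n I; have := Hn k nk; rewrite /= distrC => h1 h2.
  by have := lt_le_trans h1 h2; rewrite ltxx.
have := @nonincreasing_cvg_mu _ _ _ P E _ mE.
rewrite cap0 measure0 => HH.
have {}HH : P \o E @ \oo --> 0%E.
  apply: HH => //.
  - by apply: (@le_lt_trans _ _ 1%E); [exact: probability_le1|exact: ltry].
  - move=> m n mn; apply/subsetPset => w [k /= nk h]; exists k => //=.
    exact: leq_trans nk.
have /fine_cvgP[_ /cvgrPdist_le/(_ eta eta0)] := HH.
apply: filterS => n /=; rewrite sub0r normrN => h.
apply: (@le_trans _ _ (P (E n))).
  apply: le_measure; rewrite ?inE//; first exact: measurable_dist_ge.
  by move=> w /= hw; exists n => /=.
by rewrite (probability_fine (mE n)) lee_fin (le_trans (ler_norm _) h).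
Qed.

(** Distribution functions may jump at [x], so the comparison has slack: [eps] is spent from [A'] to
    [A s], the laws of [A s] and [B s] are exchanged, and [eps] is spent again from [B s] to
    [B']. *)
Lemma cvgp_cdf_le (T : Type) (F : set_system T) {FF : ProperFilter F} (I : finType)
    (A B : T -> I -> Omega -> R) (A' B' : I -> Omega -> R) :
  (forall s i, measurable_fun setT (A s i)) -> (forall s i, measurable_fun setT (B s i)) ->
  (forall i, measurable_fun setT (A' i)) -> (forall i, measurable_fun setT (B' i)) ->
  (forall s, same_cdf P (A s) (B s)) ->
  (forall i, cvgp F (fun s => A s i) (A' i)) -> (forall i, cvgp F (fun s => B s i) (B' i)) ->
  forall x : I -> R, (P [set w | forall i, A' i w <= x i]%R <= P [set w | forall i, B' i w <= x i]%R)%E.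
Proof.
move=> mA mB mA' mB' AB cA cB x.
have step (eps : R) : 0 < eps ->
    (P [set w | forall i, A' i w <= x i]%R <= P [set w | forall i, B' i w <= x i + (eps + eps)]%R)%E.
  move=> eps0; apply/lee_addgt0Pr => eta eta0.
  pose n := #|I|.
  (* Each of the two union bounds over [n] coordinates may cost [eta / 2]; [n.+1] avoids division by
     0 for an empty index type. *)
  have eta' : 0 < eta / (2 * n.+1%:R) by rewrite divr_gt0.
  have nA : \forall s \near F, forall i, (P [set w | (eps <= `|A s i w - A' i w|)%R] <= (eta / (2 * n.+1%:R))%:E)%E.
    by apply: filter_forall => i; exact: cA.
  have nB : \forall s \near F, forall i, (P [set w | (eps <= `|B s i w - B' i w|)%R] <= (eta / (2 * n.+1%:R))%:E)%E.
    by apply: filter_forall => i; exact: cB.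
  have [s [hA hB]] := filter_ex (filterI nA nB).
  have bad (C : T -> I -> Omega -> R) (C' : I -> Omega -> R) :
      (forall s i, measurable_fun setT (C s i)) -> (forall i, measurable_fun setT (C' i)) ->
      (forall i, (P [set w | (eps <= `|C s i w - C' i w|)%R] <= (eta / (2 * n.+1%:R))%:E)%E) ->
      measurable (\big[setU/set0]_(i : I) [set w | (eps <= `|C s i w - C' i w|)%R]) /\
      (P (\big[setU/set0]_(i : I) [set w | (eps <= `|C s i w - C' i w|)%R]) <= (eta / 2)%:E)%E.
    move=> mC mC' h.
    have m1 : measurable (\big[setU/set0]_(i : I) [set w | (eps <= `|C s i w - C' i w|)%R]).
      by apply: bigsetU_measurable => i _; exact: measurable_dist_ge.
    split=> //.
    have H : forall q : seq I, (P (\big[setU/set0]_(i <- q) [set w | (eps <= `|C s i w - C' i w|)%R]) <=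
        ((size q)%:R * (eta / (2 * n.+1%:R)))%:E)%E.
      elim=> [|i q IH]; first by rewrite big_nil measure0 mul0r.
      rewrite big_cons /= -addn1 natrD mulrDl mul1r addrC.
      apply: probabilityU_le (h i) IH => //.
      - apply: measurableU; first exact: measurable_dist_ge.
        by apply: bigsetU_measurable => j _; exact: measurable_dist_ge.
      - exact: measurable_dist_ge.
      - by apply: bigsetU_measurable => j _; exact: measurable_dist_ge.
    apply: (le_trans (H _)); rewrite lee_fin -[index_enum I]/(Finite.enum I) -enumT -cardE -/n.
    rewrite mulrA ler_pdivrMr//.
    have -> : eta / 2 * (2 * n.+1%:R) = n.+1%:R * eta by field.
    by rewrite ler_pM2r// ler_nat.
  have [mUA hUA] := bad A A' mA mA' hA.
  have [mUB hUB] := bad B B' mB mB' hB.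
  have bigsetUP (C : I -> set Omega) i w : C i w -> (\big[setU/set0]_(i : I) C i) w.
    by move=> Ci; rewrite (bigD1 i)//=; left.
  set UA := \big[setU/set0]_(i : I) _ in mUA hUA.
  set UB := \big[setU/set0]_(i : I) _ in mUB hUB.
  have s1 : (P [set w | forall i, A' i w <= x i]%R <=
      P [set w | forall i, A s i w <= x i + eps]%R + (eta / 2)%:E)%E.
    apply: (@le_trans _ _ (P [set w | forall i, A s i w <= x i + eps]%R + P UA)%E); last exact: leeD.
    have mS : measurable [set w | forall i, A s i w <= x i + eps]%R by exact: measurable_below.
    apply: (@le_trans _ _ (P ([set w | forall i, A s i w <= x i + eps]%R `|` UA))); last exact: measureU2.
    apply: le_measure; rewrite ?inE; [exact: measurable_below|exact: measurableU|].
    move=> w /= h; have [bd|nbd] := pselect (exists i, eps <= `|A s i w - A' i w|).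
      by right; case: bd => i; exact: bigsetUP.
    left => i; have : `|A s i w - A' i w| < eps by rewrite ltNge; apply/negP => hh; apply: nbd; exists i.
    by rewrite ltr_norml; have := h i; lra.
  have s2 : (P [set w | forall i, B s i w <= x i + eps]%R <=
      P [set w | forall i, B' i w <= x i + (eps + eps)]%R + (eta / 2)%:E)%E.
    apply: (@le_trans _ _ (P [set w | forall i, B' i w <= x i + (eps + eps)]%R + P UB)%E); last exact: leeD.
    have mS : measurable [set w | forall i, B' i w <= x i + (eps + eps)]%R by exact: measurable_below.
    apply: (@le_trans _ _ (P ([set w | forall i, B' i w <= x i + (eps + eps)]%R `|` UB))); last exact: measureU2.
    apply: le_measure; rewrite ?inE; [exact: measurable_below|exact: measurableU|].
    move=> w /= h; have [bd|nbd] := pselect (exists i, eps <= `|B s i w - B' i w|).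
      by right; case: bd => i; exact: bigsetUP.
    left => i; have : `|B s i w - B' i w| < eps by rewrite ltNge; apply/negP => hh; apply: nbd; exists i.
    by rewrite ltr_norml; have := h i; lra.
  apply: (le_trans s1); rewrite (AB s) [eta in leRHS]splitr EFinD addeA.
  exact: leeD.
(* Closed orthants are decreasing limits of enlarged ones, so continuity from above removes the
   slack. *)
pose E (n : nat) := [set w | forall i, B' i w <= x i + (n.+1%:R^-1 + n.+1%:R^-1)]%R.
have mE n : measurable (E n) by exact: measurable_below.
have cap : \bigcap_n E n = [set w | forall i, B' i w <= x i]%R.
  apply/seteqP; split=> w /= H; last first.
    by move=> n _ i; rewrite (le_trans (H i))// lerDl addr_ge0 ?invr_ge0.
  move=> i; rewrite leNgt; apply/negP => xB.
  have e0 : 0 < (B' i w - x i) / 2 by rewrite divr_gt0// subr_gt0.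
  have := H (Num.truncn ((B' i w - x i) / 2)^-1) Logic.I i.
  have : (Num.truncn ((B' i w - x i) / 2)^-1).+1%:R^-1 < (B' i w - x i) / 2.
    rewrite -[ltRHS]invrK ltf_pV2 ?posrE ?invr_gt0//; exact: truncnS_gt.
  by move: (_.+1%:R^-1) => q; lra.
have := @nonincreasing_cvg_mu _ _ _ P E _ mE; rewrite cap => H.
have {}H : P \o E @ \oo --> P [set w | forall i, B' i w <= x i]%R.
  apply: H.
  - by apply: (@le_lt_trans _ _ 1%E); [exact: probability_le1|exact: ltry].
  - exact: measurable_below.
  - move=> m n mn; apply/subsetPset => w /= h i; apply: (le_trans (h i)).
    by rewrite lerD2l lerD// lef_pV2 ?posrE// ler_nat.
rewrite -(cvg_lim _ H)//; apply: lime_ge; first by apply/cvg_ex; exists (P [set w | forall i, B' i w <= x i]%R).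
by apply: nearW => n /=; apply: step; rewrite invr_gt0.
Qed.

Lemma cvgp_same_cdf (T : Type) (F : set_system T) {FF : ProperFilter F} (I : finType)
    (A B : T -> I -> Omega -> R) (A' B' : I -> Omega -> R) :
  (forall s i, measurable_fun setT (A s i)) -> (forall s i, measurable_fun setT (B s i)) ->
  (forall i, measurable_fun setT (A' i)) -> (forall i, measurable_fun setT (B' i)) ->
  (forall s, same_cdf P (A s) (B s)) ->
  (forall i, cvgp F (fun s => A s i) (A' i)) -> (forall i, cvgp F (fun s => B s i) (B' i)) ->
  same_cdf P A' B'.
Proof.
move=> mA mB mA' mB' AB cA cB x; apply/eqP; rewrite eq_le; apply/andP; split.
  exact: cvgp_cdf_le mA mB mA' mB' AB cA cB x.
exact: cvgp_cdf_le mB mA mB' mA' (fun s => same_cdf_sym (AB s)) cB cA x.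
Qed.

End convergence_in_probability.

(** * Fields with continuous paths and pathwise operators *)

Section random_fields.
Context {R : realType} {N : nat} {d : measure_display} {Omega : measurableType d}.
Variable P : probability Omega R.
Notation vec := ('I_N -> R).
Notation field := (vec -> Omega -> R).
Implicit Types (X Y Z U V : field) (t s h : vec) (f : vec -> R) (O : (vec -> R) -> vec -> R).

Definition regular_field X :=
  (forall t, measurable_fun setT (X t)) /\ forall w, cont_path (X^~ w).

(** Paths are set to 0 on a measurable null set containing the bad outcomes, which keeps each [X t]
    measurable. *)
Lemma regularize X : is_field P X -> exists2 X', regular_field X' &
  {ae P, forall w, forall t, X t w = X' t w}.
Proof.
move=> [mX [A [mA A0 sub]]].
exists (fun t w => \1_(~` A) w * X t w).
  split=> [t|w].
    apply: measurable_funM => //; apply: measurable_indic; exact: measurableC.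
  rewrite indicE; have [wA|wA] := boolP (w \in ~` A).
    apply: cont_pathM; first exact: cont_path_cst.
    apply: contrapT => nc; move: wA; rewrite inE /=; apply; exact: sub.
  by under eq_fun do rewrite mul0r; exact: cont_path_cst.
exists A; split=> // w /=; apply: contra_notP => wA t.
by rewrite indicE mem_set// mul1r.
Qed.

(** Coefficients and nodes are the same for all [f]; only thus can the approximation be applied to
    random paths. *)
Definition finitely_approximable O := forall t,
  exists (c : nat -> nat -> R) (q : nat -> nat -> vec), forall f, cont_path f ->
    (fun n => \sum_(j < n.+1) c n j * f (q n j)) @ \oo --> O f t.

Lemma regular_field_op O X : (forall f, cont_path f -> cont_path (O f)) ->
  finitely_approximable O -> regular_field X -> regular_field (fun t w => O (X^~ w) t).
Proof.
move=> cO aO [mX cX]; split=> [t|w]; last exact: cO.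
have [c [q H]] := aO t.
apply: (measurable_fun_cvg (h := fun n w => \sum_(j < n.+1) c n j * X (q n j) w)).
  by move=> n; apply: measurable_lincomb.
by move=> w _; exact: H.
Qed.

Definition same_fdd U V := forall (n : nat) (ts : 'I_n -> vec),
  same_law P (fun k => U (ts k)) (fun k => V (ts k)).

Lemma same_fdd_cdf U V (I : finType) (q : I -> vec) : same_fdd U V ->
  same_cdf P (fun i => U (q i)) (fun i => V (q i)).
Proof.
move=> H x; have := H #|I| (fun k => q (enum_val k)) (fun k => x (enum_val k)).
have E (W : field) : [set w | forall k : 'I_#|I|, W (q (enum_val k)) w <= x (enum_val k)] =
    [set w | forall i, W (q i) w <= x i].
  apply/seteqP; split=> w /= HW i; last exact: HW.
  by have := HW (enum_rank i); rewrite enum_rankK.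
by rewrite !E.
Qed.

(** The approximants at all points [ts k] are joint linear combinations of finitely many field
    values, so they agree in law; pointwise limits keep this. *)
Lemma same_fdd_op O U V : finitely_approximable O -> regular_field U -> regular_field V ->
  (forall f, cont_path f -> cont_path (O f)) ->
  same_fdd U V -> same_fdd (fun t w => O (U^~ w) t) (fun t w => O (V^~ w) t).
Proof.
move=> aO rU rV cO UV n ts.
have [mU cU] := rU; have [mV cV] := rV.
have [mOU _] := regular_field_op cO aO rU; have [mOV _] := regular_field_op cO aO rV.
have ex k : exists cq : (nat -> nat -> R) * (nat -> nat -> vec), forall f, cont_path f ->
    (fun n => \sum_(j < n.+1) cq.1 n j * f (cq.2 n j)) @ \oo --> O f (ts k).
  by have [c [q H]] := aO (ts k); exists (c, q).
have [cq Hcq] := choice ex.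
pose app (W : field) m (k : 'I_n) w := \sum_(j < m.+1) (cq k).1 m j * W ((cq k).2 m j) w.
have mapp (W : field) m k : (forall t, measurable_fun setT (W t)) -> measurable_fun setT (app W m k).
  by move=> mW; exact: measurable_lincomb.
apply: (@cvgp_same_cdf R _ _ P nat \oo _ 'I_n (app U) (app V)).
- by move=> m k; exact: mapp.
- by move=> m k; exact: mapp.
- by move=> k; exact: mOU.
- by move=> k; exact: mOV.
- move=> m.
  pose I : finType := ('I_n * 'I_m.+1)%type.
  pose c (k : 'I_n) (i : I) : R := if i.1 == k then (cq k).1 m i.2 else 0.
  have E (W : field) : app W m = (fun k w => \sum_(i : I) c k i * W ((cq i.1).2 m i.2) w).
    apply/funext => k; apply/funext => w.
    rewrite -(pair_big predT predT (fun k' j => c k (k', j) * W ((cq k').2 m j) w))/=.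
    rewrite (bigD1 k)//= [X in _ + X]big1 ?addr0 => [|k' k'k].
      by apply: eq_bigr => j _; rewrite /c eqxx.
    by apply: big1 => j _; rewrite /c/= (negbTE k'k) mul0r.
  rewrite !E; apply: same_cdf_lincomb => [i|i|].
  - exact: mU.
  - exact: mV.
  exact: (same_fdd_cdf (fun i : I => (cq i.1).2 m i.2) UV).
- by move=> k; apply: cvgp_pointwise => // [m|w]; [exact: mapp|exact: Hcq].
- by move=> k; apply: cvgp_pointwise => // [m|w]; [exact: mapp|exact: Hcq].
Qed.

Lemma Eop_approximable i (th : R) : finitely_approximable (lop i (eop th)).
Proof.
move=> t; pose tau := t i.
pose q (n j : nat) := upd i (tau * (j%:R / n%:R)) t.
(* Slot 0 carries the term outside the primitive; the slots from 1 on carry a Riemann sum with [n]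
   equal steps from 0 to [t i]. *)
exists (fun n j => if j is j'.+1 then - (th * (expR (th * (tau * (j'%:R / n%:R))) * (tau / n%:R))) else expR (th * tau)),
  (fun n j => if j is j'.+1 then q n j' else t) => f cf.
pose g y := expR (th * y i) * f y.
have cg : cont_path g.
  apply: cont_pathM => //; apply: (cont_path_comp (f := fun x => expR (th * x))).
    exact: continuous_expM.
  exact: cont_path_coord.
pose phi x := g (upd i x t).
have cphi : continuous phi by exact: cont_path_line.
pose p (n j : nat) := tau * (j%:R / n%:R).
rewrite (_ : (fun n => _) = (fun n => expR (th * tau) * f t - th * leb_sum n (p n) (p n) phi)); last first.
  apply/funext => n; rewrite big_ord_recl/=; congr (_ + _).
  rewrite /leb_sum mulr_sumr -sumrN; apply: eq_bigr => j _.
  rewrite /phi /g upd_same /p /q -natr1 mulrDl mul1r; ring.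
have E : lop i (eop th) f t = expR (th * tau) * f t - th * prim phi tau.
  rewrite /lop /eop upd_id; congr (_ - _ * prim _ _); apply/funext => x.
  by rewrite /phi /g upd_same.
rewrite E; apply: cvgB; first exact: cvg_cst.
apply: cvgM; first exact: cvg_cst.
apply/cvgrPdist_le => e e0.
pose K : R := \sum_j `|t j|.
have tK : inbox K t by exact: vec_inbox.
have K0 : 0 <= K by apply: sumr_ge0.
have K1 : 0 < 2 * K + 1 by rewrite ltr_wpDl// mulr_ge0.
have [dd d0 H] := cont_path_unif K cg (divr_gt0 e0 K1).
near=> n.
have n0 : (0 < n)%N by near: n; exists 1%N.
have n0' : 0 < n%:R :> R by rewrite ltr0n.
have step j : p n j.+1 - p n j = tau / n%:R.
  by rewrite /p -natr1; field; rewrite gt_eqF.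
have small : `|tau / n%:R| < dd.
  rewrite normrM normfV (gtr0_norm n0') ltr_pdivrMr// mulrC -ltr_pdivrMr//.
  by near: n; exists (Num.truncn (`|tau| / dd)).+1 => // m /= hm; apply: (lt_le_trans (truncnS_gt _)); rewrite ler_nat.
have gr : grid1 K dd 0 tau n (p n) (p n).
  split.
  - case: (leP 0 tau) => [tau0|/ltW tau0]; [left|right] => j _.
      by rewrite -subr_ge0 step divr_ge0.
    by rewrite -subr_le0 step pmulr_lle0 ?invr_gt0.
  - by rewrite /p mul0r mulr0 divff ?gt_eqF// mulr1.
  - by move=> j _; rewrite ge_min le_max lexx.
  - by move=> j _; rewrite step.
  - by rewrite normr0; split=> //; exact: tK.
have o0 : 0 <= e / (2 * K + 1) by rewrite divr_ge0// ltW.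
have := leb_sum_approx gr cphi o0 (line_modulus i H d0 tK).
rewrite prim0// subr0 distrC => h; apply: (le_trans h).
by rewrite -mulrA ler_piMr ?(ltW e0)// mulrC ler_pdivrMr// mul1r lerDl.
Unshelve. all: by end_near. Qed.

Lemma regular_field_Eall th l X : regular_field X -> regular_field (fun t w => Eall th l (X^~ w) t).
Proof.
move=> rX; elim: l => //= i l IH.
apply: (@regular_field_op (lop i (eop (th i))) (fun t w => Eall th l (X^~ w) t)) => //.
  by move=> f cf; apply: lop_cont => //; exact: line_op_eop.
exact: Eop_approximable.
Qed.

Lemma same_fdd_Eall th l U V : regular_field U -> regular_field V -> same_fdd U V ->
  same_fdd (fun t w => Eall th l (U^~ w) t) (fun t w => Eall th l (V^~ w) t).
Proof.
move=> rU rV UV; elim: l => //= i l IH.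
apply: (@same_fdd_op (lop i (eop (th i))) (fun t w => Eall th l (U^~ w) t) (fun t w => Eall th l (V^~ w) t)) => //.
- exact: Eop_approximable.
- exact: regular_field_Eall.
- exact: regular_field_Eall.
- by move=> f cf; apply: lop_cont => //; exact: line_op_eop.
Qed.

End random_fields.

Section rectangular_laws.
Context {R : realType} {N : nat} {d : measure_display} {Omega : measurableType d}.
Variable P : probability Omega R.
Notation vec := ('I_N -> R).
Notation field := (vec -> Omega -> R).
Implicit Types (X Y Z U V : field) (t s h a : vec).

Lemma rect_incr_sumE f s t :
  rect_incr f s t = \sum_(w : {set 'I_N}) (-1) ^+ #|w| * f (Defs.merge w s t).
Proof.
rewrite /rect_incr /incr_part; apply: eq_big => w; first by rewrite finset.subsetT.
by move=> _; congr (_ * f _); apply/funext => i; rewrite /Defs.merge inE.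
Qed.

Lemma rect_incr_degenerate i f s t : s i = t i -> rect_incr f s t = 0.
Proof.
move=> st; rewrite (rect_incrE _ _ _ s) (@incr_rem R N i) ?mem_enum// incr_cons.
by rewrite /dif st subrr.
Qed.

Lemma regular_field_rect Z s t : regular_field Z ->
  measurable_fun setT (fun w => rect_incr (Z^~ w) s t).
Proof.
move=> [mZ _]; under eq_fun do rewrite rect_incr_sumE.
exact: measurable_lincomb.
Qed.

Lemma cont_path_rect f a : cont_path f -> cont_path (fun t => rect_incr f a t).
Proof.
move=> cf; under eq_fun do rewrite rect_incr_sumE.
apply: cont_path_sum => w _; apply: cont_pathM; first exact: cont_path_cst.
apply: cont_path_map => // i; rewrite /Defs.merge.
by case: (i \in w); [exact: cont_path_cst|exact: cont_path_coord].
Qed.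

Lemma regular_field_rect_field Z a : regular_field Z ->
  regular_field (fun t w => rect_incr (Z^~ w) a t).
Proof.
move=> rZ; split=> [t|w]; first exact: regular_field_rect.
by apply: cont_path_rect; have [_] := rZ.
Qed.

Lemma same_fdd_rect U V (I : finType) (s t : I -> vec) :
  regular_field U -> regular_field V -> same_fdd P U V ->
  same_cdf P (fun i w => rect_incr (U^~ w) (s i) (t i)) (fun i w => rect_incr (V^~ w) (s i) (t i)).
Proof.
move=> [mU _] [mV _] UV.
pose J : finType := (I * {set 'I_N})%type.
pose c (i : I) (j : J) : R := if j.1 == i then (-1) ^+ #|j.2| else 0.
have E (W : field) : (fun i w => rect_incr (W^~ w) (s i) (t i)) =
   (fun i w => \sum_(j : J) c i j * W (Defs.merge j.2 (s j.1) (t j.1)) w).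
  apply/funext => i; apply/funext => w; rewrite rect_incr_sumE.
  rewrite -(pair_big predT predT (fun i' v => c i (i', v) * W (Defs.merge v (s i') (t i')) w))/=.
  rewrite (bigD1 i)//= [X in _ = _ + X]big1 ?addr0 => [|i' i'i].
    by apply: eq_bigr => v _; rewrite /c eqxx.
  by apply: big1 => v _; rewrite /c/= (negbTE i'i) mul0r.
rewrite !E; apply: same_cdf_lincomb => [j|j|]; [exact: mU|exact: mV|].
exact: (same_fdd_cdf (fun j : J => Defs.merge j.2 (s j.1) (t j.1)) UV).
Qed.

Lemma same_cdf_scale (I : finType) (A B : I -> Omega -> R) (c : I -> R) :
  (forall i, measurable_fun setT (A i)) -> (forall i, measurable_fun setT (B i)) ->
  same_cdf P A B -> same_cdf P (fun i w => c i * A i w) (fun i w => c i * B i w).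
Proof.
move=> mA mB AB.
have E (C : I -> Omega -> R) : (fun i w => c i * C i w) =
    (fun i w => \sum_j (if j == i then c i else 0) * C j w).
  apply/funext => i; apply/funext => w; rewrite (bigD1 i)//= eqxx big1 ?addr0// => j /negbTE ->.
  by rewrite mul0r.
by rewrite !E; exact: same_cdf_lincomb.
Qed.

Lemma regular_field_mul (c : vec -> R) Z : cont_path c -> regular_field Z ->
  regular_field (fun t w => c t * Z t w).
Proof.
move=> cc [mZ cZ]; split=> [t|w]; last by apply: cont_pathM => //; exact: cZ.
by apply: measurable_funM => //; exact: measurable_cst.
Qed.

Lemma regular_field_shift h Z : regular_field Z -> regular_field (fun t => Z (shiftv t h)).
Proof. by move=> [mZ cZ]; split=> [t|w]; [exact: mZ|exact: (cont_path_shift h (cZ w))]. Qed.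

Lemma regular_field_expmul th Z : regular_field Z -> regular_field (fun t w => expmul th (Z^~ w) t).
Proof.
move=> rZ; apply: (@regular_field_mul (fun t => expR (dotv th t))) => //.
by apply: (cont_path_comp (f := expR)); [exact: continuous_expR|exact: cont_path_dotv].
Qed.

Lemma same_fdd_mul (c : vec -> R) U V : regular_field U -> regular_field V -> same_fdd P U V ->
  same_fdd P (fun t w => c t * U t w) (fun t w => c t * V t w).
Proof.
move=> [mU _] [mV _] UV n ts.
by apply: (@same_cdf_scale 'I_n (fun k => U (ts k)) (fun k => V (ts k)) (fun k => c (ts k))) => [k|k|];
  [exact: mU|exact: mV|exact: UV].
Qed.

Lemma EallZ th l (c : R) f : cont_path f -> Eall th l (fun t => c * f t) = (fun t => c * Eall th l f t).
Proof.
move=> cf; elim: l => //= i l ->.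
have := lop_lin i c 0 (line_op_eop (th i)) (Eall_cont th l cf) (Eall_cont th l cf).
rewrite (_ : (fun t => c * _ + 0 * _) = (fun t => c * Eall th l f t)); last first.
  by apply/funext => t; rewrite mul0r addr0.
by move=> ->; apply/funext => t; rewrite mul0r addr0.
Qed.

Lemma dotvD th s h : dotv th (shiftv s h) = dotv th s + dotv th h.
Proof. by rewrite /dotv -big_split/=; apply: eq_bigr => i _; rewrite mulrDr. Qed.

Lemma dotv_merge th (w : {set 'I_N}) (b : R) t : dotv th (Defs.merge w (fun=> b) t) =
  b * \sum_(i in w) th i + \sum_(i | i \notin w) th i * t i.
Proof.
rewrite /dotv (bigID (mem w))/= mulr_sumr; congr (_ + _).
  by apply: eq_bigr => i iw; rewrite /Defs.merge iw mulrC.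
by apply: eq_bigr => i /negbTE iw; rewrite /Defs.merge iw.
Qed.

(** The translation factors of [expmul] and of the inverse Stieltjes operators are reciprocal. *)
Lemma rect_incr_Eall_expmul_shift th f s t h : cont_path f ->
  rect_incr (langevin_op th (fun x => f (shiftv x h))) s t =
  rect_incr (langevin_op th f) (shiftv s h) (shiftv t h).
Proof.
move=> cf; rewrite /langevin_op.
have -> : expmul th (fun x => f (shiftv x h)) =
    (fun x => expR (- dotv th h) * expmul th f (shiftv x h)).
  by apply/funext => x; rewrite /expmul dotvD mulrA -expRD; congr (expR _ * _); ring.
rewrite EallZ; last by apply: cont_path_shift; exact: expmul_cont.
rewrite rect_incrZ rect_incr_Eall_shift ?perm_rev//; last exact: expmul_cont.
rewrite mulrA -expRD (_ : _ + _ = 0) ?expR0 ?mul1r//.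
by rewrite /dotv -!sumrN -big_split/= big1// => i _; ring.
Qed.

(** By [lop_eop_mul] with exponent 1, the primitive is an [eop] of an exponential multiple of [Z]
    minus [Z] itself, so the approximation already made for [eop] gives measurability. *)
Lemma regular_field_lop_prim i Z : regular_field Z ->
  regular_field (fun t w => lop i (@prim R) (Z^~ w) t).
Proof.
move=> rZ; have [mZ cZ] := rZ.
have ce : cont_path (fun t : vec => expR (1 * t i)).
  apply: (cont_path_comp (f := fun x => expR (1 * x))); first exact: continuous_expM.
  exact: cont_path_coord.
have rE := regular_field_mul ce rZ.
have [mE _] := @regular_field_op R N d Omega (lop i (eop (- 1))) _
  (fun f cf => lop_cont i (line_op_eop (- 1)) cf) (Eop_approximable i (- 1)) rE.
split=> [t|w]; last by apply: lop_cont => //; exact: line_op_prim.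
rewrite (_ : (fun w => _) = (fun w =>
    lop i (eop (- 1)) (fun s => expR (1 * s i) * Z s w) t - Z t w)).
  exact: measurable_funB.
apply/funext => w; rewrite (@lop_eop_mul _ _ i 1 (Z^~ w))//.
by rewrite mul1r addrC addKr.
Qed.

Lemma regular_field_Qall l Z : regular_field Z -> regular_field (fun t w => Qall l (Z^~ w) t).
Proof.
move=> rZ; elim: l => //= i l IH.
have [m1 c1] := regular_field_lop_prim i IH.
split=> [t|w]; last by apply: Qop_cont; have [_] := IH.
exact: (measurable_funB (m1 t) (m1 (upd i (t i - tot t) t))).
Qed.

Lemma regular_field_noise th Z : regular_field Z ->
  regular_field (fun t w => regular_noise_path th (Z^~ w) t).
Proof.
move=> rZ; have [mZ cZ] := rZ; split=> [t|w]; last exact: regular_noise_path_cont.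
apply: measurable_funD.
  apply: measurable_funB => //; apply: measurable_funM; first exact: measurable_cst.
  have := @measurable_lincomb _ _ R _ (index_enum 'I_N) (fun=> 1) _ (fun l => mZ (upd l (t l - tot t) t)).
  by under eq_fun do under eq_bigr do rewrite mul1r.
rewrite (_ : (fun w => _) = (fun w => \sum_(v : {set 'I_N})
   (if v != finset.set0 then \prod_(j in v) th j else 0) *
     Qall [seq i <- rev (enum 'I_N) | i \in v] (Z^~ w) t)).
  by apply: measurable_lincomb => v; have [m _] := regular_field_Qall [seq i <- rev (enum 'I_N) | i \in v] rZ.
apply/funext => w; rewrite big_mkcond; apply: eq_bigr => v _.
by case: ifP => // _; rewrite mul0r.
Qed.

End rectangular_laws.

(** * Stationary fields and their noise *)

Section stationary_to_noise.
Context {R : realType} {N : nat} {d : measure_display} {Omega : measurableType d}.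
Variable P : probability Omega R.
Notation vec := ('I_N -> R).
Notation field := (vec -> Omega -> R).
Implicit Types (X Y Z U V : field) (t h a th : vec) (f : vec -> R).

Definition stationary_fdd Z := forall h, same_fdd P (fun t => Z (shiftv t h)) Z.

Definition noise th Z : field := fun t w => regular_noise_path th (Z^~ w) t.

Lemma stationary_ae X Z : (forall t, measurable_fun setT (X t)) -> regular_field Z ->
  {ae P, forall w, forall t, X t w = Z t w} -> stationary P X -> stationary_fdd Z.
Proof.
move=> mX [mZ _] XZ sX h n ts.
have ae_at t : {ae P, forall w, X t w = Z t w} by apply: filterS XZ => w; apply.
apply: (@same_cdf_trans _ _ _ P 'I_n _ (fun k => X (shiftv (ts k) h))).
  apply: same_cdf_sym; apply: same_cdf_ae => k; [exact: mX|exact: mZ|exact: ae_at].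
apply: (@same_cdf_trans _ _ _ P 'I_n _ (fun k => X (ts k))); first exact: sX.
by apply: same_cdf_ae => k; [exact: mX|exact: mZ|exact: ae_at].
Qed.

(** The noise is tied to a fixed hyperplane and is not translation covariant, but its increments are
    those of [langevin_op], which commutes with translations at the level of increments. *)
Lemma noise_stat_incr th Z : regular_field Z -> stationary_fdd Z -> stat_incr P (noise th Z).
Proof.
move=> rZ sZ n h s t; have [mZ cZ] := rZ.
have rS := regular_field_shift h rZ.
have rE := regular_field_expmul th rZ.
have rES := regular_field_expmul th rS.
have H : same_fdd P (fun t w => langevin_op th (fun x => Z (shiftv x h) w) t)
    (fun t w => langevin_op th (Z^~ w) t).
  apply: (@same_fdd_Eall _ _ _ _ P _ _ (fun t w => expmul th (fun x => Z (shiftv x h) w) t)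
    (fun t w => expmul th (Z^~ w) t)) => //.
  exact: (@same_fdd_mul _ _ _ _ P (fun t => expR (dotv th t)) _ _ rS rZ (sZ h)).
have := @same_fdd_rect _ _ _ _ P _ _ 'I_n s t (regular_field_Eall _ _ rES) (regular_field_Eall _ _ rE) H.
congr (same_cdf P _ _); apply/funext => k; apply/funext => w.
  rewrite /noise rect_incr_noise_path//.
  exact: (rect_incr_Eall_expmul_shift th (s k) (t k) h (cZ w)).
by rewrite /noise rect_incr_noise_path.
Qed.

Lemma cvgp_cst_fun (T : Type) (F : set_system T) {FF : Filter F} (L : Omega -> R) :
  cvgp P F (fun=> L) L.
Proof.
move=> eps eta eps0 eta0; apply: nearW => _.
have -> : [set w : Omega | (eps <= `|L w - L w|)%R] = set0.
  by apply/seteqP; split=> w //=; rewrite subrr normr0 leNgt eps0.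
by rewrite measure0 lee_fin ltW.
Qed.

(** By stationarity the value of [Z] at the moving corner has the law of [Z] at 0, while the weight
    decays like [expR (- (c * s))]; [c] is positive because [v] is nonempty. *)
Lemma expmul_vanish th Z (v : {set 'I_N}) t : (forall i, 0 < th i) -> v != finset.set0 ->
  regular_field Z -> stationary_fdd Z ->
  cvgp P (+oo : set_system R) (fun s w => expmul th (Z^~ w) (Defs.merge v (fun=> - s) t)) (fun=> 0).
Proof.
move=> th0 v0 [mZ cZ] sZ.
pose c := \sum_(i in v) th i; pose b := \sum_(i | i \notin v) th i * t i.
have c0 : 0 < c.
  have [i iv] := set0Pn _ v0; rewrite /c (bigD1 i)//= ltr_pwDl// sumr_ge0// => j _.
  exact: ltW.
pose z := @zerov R N.
have H1 : cvgp P (+oo : set_system R) (fun s w => expR (- (c * s)) * Z z w) (fun=> 0).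
  by apply: cvgp_decay => //; exact: cvgp_cst_fun.
have H2 : cvgp P (+oo : set_system R)
    (fun s w => expR (- (c * s)) * Z (Defs.merge v (fun=> - s) t) w) (fun=> 0).
  apply: cvgp_same_law H1 => [s|s|s].
  - by apply: measurable_funM => //; exact: measurable_cst.
  - by apply: measurable_funM => //; exact: measurable_cst.
  apply: (@same_cdf_scale _ _ _ P 'I_1 (fun=> Z z) (fun=> Z (Defs.merge v (fun=> - s) t))
    (fun=> expR (- (c * s)))) => //.
  apply: same_cdf_sym.
  have := sZ (Defs.merge v (fun=> - s) t) 1%N (fun=> z).
  rewrite (_ : shiftv z _ = Defs.merge v (fun=> - s) t)//.
  by apply/funext => i; rewrite /shiftv /z /zerov add0r.
have := @cvgp_scale _ _ _ P _ _ _ _ _ (expR b) H2.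
rewrite mulr0 => H3.
suff -> : (fun (s : R) w => expmul th (Z^~ w) (Defs.merge v (fun=> - s) t)) =
  (fun s w => expR b * (expR (- (c * s)) * Z (Defs.merge v (fun=> - s) t) w)) by exact: H3.
apply/funext => s; apply/funext => w.
by rewrite /expmul dotv_merge mulrA -expRD; congr (expR _ * _); rewrite -/c -/b; ring.
Qed.

(** The integral over the box is the alternating sum of [expmul th Z] over its corners, and all
    corners but [t] vanish in the limit. *)
Lemma noise_expint_lim th Z t : (forall i, 0 < th i) -> regular_field Z -> stationary_fdd Z ->
  expint_lim P th (noise th Z) t (fun w => expR (dotv th t) * Z t w).
Proof.
move=> th0 rZ sZ; have [mZ cZ] := rZ.
have rE := regular_field_expmul th rZ; have [mE cE] := rE.
split; first by apply: measurable_funM => //; exact: measurable_cst.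
pose J (s : R) w := rect_incr (expmul th (Z^~ w)) (fun=> - s) t.
have mJ s : measurable_fun setT (J s) by exact: (regular_field_rect (fun=> - s) t rE).
exists J; split; first exact: mJ.
split.
  move=> s; apply: aeW => w; rewrite /J -(Eall_noise_path th (fun=> - s) t (cZ w)).
  by apply: RSint_exp; exact: regular_noise_path_cont.
have mL : measurable_fun setT (fun w => expR (dotv th t) * Z t w).
  by apply: measurable_funM => //; exact: measurable_cst.
have FF : Filter (+oo : set_system R) by typeclasses eauto.
apply: (proj1 (@cvgpP R d Omega P R (+oo : set_system R) FF J _ mJ mL)).
have H := @cvgp_lincomb R d Omega P R (+oo : set_system R) FF {set 'I_N} (index_enum _)
  (fun v => (-1) ^+ #|v|) (fun v s w => expmul th (Z^~ w) (Defs.merge v (fun=> - s) t))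
  (fun v => if v == finset.set0 then (fun w => expmul th (Z^~ w) t) else (fun=> 0)).
have {}H := H (fun v s => mE _).
have -> : J = (fun s w => \sum_(v : {set 'I_N}) (-1) ^+ #|v| * expmul th (Z^~ w) (Defs.merge v (fun=> - s) t)).
  by apply/funext => s; apply/funext => w; rewrite /J rect_incr_sumE.
have -> : (fun w => expR (dotv th t) * Z t w) = (fun w => \sum_(v : {set 'I_N}) (-1) ^+ #|v| *
    (if v == finset.set0 then (fun w => expmul th (Z^~ w) t) else (fun=> 0)) w).
  apply/funext => w; rewrite (bigD1 finset.set0)//= eqxx cards0 expr0 mul1r big1 ?addr0//.
  by move=> v /negbTE ->; rewrite mulr0.
apply: H => v; first by case: ifP => _; [exact: mE|exact: measurable_cst].
case: eqVneq => [->|v0]; last exact: expmul_vanish.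
have -> : (fun s w => expmul th (Z^~ w) (Defs.merge finset.set0 (fun=> - s) t)) =
   (fun _ : R => fun w => expmul th (Z^~ w) t).
  apply/funext => s; apply/funext => w; congr expmul; apply/funext => i.
  by rewrite /Defs.merge inE.
exact: cvgp_cst_fun.
Qed.

End stationary_to_noise.

(** * From stationary increments back to a stationary field *)

Section noise_to_stationary.
Context {R : realType} {N : nat} {d : measure_display} {Omega : measurableType d}.
Variable P : probability Omega R.
Notation vec := ('I_N -> R).
Notation field := (vec -> Omega -> R).
Implicit Types (X Y Z U V G H : field) (t h a th : vec) (f : vec -> R).

Definition exp_field th H : field := fun t w => Eall th (enum 'I_N) (H^~ w) t.

Lemma regular_exp_field th H : regular_field H -> regular_field (exp_field th H).
Proof. exact: regular_field_Eall. Qed.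

(* Pathwise this is the integral of e^(th . u) dH(u) over the box from (-s, ..., -s) to t. *)
Definition corner_incr th H (t : vec) (s : R) : Omega -> R :=
  fun w => rect_incr ((exp_field th H)^~ w) (fun=> - s) t.

Lemma expint_lim_cvgp th G H t (L : Omega -> R) : regular_field H ->
  {ae P, forall w, forall t, G t w = H t w} -> expint_lim P th G t L ->
  cvgp P (+oo : set_system R) (corner_incr th H t) L.
Proof.
move=> rH GH [mL [J [mJ [HJ cJ]]]].
have FF : Filter (+oo : set_system R) by typeclasses eauto.
have mC s : measurable_fun setT (corner_incr th H t s).
  exact: (regular_field_rect _ _ (regular_exp_field th rH)).
have cvgJ : cvgp P (+oo : set_system R) J L.
  exact: (proj2 (@cvgpP R d Omega P R (+oo : set_system R) FF J _ mJ mL)).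
apply: (@cvgp_ae R d Omega P R (+oo : set_system R) FF J _ L L) => // [s|]; last exact: aeW.
apply: filterS2 (HJ s) GH => w HI Ew.
have -> : J s w = corner_incr th H t s w; last by [].
have [_ cH] := rH; have HI' := RSint_exp th (fun=> - s) t (cH w).
have Ew' : (fun x => G x w) = (H^~ w) by apply/funext => x; exact: Ew.
by rewrite Ew' in HI; exact: RSint_unique HI HI'.
Qed.

Lemma stat_incr_regular G H : (forall t, measurable_fun setT (G t)) -> regular_field H ->
  {ae P, forall w, forall t, G t w = H t w} -> stat_incr P G -> stat_incr P H.
Proof.
move=> mG rH GH sG n h s t; have [mH _] := rH.
have mr (Z : field) (u v : vec) : (forall t, measurable_fun setT (Z t)) ->
    measurable_fun setT (fun w => rect_incr (Z^~ w) u v).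
  by move=> mZ; under eq_fun do rewrite rect_incr_sumE; exact: measurable_lincomb.
have ae_at u v : {ae P, forall w, rect_incr (G^~ w) u v = rect_incr (H^~ w) u v}.
  apply: filterS GH => w Ew; congr (rect_incr _ u v).
  by apply/funext => x; exact: Ew.
apply: (@same_cdf_trans _ _ _ P 'I_n _
  (fun k w => rect_incr (G^~ w) (shiftv (s k) h) (shiftv (t k) h))).
  by apply: same_cdf_sym; apply: same_cdf_ae => k; [exact: mr|exact: mr|exact: ae_at].
apply: (@same_cdf_trans _ _ _ P 'I_n _ (fun k w => rect_incr (G^~ w) (s k) (t k))); first exact: sG.
by apply: same_cdf_ae => k; [exact: mr|exact: mr|exact: ae_at].
Qed.

Lemma rect_incr_Eall_cut th f a t : cont_path f ->
  rect_incr (Eall th (enum 'I_N) (fun x => rect_incr f a x)) a t = rect_incr (Eall th (enum 'I_N) f) a t.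
Proof.
move=> cf; have cU := cont_path_rect a cf.
have := @Eall_congr R N th (enum 'I_N) _ _ cU cf _ a t.
rewrite rect_incrB => HH; apply/eqP; rewrite -subr_eq0; apply/eqP; apply: HH => s' t'.
by rewrite rect_incrB rect_incr_cut subrr.
Qed.

(** Stationary increments say nothing about values of [H]. So [H] is replaced by its increments from
    [a], whose finite-dimensional laws are known and which have the same [exp_field] increments. *)
Lemma exp_field_law th H h a (I : finType) (ts : I -> vec) : regular_field H -> stat_incr P H ->
  same_cdf P (fun k w => expR (- dotv th h) *
      rect_incr ((exp_field th H)^~ w) (shiftv a h) (shiftv (ts k) h))
    (fun k w => rect_incr ((exp_field th H)^~ w) a (ts k)).
Proof.
move=> rH sH; have [mH cH] := rH.
pose U : field := fun t w => rect_incr (H^~ w) a t.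
pose V : field := fun t w => rect_incr (fun x => H (shiftv x h) w) a t.
have rU : regular_field U by exact: regular_field_rect_field.
have rV : regular_field V by exact: (regular_field_rect_field a (regular_field_shift h rH)).
have VU : same_fdd P V U.
  move=> n us; have := sH n h (fun=> a) us; congr (same_cdf P _ _).
  apply/funext => k; apply/funext => w.
  by rewrite /V (rect_incr_shift (H^~ w)).
have := @same_fdd_rect _ _ _ _ P _ _ I (fun=> a) ts (regular_field_Eall th (enum 'I_N) rV)
  (regular_field_Eall th (enum 'I_N) rU) (same_fdd_Eall th (enum 'I_N) rV rU VU).
congr (same_cdf P _ _); apply/funext => k; apply/funext => w.
  rewrite (@rect_incr_Eall_cut th (fun x => H (shiftv x h) w)); last exact: (cont_path_shift h (cH w)).
  by rewrite (rect_incr_Eall_shift th h _ _ (cH w)).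
by rewrite (@rect_incr_Eall_cut th (H^~ w)).
Qed.

(* Shifting by r in the coordinates of v gains the factor e^(- r sum_v th) and leaves a box whose v-sides are fixed. *)
Lemma corner_incr_strip th H h t (L : field) (v : {set 'I_N}) : (forall i, 0 < th i) ->
  regular_field H -> stat_incr P H ->
  (forall t, measurable_fun setT (L t)) ->
  (forall t, cvgp P (+oo : set_system R) (corner_incr th H t) (L t)) -> v != finset.set0 ->
  cvgp P (+oo : set_system R)
    (fun r => corner_incr th H (Defs.merge v (shiftv (fun=> - r) h) t) r) (fun=> 0).
Proof.
move=> th0 rH sH mL cL v0.
have FF : Filter (+oo : set_system R) by typeclasses eauto.
have rW := regular_exp_field th rH; have [mW cW] := rW.
have mC t' s : measurable_fun setT (corner_incr th H t' s) by exact: regular_field_rect.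
pose c := \sum_(i in v) th i.
have c0 : 0 < c.
  have [i iv] := set0Pn _ v0; rewrite /c (bigD1 i)//= ltr_pwDl// sumr_ge0// => j _.
  exact: ltW.
pose z := @zerov R N.
(* The shift [k r] carries the box from [a' r] to [t'], whose sides in [v] go from 0 to [h], onto
   the strip from [-r] in question. *)
pose t' := Defs.merge v h t.
pose a' (r : R) := Defs.merge v z (fun=> - r).
pose k (r : R) := Defs.merge v (fun=> - r) z.
have dk r : dotv th (k r) = - (c * r).
  rewrite dotv_merge [X in _ + X]big1 ?addr0; first by rewrite -/c; ring.
  by move=> i _; rewrite /z /zerov mulr0.
(* Expanding the box from the corner [-r], a set [u] that leaves [v] gives a box with a side of
   length 0, so only subsets of [v] survive. *)
have fixed r w : rect_incr ((exp_field th H)^~ w) (a' r) t' =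
    \sum_(u : {set 'I_N}) (if u \subset v then (-1) ^+ #|u| else 0) *
       corner_incr th H (Defs.merge u z t') r w.
  rewrite -(rect_incr_cut _ (fun=> - r)) rect_incr_sumE; apply: eq_bigr => u _.
  case: ifPn => [uv|nuv].
    congr (_ * rect_incr _ _ _); apply/funext => i; rewrite /a' /Defs.merge.
    by case: (boolP (i \in u)) => // iu; rewrite (fintype.subsetP uv _ iu).
  have [i iu iv] := subsetPn nuv.
  rewrite (@rect_incr_degenerate _ _ i) ?mulr0 ?mul0r//.
  by rewrite /a' /Defs.merge iu (negbTE iv).
have cfix : cvgp P (+oo : set_system R)
    (fun r w => rect_incr ((exp_field th H)^~ w) (a' r) t')
    (fun w => \sum_(u : {set 'I_N}) (if u \subset v then (-1) ^+ #|u| else 0) * L (Defs.merge u z t') w).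
  rewrite (_ : (fun r w => _) = (fun r w => \sum_(u : {set 'I_N})
     (if u \subset v then (-1) ^+ #|u| else 0) * corner_incr th H (Defs.merge u z t') r w)); last first.
    by apply/funext => r; apply/funext => w; exact: fixed.
  apply: (@cvgp_lincomb R d Omega P R (+oo : set_system R) FF {set 'I_N} (index_enum _)
    (fun u => if u \subset v then (-1) ^+ #|u| else 0)
    (fun u r => corner_incr th H (Defs.merge u z t') r) (fun u => L (Defs.merge u z t'))) => //.
have mfix r : measurable_fun setT (fun w => rect_incr ((exp_field th H)^~ w) (a' r) t').
  exact: regular_field_rect.
have mS : measurable_fun setT (fun w => \sum_(u : {set 'I_N})
    (if u \subset v then (-1) ^+ #|u| else 0) * L (Defs.merge u z t') w).
  by apply: measurable_lincomb => u; exact: mL.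
have cdec := cvgp_decay mfix mS c0 cfix.
apply: cvgp_same_law cdec => [r|r|r].
- by apply: measurable_funM => //; exact: measurable_cst.
- exact: mC.
have := @exp_field_law th H (k r) (a' r) 'I_1 (fun=> t') rH sH.
have E1 : shiftv (a' r) (k r) = (fun=> - r).
  by apply/funext => i; rewrite /shiftv /a' /k /Defs.merge /z /zerov; case: ifP => _; rewrite ?add0r ?addr0.
have E2 : shiftv t' (k r) = Defs.merge v (shiftv (fun=> - r) h) t.
  by apply/funext => i; rewrite /shiftv /t' /k /Defs.merge /z /zerov; case: ifP => _; rewrite ?addr0 1?addrC.
rewrite E1 E2 dk opprK => law.
have := @same_cdf_scale _ _ _ P 'I_1 _ _ (fun=> expR (- (c * r))) _ _ law.
move=> law2; apply: same_cdf_sym.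
have {}law2 := law2 (fun _ => measurable_funM (@measurable_cst _ _ _ _ _ _) (regular_field_rect _ _ rW))
   (fun _ => mfix r).
move: law2; congr (same_cdf P _ _); apply/funext => i; apply/funext => w.
by rewrite mulrA -expRD addNr expR0 mul1r.
Qed.

(** The displaced corner is expanded into boxes starting at [-r]: the empty set gives the original
    box, and every other set a strip with negligible contribution. *)
Lemma corner_incr_shift th H h t (L : field) : (forall i, 0 < th i) ->
  regular_field H -> stat_incr P H ->
  (forall t, measurable_fun setT (L t)) ->
  (forall t, cvgp P (+oo : set_system R) (corner_incr th H t) (L t)) ->
  cvgp P (+oo : set_system R)
    (fun r w => rect_incr ((exp_field th H)^~ w) (shiftv (fun=> - r) h) t) (L t).
Proof.
move=> th0 rH sH mL cL.
have FF : Filter (+oo : set_system R) by typeclasses eauto.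
have mC t' s : measurable_fun setT (corner_incr th H t' s).
  by apply: regular_field_rect; exact: regular_exp_field.
rewrite (_ : (fun r w => _) = (fun r w => \sum_(v : {set 'I_N}) (-1) ^+ #|v| *
    corner_incr th H (Defs.merge v (shiftv (fun=> - r) h) t) r w)); last first.
  apply/funext => r; apply/funext => w.
  by rewrite -(rect_incr_cut _ (fun=> - r)) rect_incr_sumE.
have -> : L t = (fun w => \sum_(v : {set 'I_N}) (-1) ^+ #|v| *
    (if v == finset.set0 then L t else (fun=> 0)) w).
  apply/funext => w; rewrite (bigD1 finset.set0)//= eqxx cards0 expr0 mul1r big1 ?addr0//.
  by move=> v /negbTE ->; rewrite mulr0.
apply: (@cvgp_lincomb R d Omega P R (+oo : set_system R) FF {set 'I_N} (index_enum _)
    (fun v => (-1) ^+ #|v|)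
    (fun v r => corner_incr th H (Defs.merge v (shiftv (fun=> - r) h) t) r)
    (fun v => if v == finset.set0 then L t else (fun=> 0))) => // v.
  by case: ifP => _; [exact: mL|exact: measurable_cst].
case: eqVneq => [->|v0]; last exact: corner_incr_strip mL cL v0.
rewrite (_ : (fun r => _) = corner_incr th H t)//.
apply/funext => r; congr (corner_incr th H _ r); apply/funext => i.
by rewrite /Defs.merge inE.
Qed.

(** For each [r], the box whose two corners are moved by [h] and the unmoved one have equal weighted
    laws. Both converge as [r] grows, the moved one by [corner_incr_shift]. *)
Lemma stationary_of_limits th X H (L : field) : (forall i, 0 < th i) ->
  (forall t, measurable_fun setT (X t)) -> regular_field H -> stat_incr P H ->
  (forall t, measurable_fun setT (L t)) ->
  (forall t, cvgp P (+oo : set_system R) (corner_incr th H t) (L t)) ->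
  (forall t, {ae P, forall w, X t w = expR (- dotv th t) * L t w}) ->
  stationary P X.
Proof.
move=> th0 mX rH sH mL cL XL h n ts.
have FF : ProperFilter (+oo : set_system R) by typeclasses eauto.
have rW := regular_exp_field th rH.
have mEL t : measurable_fun setT (fun w => expR (- dotv th t) * L t w).
  by apply: measurable_funM => //; exact: measurable_cst.
pose A (r : R) (k : 'I_n) w := expR (- dotv th (shiftv (ts k) h)) *
  rect_incr ((exp_field th H)^~ w) (shiftv (fun=> - r) h) (shiftv (ts k) h).
pose B (r : R) (k : 'I_n) w := expR (- dotv th (ts k)) * corner_incr th H (ts k) r w.
have mA r k : measurable_fun setT (A r k).
  by apply: measurable_funM; [exact: measurable_cst|exact: regular_field_rect].
have mB r k : measurable_fun setT (B r k).
  by apply: measurable_funM; [exact: measurable_cst|exact: regular_field_rect].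
have AB r : same_cdf P (A r) (B r).
  have law := @exp_field_law th H h (fun=> - r) 'I_n ts rH sH.
  have := @same_cdf_scale _ _ _ P 'I_n _ _ (fun k => expR (- dotv th (ts k))) _ _ law.
  move=> /(_ (fun _ => measurable_funM (@measurable_cst _ _ _ _ _ _) (regular_field_rect _ _ rW))).
  move=> /(_ (fun _ => regular_field_rect _ _ rW)); congr (same_cdf P _ _).
  apply/funext => k; apply/funext => w; rewrite /A mulrA -expRD dotvD.
  by congr (expR _ * _); ring.
have lim : same_cdf P (fun k w => expR (- dotv th (shiftv (ts k) h)) * L (shiftv (ts k) h) w)
    (fun k w => expR (- dotv th (ts k)) * L (ts k) w).
  apply: (@cvgp_same_cdf R d Omega P R (+oo : set_system R) FF 'I_n A B) => // k.
    apply: cvgp_scale; exact: corner_incr_shift.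
  by apply: cvgp_scale; exact: cL.
apply: (@same_cdf_trans _ _ _ P 'I_n _ (fun k w => expR (- dotv th (shiftv (ts k) h)) * L (shiftv (ts k) h) w)).
  by apply: same_cdf_ae => k //; exact: XL.
apply: (same_cdf_trans lim); apply: same_cdf_sym.
by apply: same_cdf_ae => k //; exact: XL.
Qed.

Lemma ae_forall_countable (T : countType) (Q : T -> Omega -> Prop) :
  (forall q, {ae P, forall w, Q q w}) -> {ae P, forall w, forall q, Q q w}.
Proof.
move=> H.
have : {ae P, forall w, forall n : nat, if unpickle n is Some q then Q q w else True}.
  by apply: ae_foralln => n; case: (unpickle n) => [q|]; [exact: H|exact: aeW].
by apply: filterS => w Hw q; have := Hw (pickle q); rewrite pickleK.
Qed.

(** Reduces almost sure identities of continuous paths to countably many points. *)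
Lemma cont_path_rat0 f : cont_path f ->
  (forall q : {ffun 'I_N -> rat}, f (fun i => ratr (q i)) = 0) -> forall t, f t = 0.
Proof.
move=> cf f0 t; apply/eqP; rewrite -normr_le0 leNgt; apply/negP => e0.
have [dd d0 H] := cf t _ e0.
have ex i : exists q : rat, `|ratr q - t i| < dd.
  have lt2 : t i - dd < t i + dd by lra.
  have [q] := rat_in_itvoo lt2; rewrite in_itv/= => qi.
  by exists q; rewrite ltr_norml; lra.
have [q Hq] := choice ex.
have := H (fun i => ratr ([ffun i => q i] i)).
rewrite f0 sub0r normrN ltxx => HH; have : false by apply: HH => i; rewrite ffunE; exact: Hq.
by [].
Qed.

(** Increments of [exp_field th H] from 0 to [t] are alternating sums of the limits [L] at corners,
    and [L] is [expmul th Z] almost surely. Inverting the Stieltjes operators then compares [H] with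
    the noise of [Z]. *)
Lemma limits_determine_noise th Z H (L : field) : regular_field Z -> regular_field H ->
  (forall t, measurable_fun setT (L t)) ->
  (forall t, cvgp P (+oo : set_system R) (corner_incr th H t) (L t)) ->
  (forall t, {ae P, forall w, Z t w = expR (- dotv th t) * L t w}) ->
  {ae P, forall w, null (fun t => noise th Z t w - H t w)}.
Proof.
move=> rZ rH mL cL ZL; have [mZ cZ] := rZ; have [mH cH] := rH.
have FF : ProperFilter (+oo : set_system R) by typeclasses eauto.
have rW := regular_exp_field th rH; have rY := regular_field_expmul th rZ.
pose z := @zerov R N.
have at_point t : {ae P, forall w,
    rect_incr ((exp_field th H)^~ w) z t = rect_incr (expmul th (Z^~ w)) z t}.
  pose S w := \sum_(v : {set 'I_N}) (-1) ^+ #|v| * L (Defs.merge v z t) w.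
  have mS : measurable_fun setT S by exact: measurable_lincomb.
  have mC t' s : measurable_fun setT (corner_incr th H t' s) by exact: regular_field_rect.
  (* The family is constant in [r]; rewritten as a combination of increments from [-r] it converges
     to [S], so uniqueness of limits gives the identity. *)
  have c1 : cvgp P (+oo : set_system R) (fun _ w => rect_incr ((exp_field th H)^~ w) z t) S.
    rewrite (_ : (fun _ w => _) = (fun (r : R) w => \sum_(v : {set 'I_N}) (-1) ^+ #|v| *
        corner_incr th H (Defs.merge v z t) r w)); last first.
      apply/funext => r; apply/funext => w.
      by rewrite -(rect_incr_cut _ (fun=> - r)) rect_incr_sumE.
    exact: (@cvgp_lincomb R d Omega P R (+oo : set_system R) _ {set 'I_N} (index_enum _)
      (fun v => (-1) ^+ #|v|) (fun v r => corner_incr th H (Defs.merge v z t) r)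
      (fun v => L (Defs.merge v z t))).
  have mI : measurable_fun setT (fun w => rect_incr ((exp_field th H)^~ w) z t).
    exact: regular_field_rect.
  have e1 : {ae P, forall w, rect_incr ((exp_field th H)^~ w) z t = S w}.
    exact: (@cvgp_unique R d Omega P R (+oo : set_system R) FF _ _ _ (fun=> mI) mI mS
      (cvgp_cst_fun _ _) c1).
  have e2 : {ae P, forall w, forall v : {set 'I_N},
      Z (Defs.merge v z t) w = expR (- dotv th (Defs.merge v z t)) * L (Defs.merge v z t) w}.
    by apply: ae_forall_countable => v; exact: ZL.
  apply: filterS2 e1 e2 => w -> h2; rewrite rect_incr_sumE; apply: eq_bigr => v _.
  by rewrite /expmul h2 mulrA -expRD addrN expR0 mul1r.
have := ae_forall_countable (fun q : {ffun 'I_N -> rat} => at_point (fun i => ratr (q i))).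
apply: filterS => w Hw.
have cY : cont_path (expmul th (Z^~ w)) by exact: expmul_cont.
have cWw : cont_path (Eall th (enum 'I_N) (H^~ w)) by exact: Eall_cont.
have n1 : null (fun t => Eall th (enum 'I_N) (H^~ w) t - expmul th (Z^~ w) t).
  apply: (@null_base _ _ z) => t.
  apply: (@cont_path_rat0 (fun t => rect_incr (fun t => Eall th (enum 'I_N) (H^~ w) t - expmul th (Z^~ w) t) z t)).
    by apply: cont_path_rect; exact: cont_pathB.
  by move=> q; rewrite rect_incrB (Hw q) subrr.
have n2 := proj2 (langevin_op_null th (cZ w) (cH w)) n1.
have n3 := null_noise_path th (cZ w).
have := nullB n3 n2; congr null; apply/funext => t.
by rewrite /noise; ring.
Qed.

End noise_to_stationary.

(** * Representation and uniqueness *)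

Section representation.
Context {R : realType} {N : nat} {d : measure_display} {Omega : measurableType d}.
Variable P : probability Omega R.
Notation vec := ('I_N -> R).
Notation field := (vec -> Omega -> R).
Implicit Types (X Y Z G H : field) (t h th : vec).

Lemma represents_limits th X G H : regular_field H ->
  {ae P, forall w, forall t, G t w = H t w} -> represents P th X G ->
  exists L : field, [/\ forall t, measurable_fun setT (L t),
    forall t, cvgp P (+oo : set_system R) (corner_incr th H t) (L t) &
    forall t, {ae P, forall w, X t w = expR (- dotv th t) * L t w}].
Proof.
move=> rH GH rep; have [L HL] := choice rep; exists L; split=> t.
- by have [[]] := HL t.
- by have [h _] := HL t; exact: expint_lim_cvgp h.
- by have [] := HL t.
Qed.

Lemma stationary_of_represents th X G : (forall i, 0 < th i) ->
  (forall t, measurable_fun setT (X t)) -> GTheta P th G -> represents P th X G ->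
  stationary P X.
Proof.
move=> th0 mX [fG sG _] rep.
have [H rH GH] := regularize fG.
have [L [mL cL XL]] := represents_limits rH GH rep.
have sH := stat_incr_regular fG.1 rH GH sG.
exact: stationary_of_limits th0 mX rH sH mL cL XL.
Qed.

(** Nullity on the box from 0 to [t] expresses the difference at [t] through its values with some
    coordinates set to 0, which are functions of the remaining coordinates. *)
Lemma equivG_of_null G Z th : (0 < N)%N ->
  {ae P, forall w, null (fun t => noise th Z t w - G t w)} ->
  {ae P, forall w, forall t, \sum_(i < N) t i = 0 -> G t w = 0} ->
  {ae P, forall w, forall t, \sum_(i < N) t i = 0 -> noise th Z t w = 0} ->
  equivG P G (noise th Z).
Proof.
move=> N0 nD G0 Z0; pose z := @zerov R N.
pose D t w := noise th Z t w - G t w.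
pose f (v : {set 'I_N}) t w := - ((-1) ^+ #|(~: v)%SET| * D (Defs.merge v t z) w).
have main : {ae P, forall w, forall t,
    D t w = \sum_(v : {set 'I_N} | (v != finset.set0) && (#|v| != N)) f v t w}.
  apply: filterS3 nD G0 Z0 => w nw g0 z0 t.
  (* The origin lies on the hyperplane; this removes the term of the empty set, which [equivG]
     excludes. *)
  have D0 : D z w = 0.
    have z00 : \sum_(i < N) z i = 0 by rewrite big1.
    by rewrite /D (g0 _ z00) (z0 _ z00) subrr.
  have := nw z t; rewrite rect_incr_sumE.
  (* Complements are taken because the increment lists the coordinates set to 0, whereas [f] is
     indexed by those that are kept. *)
  rewrite (reindex_inj (@finset.setC_inj _))/=.
  have E (v : {set 'I_N}) : Defs.merge (~: v)%SET z t = Defs.merge v t z.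
    by apply/funext => i; rewrite /Defs.merge inE; case: (i \in v).
  rewrite (bigD1 [set: 'I_N]%SET)//= (bigD1 finset.set0)//=; last first.
    apply/eqP => e; have := cardsT 'I_N; rewrite -e cards0 card_ord => e'.
    by rewrite -e' in N0.
  rewrite !E finset.setCT cards0 expr0 mul1r.
  have -> : Defs.merge [set: 'I_N]%SET t z = t.
    by apply/funext => i; rewrite /Defs.merge inE.
  have -> : Defs.merge finset.set0 t z = z.
    by apply/funext => i; rewrite /Defs.merge inE.
  rewrite -/(D t w) -/(D z w) D0 mulr0 add0r => /eqP; rewrite addr_eq0 => /eqP ->.
  rewrite -sumrN; apply: eq_big => [v|v _]; last by rewrite /f E.
  rewrite andbC; congr (_ && _); congr (~~ _).
  have vN : (#|v| <= N)%N by apply: (leq_trans (max_card _)); rewrite card_ord.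
  by rewrite eqEcard finset.subsetT cardsT card_ord/= eqn_leq vN.
exists f; split; [|split].
- move=> v t t' w tt'; rewrite /f; congr (- (_ * D _ w)).
  by apply/funext => i; rewrite /Defs.merge; case: ifP => // /tt'.
- exact: main.
- apply: filterS3 main G0 Z0 => w mw g0 z0 t t0.
  by rewrite -mw /D (g0 _ t0) (z0 _ t0) subrr.
Qed.

End representation.

Theorem mainTheorem14 (R : realType) (N : nat) (d : measure_display)
  (Omega : measurableType d) (P : probability Omega R)
  (Theta : 'I_N -> R) (X : ('I_N -> R) -> Omega -> R) :
  (0 < N)%N -> (forall i, 0 < Theta i) -> is_field P X ->
  (stationary P X <->
     exists G : ('I_N -> R) -> Omega -> R,
       [/\ GTheta0 P Theta G,
           solves P Theta X G,
           init_cond P Theta X G,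
           represents P Theta X G &
           forall Y : ('I_N -> R) -> Omega -> R,
             is_field P Y -> solves P Theta Y G -> init_cond P Theta Y G ->
             equivTheta P Theta X Y])
  /\
  (stationary P X ->
     exists G0 : ('I_N -> R) -> Omega -> R,
       [/\ GTheta0 P Theta G0,
           represents P Theta X G0,
           {ae P, forall w, forall t : 'I_N -> R,
              G0 t w = Mop Theta (lamperti Theta X) t w} &
           forall G : ('I_N -> R) -> Omega -> R,
             GTheta0 P Theta G -> represents P Theta X G -> equivG P G G0]).
Proof.
(* Pathwise work is done on the version [Z]; it equals [X] almost surely for all [t] simultaneously,
   so statements about whole paths transfer. *)
move=> N0 th0 fX; have [Z rZ XZ] := regularize fX; have [mZ cZ] := rZ.
have mX := fX.1.
pose G0 := noise Theta Z.
have rG0 : regular_field G0 by exact: regular_field_noise.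
have XZt t : {ae P, forall w, X t w = Z t w} by apply: filterS XZ => w; apply.
have G00 : {ae P, forall w, forall t : 'I_N -> R, \sum_(i < N) t i = 0 -> G0 t w = 0}.
  by apply: aeW => w t t0; exact: regular_noise_path_tot0.
have fG0 : is_field P G0 by split; [exact: rG0.1|apply: aeW => w; exact: rG0.2].
have path w : (forall t, X t w = Z t w) -> (fun x => X x w) = Z^~ w.
  by move=> E; apply/funext => x; exact: E.
have forward : stationary P X -> GTheta0 P Theta G0 /\ represents P Theta X G0.
  move=> sX; have sZ := stationary_ae mX rZ XZ sX.
  have lim t := noise_expint_lim t th0 rZ sZ.
  split; first split=> //.
    split=> // [|t]; first exact: noise_stat_incr.
    by exists (fun w => expR (dotv Theta t) * Z t w); exact: lim.
  move=> t; exists (fun w => expR (dotv Theta t) * Z t w); split; first exact: lim.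
  by apply: filterS (XZt t) => w ->; rewrite mulrA -expRD addNr expR0 mul1r.
(* A pathwise identity, available before stationarity, which serves to place [G0] in [GTheta0] and
   to obtain the representation. *)
have solv : solves P Theta X G0.
  apply: filterS XZ => w /path ->.
  by apply/(langevin_pathP _ _ (cZ w)); exact: null_noise_path.
split; last first.
  move=> sX; have [g0 rep] := forward sX; exists G0; split=> //.
    apply: filterS XZ => w /path Ew t; rewrite Mop_lamperti Ew.
    by rewrite noise_pathE.
  move=> G [[fG sG limG] Gz] repG.
  have [H rH GH] := regularize fG.
  have [L [mL cL XL]] := represents_limits rH GH repG.
  have ZL t : {ae P, forall w, Z t w = expR (- dotv Theta t) * L t w}.
    by apply: filterS2 (XZt t) (XL t) => w <-.
  apply: equivG_of_null => //.
  apply: filterS2 (limits_determine_noise rZ rH mL cL ZL) GH => w nw Ew.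
  by under eq_fun do rewrite Ew.
split=> [sX|[G [[gG _] _ _ rep _]]]; last exact: stationary_of_represents th0 mX gG rep.
have [g0 rep] := forward sX; exists G0; split=> //.
  have [L [HL XL]] := rep (@zerov R N); exists L; split=> //.
  apply: filterS XL => w ->.
  by rewrite /dotv big1 ?oppr0 ?expR0 ?mul1r// => i _; rewrite /zerov mulr0.
move=> Y [mY cY] sY _.
(* With the noise in common, [expmul Theta] of both solutions agrees modulo [null] with the same
   function [Eall Theta] of [G0]; the difference is the required null function. *)
apply: filterS3 XZ cY (filterI solv sY) => w /path Ew cYw [].
rewrite Ew => /(langevin_pathP _ _ (cZ w)) n1 /(langevin_pathP _ _ cYw) n2.
have cG := rG0.2 w.
have e1 := proj1 (langevin_op_null Theta (cZ w) cG) n1.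
have e2 := proj1 (langevin_op_null Theta cYw cG) n2.
have := nullB e2 e1.
have XE x : X x w = Z x w by rewrite -[RHS]/((Z^~ w) x) -Ew.
rewrite (_ : (fun t => _) = (fun x => expR (dotv Theta x) * (X x w - Y x w))).
  by move=> H s t; exact: H.
by apply/funext => x; rewrite XE /expmul; ring.
Qed.
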